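(* Let $n\ge3$ be an odd integer, $k\ge1$ an integer, and let $t\in[0,1)$ be such that the family $C_{n,k}^t$ is defined. Then $|C_{n,1}^t|=2$, and for $k\ge2$ $$|C_{n,k}^t|=2\sum_{i=0}^{2n}\ \sum_{\substack{d\,:\,d\mid i,\\ d\mid(2n-i)k}}\frac{\varphi(d)}{i}\binom{(2n-i)k/d+i/d-1}{i/d-1},$$ where $\varphi$ is Euler's totient function and the term $i=0$ of the outer sum is understood to be the necklace number $\mathcal N_{0,2nk}=1$.
   Context: Tile: the closure of an open contractible plane region bounded by a simple closed curve. For an angle $\alpha$ and a point $p$, $\alpha_p$ denotes the anticlockwise rotation by $\alpha$ about $p$. If $\eta$ is a continuous planar curve segment without self-intersections with end-point $p$, and $\alpha\in(0,2\pi)$, then $[\eta,p,\alpha]$ is the contour consisting of $\eta$, $\eta'=\alpha_p(\eta)$ and the circular arc $\rho_p$ centred at $p$ joining the other end-points of $\eta$ and $\eta'$; if it is simple, the tile it bounds is written $\langle\eta,p,\alpha\rangle$ and is said to be radially generated by $p$. A wedge is a tile radially generated by exactly two points; it is symmetric if it has a line of symmetry. For odd $n\ge3$, an $n$-wedge is a wedge of the form $\langle\eta,p,\pi/n\rangle=\langle\nu,q,\pi/n\rangle$ with $p\ne q$. Groove length: for an $n$-wedge $\langle\eta,p,\pi/n\rangle=\langle\nu,q,\pi/n\rangle$ with $p\ne q$, let $r$ be the end-point of $\eta$ other than $p$ (an end-point of the arc $\rho_p$); the portion of $\eta$ from $q$ to $r$ is the groove and $|r-q|$ is the groove length (it is $0$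 if $r=q$). For symmetric $n$-wedges the grooves are straight segments and $r$ lies on the line through $p$ and $q$; scale so that the supremum of the possible groove lengths of symmetric $n$-wedges with given $p,q$ is $1$, so that the groove length is a number $t\in[0,1)$. The family $C_{n,k}^t$: let $\overline U=\langle\eta,p,\pi/n\rangle$ be a symmetric $n$-wedge with groove length $t$, where $t$ is small enough that $\overline U_k=\langle\eta,p,\pi/(nk)\rangle$ is a tile. The $2nk$ images of $\overline U_k$ under rotations about $p$ by multiples of $\pi/(nk)$ form a monohedral tiling $T_0$ of a disk centred at $p$. The union of any $k$ cyclically consecutive tiles of $T_0$ is a rotated copy of $\overline U$; flipping this block means replacing its $k$ tiles by their images under the reflection in the line of symmetry of that copy of $\overline U$. $C_{n,k}^t$ is the set of tilings of the disk obtained from $T_0$ by choosing any collection of (between $0$ and $2n$) blocks of $k$ consecutive tiles, no two blocks sharing a tile, and flipping each chosen block, together with the mirror images of all these tilings. Two tilings are counted as the same if one is mapped to the other by an orientation preserving affine transformation, and $|C_{n,k}^t|$ denotes the number of different tilings. The necklace number $\mathcal N_{a,b}$ is the number of cyclic necklaces with $a$ black beads and $b$ red beads, up to rotation (reflections are not identified). *)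

(* Defs.v *)
From mathcomp Require Import all_boot all_order all_algebra.
From mathcomp Require Import all_classical all_reals all_analysis.
Set Implicit Arguments.
Unset Strict Implicit.
Unset Printing Implicit Defensive.
Import Order.TTheory GRing.Theory Num.Theory.
Import numFieldNormedType.Exports.
Local Open Scope classical_set_scope.
Local Open Scope ring_scope.

(* The plane is R * R.  Its library norm is the sup norm, which induces the
   usual topology and bounded sets; Euclidean lengths use [edist]. *)

Definition edist (R : realType) (x y : R * R) : R :=
  Num.sqrt ((x.1 - y.1) ^+ 2 + (x.2 - y.2) ^+ 2).

(* Anticlockwise rotation by the angle a about p. *)
Definition rotation (R : realType) (a : R) (p z : R * R) : R * R :=
  (p.1 + (cos a * (z.1 - p.1) - sin a * (z.2 - p.2)),
   p.2 + (sin a * (z.1 - p.1) + cos a * (z.2 - p.2))).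

(* Reflection in the line through a and b (meaningful for a <> b): with
   u = b - a and w = z - a, it sends z to a + 2 (<w,u> / <u,u>) u - w. *)
Definition reflection (R : realType) (a b z : R * R) : R * R :=
  let u := b - a in
  let w := z - a in
  let c := 2 * (w.1 * u.1 + w.2 * u.2) / (u.1 ^+ 2 + u.2 ^+ 2) in
  (a.1 + (c * u.1 - w.1), a.2 + (c * u.2 - w.2)).

Definition symmetry_reflection (R : realType) (X : set (R * R))
    (s : R * R -> R * R) : Prop :=
  exists a b, [/\ a <> b, s = reflection a b & s @` X = X].

Definition affine_op (R : realType) (f : R * R -> R * R) : Prop :=
  exists a b c d e g : R, 0 < a * d - b * c /\
    forall z, f z = (a * z.1 + b * z.2 + e, c * z.1 + d * z.2 + g).

Definition contractible (T : topologicalType) (R : realType) (V : set T) : Prop :=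
  exists (c : T) (H : R * T -> T),
    [/\ V c,
        {within `[0, 1]%classic `*` V, continuous H},
        forall s x, s \in `[0, 1] -> V x -> V (H (s, x)),
        forall x, V x -> H (0, x) = x
      & forall x, V x -> H (1, x) = c].

Definition simple_closed_curve (R : realType) (a b : R) (c : R -> R * R) : Prop :=
  [/\ {within `[a, b], continuous c}, c a = c b &
      {in `[a, b[ &, injective c}].

(* The points off G lying in a bounded connected component of the complement. *)
Definition inside (R : realType) (G : set (R * R)) : set (R * R) :=
  [set z | ~ G z /\ bounded_set (connected_component (~` G) z)].

(* U is the tile bounded by c.  For a simple closed curve c the conditions on
   V = inside (image of c) hold by the Jordan-Schoenflies theorem. *)
Definition tile_bounded_by (R : realType) (a b : R) (c : R -> R * R)
    (U : set (R * R)) : Prop :=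
  simple_closed_curve a b c /\
  exists V : set (R * R),
    [/\ V = inside (c @` `[a, b]), open V, contractible R V,
        closure V `\` V = c @` `[a, b] & U = closure V].

(* The contour [eta, p, alpha], for eta parametrized by [0, 1] with eta 0 = p,
   as a closed curve on [0, 3]: first eta, then the arc swept by eta 1 in the
   rotation by alpha about p, then the rotated copy of eta, back to p. *)
Definition contour (R : realType) (eta : R -> R * R) (p : R * R) (alpha : R)
    (s : R) : R * R :=
  if s <= 1 then eta s
  else if s <= 2 then rotation (alpha * (s - 1)) p (eta 1)
  else rotation alpha p (eta (3 - s)).

(* U = <eta, p, alpha>.  Simplicity and continuity of the contour include those
   of eta. *)
Definition radial_tile (R : realType) (eta : R -> R * R) (p : R * R) (alpha : R)
    (U : set (R * R)) : Prop :=
  [/\ 0 < alpha < 2 * pi, eta 0 = p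
    & tile_bounded_by 0 3 (contour eta p alpha) U].

Definition radially_generated (R : realType) (U : set (R * R)) (p : R * R) : Prop :=
  exists eta alpha, radial_tile eta p alpha U.

Definition wedge (R : realType) (U : set (R * R)) : Prop :=
  exists p q : R * R, p <> q /\
    forall x, radially_generated U x <-> x = p \/ x = q.

Definition n_wedge (R : realType) (n : nat) (eta : R -> R * R) (p : R * R)
    (nu : R -> R * R) (q : R * R) (U : set (R * R)) : Prop :=
  [/\ wedge U, p <> q, radial_tile eta p (pi / n%:R) U
    & radial_tile nu q (pi / n%:R) U].

Definition symmetric_n_wedge (R : realType) (n : nat) (eta : R -> R * R)
    (p : R * R) (nu : R -> R * R) (q : R * R) (U : set (R * R)) : Prop :=
  n_wedge n eta p nu q U /\ exists s, symmetry_reflection U s.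

(* The groove is the portion of eta from q to r = eta 1, so q lies on eta. *)
Definition has_groove_length (R : realType) (eta : R -> R * R) (q : R * R)
    (l : R) : Prop :=
  (eta @` `[0, 1]) q /\ l = edist (eta 1) q.

Definition groove_lengths (R : realType) (n : nat) (p q : R * R) : set R :=
  [set l | exists eta nu U,
     symmetric_n_wedge n eta p nu q U /\ has_groove_length eta q l].

(* Angle of the position j among the 2nk positions around the disk. *)
Definition angle (R : realType) (n k j : nat) : R := j%:R * (pi / (n * k)%:R).

Definition T0_tile (R : realType) (n k : nat) (p : R * R) (Uk : set (R * R))
    (j : nat) : set (R * R) :=
  rotation (angle R n k j) p @` Uk.

(* m is one of the k cyclically consecutive positions starting at j. *)
Definition in_block (n k : nat) (j m : 'I_(2 * n * k)) : Prop :=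
  exists2 i, (i < k)%N & nat_of_ord m = ((j + i) %% (2 * n * k))%N.

(* A collection of blocks, given by their initial positions. *)
Definition disjoint_blocks (n k : nat) (A : set 'I_(2 * n * k)) : Prop :=
  forall j j' m, A j -> A j' -> in_block j m -> in_block j' m -> j = j'.

Definition flipped_tiling (R : realType) (n k : nat) (p : R * R)
    (Uk : set (R * R)) (A : set 'I_(2 * n * k))
    (s : 'I_(2 * n * k) -> R * R -> R * R) : set (set (R * R)) :=
  [set X |
    (exists2 m : 'I_(2 * n * k), (forall j, A j -> ~ in_block j m)
                               & X = T0_tile n k p Uk m) \/
    (exists j m : 'I_(2 * n * k),
       [/\ A j, in_block j m & X = s j @` T0_tile n k p Uk m])].

(* The block starting at j is a copy of U rotated by [angle n k j]. *)
Definition is_flipped_tiling (R : realType) (n k : nat) (p : R * R)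
    (U Uk : set (R * R)) (T : set (set (R * R))) : Prop :=
  exists (A : set 'I_(2 * n * k)) (s : 'I_(2 * n * k) -> R * R -> R * R),
    [/\ disjoint_blocks A,
        forall j, A j ->
          symmetry_reflection (rotation (angle R n k j) p @` U) (s j)
      & T = flipped_tiling p Uk A s].

Definition image_tiling (R : realType) (f : R * R -> R * R)
    (T : set (set (R * R))) : set (set (R * R)) :=
  [set f @` X | X in T].

(* Mirror images are taken in the lines through the centre p of the disk. *)
Definition C_family (R : realType) (n k : nat) (p : R * R) (U Uk : set (R * R)) :
    set (set (set (R * R))) :=
  [set T | is_flipped_tiling n k p U Uk T \/
     exists T' b, [/\ is_flipped_tiling n k p U Uk T', b <> p
                    & T = image_tiling (reflection p b) T']].

Definition same_tiling (R : realType) (T T' : set (set (R * R))) : Prop :=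
  exists2 f, affine_op f & image_tiling f T = T'.

Definition number_of_different_tilings (R : realType)
    (C : set (set (set (R * R)))) (m : nat) : Prop :=
  ([set [set T' | C T' /\ same_tiling T T'] | T in C] #= `I_m)%card.

(* Main.v *)
Require Import Defs.
From mathcomp Require Import all_boot all_order all_algebra.
From mathcomp Require Import fingroup action cyclic zmodp.
From mathcomp Require Import all_classical all_reals all_analysis.
From mathcomp Require Import ring lra zify.
Set Implicit Arguments.
Unset Strict Implicit.
Unset Printing Implicit Defensive.
Import Order.TTheory GRing.Theory Num.Theory.
Import numFieldNormedType.Exports.
Local Open Scope classical_set_scope.
Local Open Scope ring_scope.

(* Winding numbers of the contour of a radially generated tile show that its
   rotated copies tile the disk, and that no side crosses another one or enters a
   tile other than its two neighbours.  Hence a symmetry of the wedge cannot fix p: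
   it exchanges p and q, so that it is unique and a tiling of the family is given
   by the set of its flipped blocks.

   An affine map between two such tilings preserves the disk, so it is an isometry
   fixing p, and it permutes the tiles at p.  An isometry which fixes a point of a
   simple closed curve and preserves the curve fixes a second point of it; applied
   to contours, this shows that the isometry is not a reflection, and that for
   k >= 2 it sends flipped blocks to flipped blocks.  It is therefore a rotation by
   a multiple of pi / (n k), which translates the set of flipped blocks, and mirror
   images are never equivalent to unmirrored tilings.

   For k = 1 flipping changes nothing.  For k >= 2, sets of i disjoint blocks up to
   rotation correspond to sequences of i gaps of total length (2n - i)k up to cyclic
   shift, and these are counted by Burnside's lemma for the cyclic group of order
   i: the sequences fixed by an element of order d are determined by i/d gaps of
   total length (2n - i)k/d. *)

(** * Angles and their variation along curves *)

(** That a contour winds exactly once around its tile comes from a count: the contours of all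
    rotated copies add up to the boundary circle.

    The main obstacle is a reflection fixing [p] and preserving a flipped tile. A simple loop may
    well have such a symmetry, so a second fixed point is not yet a contradiction, and the shape of
    the groove has to enter. The symmetry [s] of the wedge maps the part of the contour beyond [q],
    through the end of the side and a little way along the arc, onto an initial part of the far
    side. Hence a flipped tile leaves [p] along [rt k \o e] and returns along [e]. A reflection
    exchanging these two ends becomes, after a rotation, a reflection that maps an initial part of
    [e] into [e], and therefore fixes it pointwise. If this part contains the image of a piece of
    arc, three points of a circle are collinear; otherwise it is the whole part from [p] to [q], and
    following one more point of the contour makes two sides meet away from [p]. *)

Section Angles.
Context {R : realType}.
Implicit Types (v d z : R * R) (t : R).

Definition along v t := exists2 r, 0 < r & v = (r * cos t, r * sin t).
Definition dot v d : R := v.1 * d.1 + v.2 * d.2.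
Definition cross v d : R := v.1 * d.2 - v.2 * d.1.

Lemma sin_atan (x : R) : sin (atan x) = x * cos (atan x).
Proof.
have c0 : cos (atan x) != 0.
  by rewrite gt_eqF// cos_gt0_pihalf// atan_gtNpi2 atan_ltpi2.
by rewrite -[X in X * _](atanK x) /tan -mulrA mulVf// mulr1.
Qed.

(** In the frame with first axis [d], the coordinates of [v] are proportional to [dot d v] and
    [cross d v]; the first is positive, so the arctangent of their ratio is the angle. *)
Lemma along_atan v d t : along d t -> 0 < dot d v ->
  along v (t + atan (cross d v / dot d v)).
Proof.
move=> [r r0 ->]; rewrite /dot /cross /= => dv.
set w := (X in atan X).
have c0 : 0 < cos (atan w) by rewrite cos_gt0_pihalf// atan_gtNpi2 atan_ltpi2.
have dvr : 0 < cos t * v.1 + sin t * v.2.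
  have -> : cos t * v.1 + sin t * v.2 =
    (r * cos t * v.1 + r * sin t * v.2) / r by field; rewrite gt_eqF.
  exact: divr_gt0.
exists ((cos t * v.1 + sin t * v.2) / cos (atan w)); first exact: divr_gt0.
have wE : w * (cos t * v.1 + sin t * v.2) = cos t * v.2 - sin t * v.1.
  by rewrite /w; field; rewrite !gt_eqF//= mulrC -mulrDl mulrC.
have cs := cos2Dsin2 t.
have E1 : cos (t + atan w) = cos (atan w) * (cos t - w * sin t).
  by rewrite cosD sin_atan; ring.
have E2 : sin (t + atan w) = cos (atan w) * (sin t + w * cos t).
  by rewrite sinD sin_atan; ring.
rewrite E1 E2; have cn : cos (atan w) != 0 by rewrite gt_eqF.
clearbody w; case: v dv dvr wE => x y /= dv dvr wE; congr pair.
  have -> : (cos t * x + sin t * y) / cos (atan w) *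
    (cos (atan w) * (cos t - w * sin t)) =
    (cos t * x + sin t * y) * cos t - (w * (cos t * x + sin t * y)) * sin t.
    by field.
  rewrite wE; transitivity (x * (cos t ^+ 2 + sin t ^+ 2)); last by ring.
  by rewrite cs mulr1.
have -> : (cos t * x + sin t * y) / cos (atan w) *
  (cos (atan w) * (sin t + w * cos t)) =
  (cos t * x + sin t * y) * sin t + (w * (cos t * x + sin t * y)) * cos t.
  by field.
rewrite wE; transitivity (y * (cos t ^+ 2 + sin t ^+ 2)); last by ring.
by rewrite cs mulr1.
Qed.

Lemma along_ex v : v <> 0 -> exists t, along v t.
Proof.
move=> v0; have [x0|x0|x0] := ltgtP v.1 0.
- exists (pi + atan (cross (-1, 0) v / dot (-1, 0) v)).
  apply: along_atan; last by rewrite /dot /=; lra.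
  by exists 1 => //; rewrite cospi sinpi; congr pair; ring.
- exists (0 + atan (cross (1, 0) v / dot (1, 0) v)).
  apply: along_atan; last by rewrite /dot /=; lra.
  by exists 1 => //; rewrite cos0 sin0; congr pair; ring.
have [y0|y0|y0] := ltgtP v.2 0.
- exists (- (pi / 2) + atan (cross (0, -1) v / dot (0, -1) v)).
  apply: along_atan; last by rewrite /dot /=; lra.
  by exists 1 => //; rewrite cosN sinN cos_pihalf sin_pihalf; congr pair; ring.
- exists (pi / 2 + atan (cross (0, 1) v / dot (0, 1) v)).
  apply: along_atan; last by rewrite /dot /=; lra.
  by exists 1 => //; rewrite cos_pihalf sin_pihalf; congr pair; ring.
by case: v0; case: v x0 y0 => x y /= -> ->.
Qed.

Lemma cosD2piz (m : int) t : cos (t + m%:~R * (pi *+ 2)) = cos t.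
Proof.
rewrite mulrC mulrzr; case: m => m.
  by rewrite -pmulrn (periodicn (@cosD2pi R)).
by rewrite NegzE -nmulrn -[in RHS](subrK (pi *+ 2 *+ m.+1) t)
  (periodicn (@cosD2pi R)).
Qed.

Lemma sinD2piz (m : int) t : sin (t + m%:~R * (pi *+ 2)) = sin t.
Proof.
rewrite mulrC mulrzr; case: m => m.
  by rewrite -pmulrn (periodicn (@sinD2pi R)).
by rewrite NegzE -nmulrn -[in RHS](subrK (pi *+ 2 *+ m.+1) t)
  (periodicn (@sinD2pi R)).
Qed.

Lemma cos_eq1 t : cos t = 1 -> exists m : int, t = m%:~R * (pi *+ 2).
Proof.
move=> c1; pose m := Num.floor (t / (pi *+ 2)); exists m.
have p0 := @pi_gt0 R.
have pp : 0 < pi *+ 2 :> R by rewrite pmulrn_lgt0.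
pose y := t - m%:~R * (pi *+ 2).
have y0 : 0 <= y.
  by rewrite /y subr_ge0 -ler_pdivlMr// Num.Theory.ge_floor.
have y1 : y < pi *+ 2.
  rewrite /y ltrBlDr -[X in X + _]mul1r -mulrDl -ltr_pdivrMr//.
  by have := floorD1_gt (t / (pi *+ 2)); rewrite intrD addrC.
have cy : cos y = 1.
  have -> : y = t + (- m)%:~R * (pi *+ 2) by rewrite /y intrN mulNr.
  by rewrite cosD2piz.
suff : y = 0 by move/eqP; rewrite /y subr_eq0 => /eqP.
have [yp|yp] := leP y pi.
  have I0 : 0 \in `[0, pi : R]%R by rewrite in_itv/= lexx ltW.
  by apply: (@cos_inj R) => //; rewrite ?in_itv/= ?y0 ?yp// cy cos0.
have cy' : cos (pi *+ 2 - y) = 1.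
  by rewrite -cosN opprB -(cosD2pi (y - pi *+ 2)) subrK.
have : pi *+ 2 - y = 0.
  have I0 : 0 \in `[0, pi : R]%R by rewrite in_itv/= lexx ltW.
  apply: (@cos_inj R) => //; last by rewrite cy' cos0.
  by rewrite in_itv/= subr_ge0 ltW//= mulr2n; lra.
lra.
Qed.

Lemma along_uniq v t t' : along v t -> along v t' ->
  exists m : int, t' = t + m%:~R * (pi *+ 2).
Proof.
move=> [r r0 ->] [r' r0' []] e1 e2.
have rr : r = r'.
  have : r ^+ 2 = r' ^+ 2.
    transitivity ((r * cos t) ^+ 2 + (r * sin t) ^+ 2).
      by rewrite !exprMn -mulrDr cos2Dsin2 mulr1.
    by rewrite e1 e2 !exprMn -mulrDr cos2Dsin2 mulr1.
  by move/eqP; rewrite eqrXn2 ?ltW// => /eqP.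
move: e1 e2; rewrite -rr => /(mulfI (lt0r_neq0 r0)) e1 /(mulfI (lt0r_neq0 r0)) e2.
have [|m mE] := @cos_eq1 (t' - t).
  by rewrite cosB -e1 -e2 -!expr2 cos2Dsin2.
by exists m; rewrite -mE addrC subrK.
Qed.

Lemma alongD2pi v t (m : int) : along v t -> along v (t + m%:~R * (pi *+ 2)).
Proof. by move=> [r r0 ->]; exists r => //; rewrite cosD2piz sinD2piz. Qed.

End Angles.

(** * Continuity of real and planar maps; real induction *)

Section ContinuousPaths.
Context {R : realType}.
Implicit Types (T : topologicalType).

Lemma cont_fst T (c : T -> R * R) : continuous c -> continuous (fun t => (c t).1).
Proof. by move=> cc t; apply: cvg_comp; [exact: cc|exact: cvg_fst]. Qed.

Lemma cont_snd T (c : T -> R * R) : continuous c -> continuous (fun t => (c t).2).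
Proof. by move=> cc t; apply: cvg_comp; [exact: cc|exact: cvg_snd]. Qed.

Lemma cont_pair T (f g : T -> R) : continuous f -> continuous g ->
  continuous (fun t => (f t, g t)).
Proof. by move=> cf cg t; exact: (cvg_pair (cf t) (cg t)). Qed.

Lemma cont_cst T (k : R) : continuous (fun _ : T => k).
Proof. exact: cst_continuous. Qed.

Lemma contD T (f g : T -> R) : continuous f -> continuous g ->
  continuous (fun t => f t + g t).
Proof. by move=> cf cg t; apply: cvgD; [exact: cf|exact: cg]. Qed.

Lemma contN T (f : T -> R) : continuous f -> continuous (fun t => - f t).
Proof. by move=> cf t; apply: cvgN; exact: cf. Qed.

Lemma contB T (f g : T -> R) : continuous f -> continuous g ->
  continuous (fun t => f t - g t).
Proof. by move=> cf cg; apply: contD => //; exact: contN. Qed.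

Lemma contM T (f g : T -> R) : continuous f -> continuous g ->
  continuous (fun t => f t * g t).
Proof. by move=> cf cg t; apply: cvgM; [exact: cf|exact: cg]. Qed.

(** Composition with [clamp] turns a function continuous on a segment into one continuous on the
    whole line, which avoids subspace topologies. *)
Definition clamp (a b t : R) := Num.max a (Num.min b t).

Lemma clampP a b t : a <= b -> a <= clamp a b t <= b.
Proof. by move=> ab; rewrite /clamp le_max lexx/= ge_max ab ge_min lexx. Qed.

Lemma clamp_id a b t : a <= t <= b -> clamp a b t = t.
Proof. by move=> /andP[ta tb]; rewrite /clamp min_r// max_r. Qed.

Lemma cont_id : continuous (fun t : R => t).
Proof. by move=> t; exact: cvg_id. Qed.

Lemma cont_clamp a b : continuous (clamp a b).
Proof.
move=> t; apply: (@continuous_max R R (fun=> a) (fun t => Num.min b t)).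
  exact: cvg_cst.
apply: (@continuous_min R R (fun=> b) (fun t => t)); first exact: cvg_cst.
exact: cvg_id.
Qed.

Lemma cont_within_clamp T (f : R -> T) a b : a <= b ->
  {within `[a, b], continuous f} -> continuous (f \o clamp a b).
Proof.
move=> ab /subspace_continuousP cf t.
apply: (@cvg_comp _ _ _ _ _ _ (within `[a, b] (nbhs (clamp a b t)))); last first.
  by apply: cf; rewrite /= in_itv/= clampP.
move=> A wA; rewrite /nbhs /=.
suff : \forall u \near t, A (clamp a b u) by [].
have : \forall u \near t, `[a, b]%classic (clamp a b u) -> A (clamp a b u).
  exact: (@cont_clamp a b t [set x | `[a, b]%classic x -> A x]).
by apply: filterS => u; apply; rewrite /= in_itv/= clampP.
Qed.

(** The local step at the supremum of the points satisfying [P] carries [P] from a point just before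
    the supremum to one beyond it, unless the supremum is [b]. *)
Lemma real_induction (P : R -> Prop) a b : a <= b -> P a ->
  (forall s, a <= s <= b -> exists2 e, 0 < e & forall t t', a <= t -> t <= t' ->
     t' <= b -> `|t - s| < e -> `|t' - s| < e -> P t -> P t') -> P b.
Proof.
move=> ab Pa H; pose S := [set t | a <= t <= b /\ P t].
have Sa : S a by split => //; rewrite lexx.
have hS : has_sup S by split; [exists a|exists b => t [/andP[]]].
have as_ : a <= sup S by apply: ub_le_sup => //; case: hS.
have sb : sup S <= b by apply: ge_sup; [exists a|move=> t [/andP[]]].
have [|e e0 He] := H (sup S); first by rewrite as_.
have [t [/andP[ta tb] Pt] st] := sup_adherent e0 hS.
have ts : t <= sup S by apply: ub_le_sup; [case: hS|split => //; rewrite ta].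
pose t' := Num.min b (sup S + e / 2).
have e2 : 0 < e / 2 by rewrite divr_gt0.
have tt' : t <= t' by rewrite /t' le_min tb/=; lra.
have t'b : t' <= b by rewrite /t' ge_min lexx.
have st' : sup S <= t' by rewrite /t' le_min sb/=; lra.
have t's : t' <= sup S + e / 2 by rewrite /t' ge_min lexx orbT.
have Pt' : P t'.
  apply: (He t) => //.
    by rewrite ltr_norml; apply/andP; split; lra.
  by rewrite ltr_norml; apply/andP; split; lra.
have : t' <= sup S.
  by apply: ub_le_sup; [case: hS|split => //; rewrite (le_trans ta)].
move=> t's'; have bs : b = t'.
  move: t's'; rewrite /t'; case: (leP b (sup S + e / 2)) => // _; lra.
by rewrite bs.
Qed.

End ContinuousPaths.

(** * Continuous arguments along a curve and their variation *)

Section Variation.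
Context {R : realType}.
Implicit Types (v w d z x : R * R) (c : R -> R * R) (a b : R) (f : R -> R).

(** A perturbation shorter than [v] cannot turn it by a right angle; this is what makes winding
    numbers locally constant. *)
Lemma dot_gt0 v w : dot w w < dot v v -> 0 < dot v (v + w).
Proof.
case: v w => [v1 v2] [w1 w2]; rewrite /dot /= => H.
have := sqr_ge0 (v1 + w1); have := sqr_ge0 (v2 + w2).
rewrite !expr2; nra.
Qed.

Lemma cont_sub c z : continuous c -> continuous (fun t => c t - z).
Proof.
move=> cc; apply: cont_pair; apply: contB; do ?exact: cont_cst.
- exact: cont_fst.
- exact: cont_snd.
Qed.

Lemma cont_dot c1 c2 : continuous c1 -> continuous c2 ->
  continuous (fun t => dot (c1 t) (c2 t)).
Proof.
by move=> h1 h2; apply: contD; apply: contM;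
  [exact: cont_fst|exact: cont_fst|exact: cont_snd|exact: cont_snd].
Qed.

Lemma cont_cross c1 c2 : continuous c1 -> continuous c2 ->
  continuous (fun t => cross (c1 t) (c2 t)).
Proof.
by move=> h1 h2; apply: contB; apply: contM;
  [exact: cont_fst|exact: cont_snd|exact: cont_snd|exact: cont_fst].
Qed.

(* The principal angle from v to w, when dot v w > 0. *)
Definition turn v w : R := atan (cross v w / dot v w).

Lemma cont_turn c1 c2 : continuous c1 -> continuous c2 ->
  (forall t, 0 < dot (c1 t) (c2 t)) -> continuous (fun t => turn (c1 t) (c2 t)).
Proof.
move=> h1 h2 h t; apply: continuous_comp; last exact: continuous_atan.
apply: cvgM; first exact: cont_cross.
apply: cvgV; first by rewrite gt_eqF.
exact: cont_dot.
Qed.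

Definition lift c z a b f :=
  continuous f /\ forall t, a <= t <= b -> along (c t - z) (f t).

(** Seen from [z], the curve stays on [[t0, t1]] in an open half-plane, where the principal angle
    from [d] is continuous. Its increment is added to [f t0], which differs from the argument read
    from [d] at [t0] by a multiple of 2 pi. *)
Lemma lift_extend c z a t0 t1 f d : continuous c -> a <= t0 -> t0 <= t1 ->
  lift c z a t0 f -> (forall t, t0 <= t <= t1 -> 0 < dot d (c t - z)) ->
  exists g, lift c z a t1 g.
Proof.
move=> cc at0 t01 [cf hf] hd.
have d0 : d <> 0.
  move=> d0; have := hd t0; rewrite d0 lexx t01 /dot /= !mul0r addr0 ltxx.
  by move/(_ isT).
have [u0 du0] := along_ex d0.
pose g t := turn d (c (clamp t0 t1 t) - z).
have cg : continuous g.
  apply: cont_turn; first by move=> ?; exact: cvg_cst.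
    apply: (@cont_sub (c \o clamp t0 t1)) => t.
    by apply: continuous_comp; [exact: cont_clamp|exact: cc].
  by move=> t; apply: hd; exact: clampP.
have gt0 : g t0 = turn d (c t0 - z) by rewrite /g clamp_id// lexx.
have [m mE] : exists m : int, u0 + g t0 = f t0 + m%:~R * (pi *+ 2).
  apply: along_uniq; first by apply: hf; rewrite lexx at0.
  by rewrite gt0; apply: along_atan => //; apply: hd; rewrite lexx.
exists (fun t => f (clamp a t0 t) + (g t - g t0)); split.
  apply: contD; last first.
    by apply: contB => //; exact: cont_cst.
  move=> t; apply: (@continuous_comp _ _ _ (clamp a t0) f); last exact: cf.
  exact: cont_clamp.
move=> t /andP[ta tt1]; have [tt0|tt0] := leP t t0.
  rewrite (@clamp_id _ a t0) ?ta// [X in _ + (X - _)]/g.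
  have -> : clamp t0 t1 t = t0 by rewrite /clamp min_r ?max_l.
  by rewrite -gt0 subrr addr0; apply: hf; rewrite ta.
have -> : clamp a t0 t = t0 by rewrite /clamp min_l ?max_r// ltW.
have -> : f t0 + (g t - g t0) = (u0 + g t) + (- m)%:~R * (pi *+ 2).
  by rewrite intrN; lra.
apply: alongD2pi; rewrite /g clamp_id ?tt1 ?(ltW tt0)//.
by apply: along_atan => //; apply: hd; rewrite tt1 ltW.
Qed.

(** By real induction: near a parameter [s] the curve stays in the half-plane of direction
    [c s - z], where a lift extends. *)
Lemma lift_ex c z a b : continuous c -> a <= b ->
  (forall t, a <= t <= b -> c t <> z) -> exists f, lift c z a b f.
Proof.
move=> cc ab cz; apply: (@real_induction R (fun t => exists f, lift c z a t f) a) => //.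
  have [|u cu] := @along_ex _ (c a - z).
    by move/eqP; rewrite subr_eq0 => /eqP; apply: cz; rewrite lexx.
  exists (fun=> u); split; first by move=> ?; exact: cvg_cst.
  by move=> t; rewrite -eq_le => /eqP <-.
move=> s sab; pose d := c s - z.
have dd : 0 < dot d d.
  have d0 : d <> 0 by move/eqP; rewrite subr_eq0 => /eqP; exact: cz.
  have [u [r r0 ->]] := along_ex d0; rewrite /dot /= -!expr2 !exprMn -mulrDr.
  by rewrite cos2Dsin2 mulr1 exprn_gt0.
have : \forall t \near s, 0 < dot d (c t - z).
  have cd : continuous (fun t => dot d (c t - z)).
    by apply: cont_dot; [move=> ?; exact: cvg_cst|exact: cont_sub].
  exact: (cvgr_gt _ (cd s) _ dd).
move=> /nbhs_ballP[e /= e0 He]; exists e => // t t' ta tt' t'b hts ht's [f hf].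
apply: (lift_extend cc ta tt' hf (d := d)) => u /andP[tu ut'].
apply: He; rewrite /ball /=; rewrite distrC ltr_norml in hts.
move: ht's; rewrite ltr_norml => /andP[_ h1]; move/andP: hts => [_ h2].
by rewrite ltr_norml; apply/andP; split; lra.
Qed.

(** The difference of two lifts, divided by 2 pi, is continuous and integer-valued; if it took two
    values it would also take a half-integer one. *)
Lemma lift_uniq c z a b f g : a <= b -> lift c z a b f -> lift c z a b g ->
  f b - f a = g b - g a.
Proof.
move=> ab [cf hf] [cg hg]; pose h t := (g t - f t) / (pi *+ 2).
have pp : pi *+ 2 != 0 :> R by rewrite mulrn_eq0/= gt_eqF ?pi_gt0.
have hE t : a <= t <= b -> exists m : int, h t = m%:~R.
  move=> tab; have [m mE] := along_uniq (hf _ tab) (hg _ tab); exists m.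
  by rewrite /h mE addrAC subrr add0r mulfK.
suff e : h a = h b.
  have : h a * (pi *+ 2) = h b * (pi *+ 2) by rewrite e.
  rewrite /h !mulfVK//; lra.
have ch : continuous h.
  by apply: contM; [exact: contB|exact: cont_cst].
have [ma maE] : exists m : int, h a = m%:~R by apply: hE; rewrite lexx ab.
have [mb mbE] : exists m : int, h b = m%:~R by apply: hE; rewrite lexx ab.
suff mab : ma = mb by rewrite maE mbE mab.
have key (m1 m2 : int) : (m1 < m2)%R ->
    (Num.min (h a) (h b) <= m1%:~R) -> m2%:~R <= Num.max (h a) (h b) -> False.
  move=> m12 h1 h2.
  have m12' : m1%:~R + 1 <= m2%:~R :> R by rewrite -[1]/(1%:~R) -intrD ler_int lezD1.
  have [|//||t tab hm] := @IVT R h a b (m1%:~R + 2^-1).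
  - exact: ab.
  - exact: continuous_subspaceT.
  - apply/andP; split; first by apply: (le_trans h1); rewrite lerDl invr_ge0.
    by apply: le_trans h2; lra.
  have [m mE] := hE t tab; move: hm; rewrite mE => hm.
  have : (m - m1)%:~R * 2 = 1%:~R :> R by rewrite intrB; lra.
  rewrite -[2]/(2%:~R) -intrM => /intr_inj; lia.
have [mm|mm|//] := ltgtP ma mb.
- case: (key _ _ mm); rewrite maE mbE ?ge_min ?le_max lexx ?orbT//.
- case: (key _ _ mm); rewrite maE mbE ?ge_min ?le_max lexx ?orbT//.
Qed.

(** The value is 0 by default when the curve has no continuous argument around [z]. *)
Definition var c z a b : R :=
  xget 0 [set u | exists2 f, lift c z a b f & u = f b - f a].

Lemma varE c z a b f : a <= b -> lift c z a b f -> var c z a b = f b - f a.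
Proof.
move=> ab hf; rewrite /var; case: xgetP => [u _ /= [g hg ->]|].
  exact: (lift_uniq ab hg hf).
by move/(_ (f b - f a)) => /=; case; exists f.
Qed.

Lemma var_cat c z a b e : continuous c -> a <= b -> b <= e ->
  (forall t, a <= t <= e -> c t <> z) ->
  var c z a e = var c z a b + var c z b e.
Proof.
move=> cc ab be hc; have [f [cf hf]] := lift_ex cc (le_trans ab be) hc.
rewrite (varE (le_trans ab be) (conj cf hf)) (varE (f := f) ab).
  rewrite (varE (f := f) be); first by ring.
  by split => // t /andP[bt te]; apply: hf; rewrite (le_trans ab bt).
by split => // t /andP[at_ tb]; apply: hf; rewrite at_ (le_trans tb be).
Qed.

Lemma var_turn c z d a b : continuous c -> a <= b ->
  (forall t, a <= t <= b -> 0 < dot d (c t - z)) ->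
  var c z a b = turn d (c b - z) - turn d (c a - z).
Proof.
move=> cc ab hd.
have d0 : d <> 0.
  move=> d0; have := hd a; rewrite d0 lexx ab /dot /= !mul0r addr0 ltxx.
  by move/(_ isT).
have [u0 du0] := along_ex d0.
pose g t := u0 + turn d (c (clamp a b t) - z).
rewrite (varE (f := g) ab).
  by rewrite /g !clamp_id ?lexx ?ab//; ring.
split.
  apply: contD; first exact: cont_cst.
  apply: cont_turn; first by move=> ?; exact: cvg_cst.
    apply: (@cont_sub (c \o clamp a b)) => t.
    by apply: continuous_comp; [exact: cont_clamp|exact: cc].
  by move=> t; apply: hd; exact: clampP.
by move=> t tab; rewrite /g clamp_id//; apply: along_atan => //; exact: hd.
Qed.

(** The angle between the two views of [c t] is acute, so it varies continuously and can be added to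
    a lift. Only its end values remain, and these cancel over a closed chain. *)
Lemma var_move c z z' a b : continuous c -> a <= b ->
  (forall t, a <= t <= b -> c t <> z) ->
  (forall t, a <= t <= b -> 0 < dot (c t - z) (c t - z')) ->
  var c z' a b = var c z a b + (turn (c b - z) (c b - z') - turn (c a - z) (c a - z')).
Proof.
move=> cc ab cz hd; have [f [cf hf]] := lift_ex cc ab cz.
pose g t := f t + turn (c (clamp a b t) - z) (c (clamp a b t) - z').
have cC : continuous (c \o clamp a b).
  by move=> t; apply: continuous_comp; [exact: cont_clamp|exact: cc].
rewrite (varE ab (conj cf hf)) (varE (f := g) ab).
  by rewrite /g !clamp_id ?lexx ?ab//; ring.
split.
  apply: contD => //.
  apply: cont_turn; [exact: (cont_sub (z := z) cC)|exact: (cont_sub (z := z') cC)|].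
  by move=> t; apply: hd; exact: clampP.
move=> t tab; rewrite /g clamp_id//; apply: along_atan; first exact: hf.
exact: hd.
Qed.

End Variation.

(** * Winding numbers of chains of curves *)

Section Winding.
Context {R : realType}.
Implicit Types (p v w d z x y : R * R) (c : R -> R * R) (a b : R) (f : R -> R).

(** The squared Euclidean distance is polynomial, which keeps square roots out of all later
    computations. *)
Definition d2 x y : R := dot (x - y) (x - y).

Lemma d2_ge0 x y : 0 <= d2 x y.
Proof. by rewrite /d2 /dot -!expr2 addr_ge0// sqr_ge0. Qed.

Lemma d2xx x : d2 x x = 0.
Proof. by rewrite /d2 subrr /dot /= !mul0r addr0. Qed.

Lemma d2C x y : d2 x y = d2 y x.
Proof. by rewrite /d2 /dot /=; ring. Qed.

Lemma d2_eq0 x y : d2 x y = 0 -> x = y.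
Proof.
case: x y => [x1 x2] [y1 y2]; rewrite /d2 /dot /= => /eqP.
by rewrite -!expr2 paddr_eq0 ?sqr_ge0// !sqrf_eq0 !subr_eq0 => /andP[/eqP-> /eqP->].
Qed.

Lemma d2_gt0 x y : x <> y -> 0 < d2 x y.
Proof.
by move=> xy; rewrite lt_neqAle d2_ge0 andbT eq_sym; apply/eqP => /d2_eq0.
Qed.

Lemma nbhs_d2 z (A : set (R * R)) :
  nbhs z A <-> exists2 e, 0 < e & forall y, d2 y z < e -> A y.
Proof.
split => [/nbhs_ballP[e /= e0 He]|[e e0 He]].
  exists (e ^+ 2); first exact: exprn_gt0.
  move=> y; rewrite /d2 /dot /= => h; apply: He.
  have h1 : (y.1 - z.1) ^+ 2 < e ^+ 2.
    by apply: le_lt_trans h; rewrite expr2 lerDl -expr2 sqr_ge0.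
  have h2 : (y.2 - z.2) ^+ 2 < e ^+ 2.
    by apply: le_lt_trans h; rewrite expr2 lerDr -expr2 sqr_ge0.
  have k (t : R) : t ^+ 2 < e ^+ 2 -> `|t| < e.
    move=> te; rewrite ltNge; apply/negP => et; move: te.
    rewrite -(real_normK (num_real t)) ltNge => /negP; apply.
    by rewrite lerXn2r ?nnegrE// ltW.
  by split; rewrite /ball /= distrC; exact: k.
apply/nbhs_ballP; pose u := Num.min 1 (e / 2).
have u0 : 0 < u by rewrite lt_min ltr01 divr_gt0.
have u1 : u <= 1 by rewrite ge_min lexx.
have ue : u <= e / 2 by rewrite ge_min lexx orbT.
exists u => // y [/= h1 h2]; apply: He.
rewrite /ball /= distrC in h1; rewrite /ball /= distrC in h2.
have k (t : R) : `|t| < u -> t ^+ 2 < e / 2.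
  move=> tu; rewrite -real_normK ?num_real//.
  have : `|t| ^+ 2 < u ^+ 2 by rewrite ltr_pXn2r ?nnegrE// ltW.
  rewrite !expr2; nra.
rewrite /d2 /dot /= -!expr2; have := k _ h1; have := k _ h2; lra.
Qed.

Lemma open_d2 (A : set (R * R)) :
  (forall z, A z -> exists2 e, 0 < e & forall y, d2 y z < e -> A y) -> open A.
Proof. by move=> H; rewrite openE => z /H /nbhs_d2. Qed.

Lemma open_d2P (A : set (R * R)) z : open A -> A z ->
  exists2 e, 0 < e & forall y, d2 y z < e -> A y.
Proof. by rewrite openE => oA /oA /nbhs_d2. Qed.

Lemma closure_d2 (A : set (R * R)) z :
  closure A z <-> forall e, 0 < e -> exists2 y, A y & d2 y z < e.
Proof.
split=> [cA e e0|H B /nbhs_d2[e e0 He]].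
  have [|y [Ay ye]] := cA [set y | d2 y z < e]; first by apply/nbhs_d2; exists e.
  by exists y.
by have [y Ay yz] := H e e0; exists y; split => //; exact: He.
Qed.

Lemma rotation_sub t p x y :
  rotation t p x - rotation t p y =
  (cos t * (x.1 - y.1) - sin t * (x.2 - y.2),
   sin t * (x.1 - y.1) + cos t * (x.2 - y.2)).
Proof. by rewrite /rotation; congr pair; rewrite /=; ring. Qed.

Lemma along_rotation v u t : along v u ->
  along (cos t * v.1 - sin t * v.2, sin t * v.1 + cos t * v.2) (u + t).
Proof.
by move=> [r r0 ->]; exists r => //=; rewrite cosD sinD; congr pair; ring.
Qed.

Lemma cont_rotation t p : continuous (rotation t p).
Proof.
have c1 : continuous (fun z : R * R => z.1) by move=> z; exact: cvg_fst.
have c2 : continuous (fun z : R * R => z.2) by move=> z; exact: cvg_snd.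
by apply: cont_pair; apply: contD; rewrite ?/GRing.one; do ?[exact: cont_cst];
  first [apply: contB|apply: contD]; apply: contM; do ?exact: cont_cst;
  apply: contB => //; exact: cont_cst.
Qed.

Lemma cont_comp (T U V : topologicalType) (f : T -> U) (g : U -> V) :
  continuous f -> continuous g -> continuous (g \o f).
Proof. by move=> cf cg t; apply: continuous_comp; [exact: cf|exact: cg]. Qed.

Lemma var_rotation c t p z a b : continuous c -> a <= b ->
  (forall u, a <= u <= b -> c u <> z) ->
  var (rotation t p \o c) (rotation t p z) a b = var c z a b.
Proof.
move=> cc ab cz; have [f [cf hf]] := lift_ex cc ab cz.
rewrite (varE ab (conj cf hf)) (varE (f := fun u => f u + t) ab); first by ring.
split; first by apply: contD => //; exact: cont_cst.
by move=> u uab; rewrite /= rotation_sub; exact: (along_rotation t (hf u uab)).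
Qed.

Lemma var_shift c h z a b : continuous c -> a <= b ->
  (forall u, a + h <= u <= b + h -> c u <> z) ->
  var (fun u => c (u + h)) z a b = var c z (a + h) (b + h).
Proof.
move=> cc ab cz; have abh : a + h <= b + h by rewrite lerD2r.
have [f [cf hf]] := lift_ex cc abh cz.
rewrite (varE abh (conj cf hf)) (varE (f := fun u => f (u + h)) ab)//.
split.
  by apply: (cont_comp (f := fun u => u + h)) => //; apply: contD;
    [exact: cont_id|exact: cont_cst].
by move=> u /andP[au ub]; apply: hf; rewrite !lerD2r au.
Qed.

Lemma var_ext c c' z a b : a <= b -> (forall u, a <= u <= b -> c u = c' u) ->
  var c z a b = var c' z a b.
Proof.
move=> ab cE; rewrite /var; congr xget; apply/seteqP; split => u [f [cf hf] ->];
  exists f => //; split => // t tab; first by rewrite -cE//; exact: hf.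
by rewrite cE//; exact: hf.
Qed.

(* A chain is a formal integer combination of paths; it is closed when its
   boundary vanishes, which is tested against all functions of the end-points. *)
Record piece := Piece { coef : int ; curve : R -> R * R ; lo : R ; hi : R }.
Implicit Types (ch : seq piece) (e : piece) (A : R * R -> R).

(** By recursion, so that on an explicit chain the condition computes to a nested conjunction. *)
Fixpoint allp (P : piece -> Prop) ch : Prop :=
  if ch is e :: ch' then P e /\ allp P ch' else True.

Definition ok_chain ch := allp (fun e => continuous (curve e) /\ lo e <= hi e) ch.

Definition avoids ch z :=
  allp (fun e => forall t, lo e <= t <= hi e -> curve e t <> z) ch.

Definition wind ch z : R :=
  \sum_(e <- ch) (coef e)%:~R * var (curve e) z (lo e) (hi e).

Definition bound A ch : R :=
  \sum_(e <- ch) (coef e)%:~R * (A (curve e (hi e)) - A (curve e (lo e))).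

Definition closed_chain ch := forall A, bound A ch = 0.

Lemma wind_turn ch z d : ok_chain ch ->
  allp (fun e => forall t, lo e <= t <= hi e -> 0 < dot d (curve e t - z)) ch ->
  wind ch z = bound (fun x => turn d (x - z)) ch.
Proof.
rewrite /wind /bound; elim: ch => [|e ch IH] /=; first by rewrite !big_nil.
move=> [[ce abe] oc] [he hc]; rewrite !big_cons IH//; congr (_ + _).
by rewrite (@var_turn _ _ _ d).
Qed.

Lemma wind_move ch z z' : ok_chain ch -> avoids ch z ->
  allp (fun e => forall t, lo e <= t <= hi e ->
    0 < dot (curve e t - z) (curve e t - z')) ch ->
  wind ch z' = wind ch z + bound (fun x => turn (x - z) (x - z')) ch.
Proof.
rewrite /wind /bound; elim: ch => [|e ch IH] /=; first by rewrite !big_nil addr0.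
move=> [[ce abe] oc] [ae ac] [he hc]; rewrite !big_cons IH//.
by rewrite (@var_move _ _ z)//; ring.
Qed.

(** For a fixed, possibly discontinuous, choice [A] of arguments, the variation along a piece is the
    difference of [A] at its ends up to a multiple of 2 pi, and these differences cancel on a closed
    chain. *)
Lemma wind_int ch z : ok_chain ch -> avoids ch z -> closed_chain ch ->
  exists m : int, wind ch z = m%:~R * (pi *+ 2).
Proof.
pose A x : R := xget 0 [set t | along (x - z) t].
have AP x : x <> z -> along (x - z) (A x).
  move=> xz; rewrite /A; case: xgetP => [t _ //|H].
  have [|t xt] := @along_ex R (x - z); last by case: (H t).
  by move/eqP; rewrite subr_eq0 => /eqP.
move=> oc ac cl; suff [m ->] : exists m : int,
  wind ch z = bound A ch + m%:~R * (pi *+ 2) by exists m; rewrite cl add0r.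
rewrite /wind /bound; elim: ch oc ac {cl} => [|e ch IH] /=.
  by move=> _ _; exists 0; rewrite !big_nil; ring.
move=> [[ce abe] oc] [ae ac]; have [m mE] := IH oc ac.
rewrite !big_cons mE; have [f [cf hf]] := lift_ex ce abe ae.
rewrite (varE abe (conj cf hf)).
have ll : lo e <= lo e <= hi e by rewrite lexx.
have hh : lo e <= hi e <= hi e by rewrite lexx andbT.
have [m1 E1] := along_uniq (AP _ (ae _ ll)) (hf _ ll).
have [m2 E2] := along_uniq (AP _ (ae _ hh)) (hf _ hh).
exists (m + coef e * (m2 - m1)); rewrite E1 E2 intrD intrM intrB.
ring.
Qed.

Lemma dist_chain ch z : ok_chain ch -> avoids ch z ->
  exists2 r, 0 < r & allp (fun e => forall t, lo e <= t <= hi e ->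
    r <= d2 (curve e t) z) ch.
Proof.
elim: ch => [|e ch IH] /=; first by move=> _ _; exists 1.
move=> [[ce abe] oc] [ae ac]; have [r r0 hr] := IH oc ac.
have [|t tab ht] := @EVT_min R (fun t => d2 (curve e t) z) (lo e) (hi e) abe.
  apply: continuous_subspaceT; apply: cont_dot; exact: cont_sub.
pose s := Num.min r (d2 (curve e t) z).
have s0 : 0 < s by rewrite lt_min r0/= d2_gt0//; apply: ae; rewrite in_itv in tab.
exists s => //; split.
  by move=> u uab; rewrite ge_min ht ?orbT// in_itv.
elim: ch hr {IH oc ac} => //= e' ch IH [h1 h2]; split; last exact: IH.
by move=> u /h1 h; rewrite ge_min h.
Qed.

Lemma wind_near ch z : ok_chain ch -> avoids ch z -> closed_chain ch ->
  exists2 r, 0 < r & forall y, d2 y z < r -> avoids ch y /\ wind ch y = wind ch z.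
Proof.
move=> oc ac cl; have [r r0 hr] := dist_chain oc ac; exists r => // y yr.
split.
  elim: ch {oc ac cl} hr => //= e ch IH [h1 h2]; split; last exact: IH.
  by move=> t /h1 h yt; move: h; rewrite yt leNgt yr.
rewrite (@wind_move _ z)// ?cl ?addr0//.
elim: ch {oc ac cl} hr => //= e ch IH [h1 h2]; split; last exact: IH.
move=> t /h1 h; have -> : curve e t - y = (curve e t - z) + (z - y).
  by rewrite addrA subrK.
by apply: dot_gt0; rewrite -/(d2 z y) -/(d2 _ z) d2C (lt_le_trans yr).
Qed.

Lemma wind_connected ch (K : set (R * R)) : ok_chain ch -> closed_chain ch ->
  connected K -> (forall z, K z -> avoids ch z) ->
  forall z z', K z -> K z' -> wind ch z = wind ch z'.
Proof.
move=> oc cl cK aK z z' Kz Kz'.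
pose B := K `&` [set x | wind ch x = wind ch z].
suff BK : B = K by move: Kz'; rewrite -BK => -[_ /= ->].
apply: cK; first by exists z.
- exists [set x | avoids ch x /\ wind ch x = wind ch z].
    apply: open_d2 => x [ax <-]; have [r r0 hr] := wind_near oc ax cl.
    by exists r.
  by apply/seteqP; split => x [Kx /= h]; split => //; [split => //; exact: aK|case: h].
- exists (~` [set x | avoids ch x /\ wind ch x <> wind ch z]).
    apply: open_closedC; apply: open_d2 => x [ax hx].
    have [r r0 hr] := wind_near oc ax cl; exists r => // y /hr[ay yE].
    by split => //; rewrite yE.
  apply/seteqP; split => x [Kx /= h]; split => //=; first by case.
  by apply: contrapT => hx; apply: h; split => //; exact: aK.
Qed.

(** From a point outside a disc about [p], everything in the disc is seen in the half-plane of
    direction [p - z], where one branch of the argument serves for all pieces. *)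
Lemma wind_outside ch p r z : ok_chain ch -> closed_chain ch ->
  allp (fun e => forall t, lo e <= t <= hi e -> d2 (curve e t) p <= r) ch ->
  r < d2 z p -> avoids ch z /\ wind ch z = 0.
Proof.
move=> oc cl hr rz; split.
  elim: ch {oc cl} hr => //= e ch IH [h1 h2]; split; last exact: IH.
  by move=> t /h1 h tz; move: h; rewrite tz leNgt rz.
rewrite (@wind_turn _ _ (p - z))//.
elim: ch {oc cl} hr => //= e ch IH [h1 h2]; split; last exact: IH.
move=> t /h1 h; have -> : curve e t - z = (p - z) + (curve e t - p).
  by rewrite [RHS]addrC addrA subrK.
by apply: dot_gt0; rewrite -/(d2 _ p) -/(d2 p z) (d2C p z) (le_lt_trans h).
Qed.

Lemma chain_bounded ch p : ok_chain ch ->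
  exists r, allp (fun e => forall t, lo e <= t <= hi e -> d2 (curve e t) p <= r) ch.
Proof.
elim: ch => [|e ch IH] /=; first by exists 0.
move=> [[ce abe] oc]; have [r hr] := IH oc.
have [|t tab ht] := @EVT_max R (fun t => d2 (curve e t) p) (lo e) (hi e) abe.
  apply: continuous_subspaceT; apply: cont_dot; exact: cont_sub.
pose s := Num.max r (d2 (curve e t) p).
exists s; split.
  by move=> u uab; rewrite le_max ht ?orbT// in_itv.
elim: ch hr {IH oc} => //= e' ch IH [h1 h2]; split; last exact: IH.
by move=> u /h1 h; rewrite le_max h.
Qed.

End Winding.

(** * Radially generated tiles *)

Section Rotations.
Context {R : realType}.
Implicit Types (p x y z : R * R) (a b : R).

Lemma rotationD a b p z : rotation a p (rotation b p z) = rotation (a + b) p z.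
Proof. by rewrite /rotation cosD sinD /=; congr pair; ring. Qed.

Lemma rotation0 p z : rotation 0 p z = z.
Proof. by case: z => z1 z2; rewrite /rotation cos0 sin0 /=; congr pair; ring. Qed.

Lemma rotationK a p : cancel (rotation a p) (rotation (- a) p).
Proof. by move=> z; rewrite rotationD addNr rotation0. Qed.

Lemma rotationNK a p : cancel (rotation (- a) p) (rotation a p).
Proof. by move=> z; rewrite rotationD addrN rotation0. Qed.

Lemma rotation_center a p : rotation a p p = p.
Proof. by case: p => p1 p2; rewrite /rotation /=; congr pair; ring. Qed.

Lemma rotation_inj a p : injective (rotation a p).
Proof. exact: (can_inj (rotationK a p)). Qed.

Lemma rotationD2pi a p z : rotation (a + pi *+ 2) p z = rotation a p z.
Proof. by rewrite /rotation cosD2pi sinD2pi. Qed.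

Lemma d2_rotation a p x y : d2 (rotation a p x) (rotation a p y) = d2 x y.
Proof.
rewrite /d2 rotation_sub /dot /=.
transitivity ((cos a ^+ 2 + sin a ^+ 2) *
   ((x.1 - y.1) * (x.1 - y.1) + (x.2 - y.2) * (x.2 - y.2))); first by ring.
by rewrite cos2Dsin2 mul1r.
Qed.

Lemma d2_rotationp a p x : d2 (rotation a p x) p = d2 x p.
Proof. by rewrite -[X in d2 _ X](rotation_center a p) d2_rotation. Qed.

Lemma cont_circ p x : continuous (fun t => rotation t p x).
Proof.
apply: cont_pair; apply: contD; do ?exact: cont_cst;
  first [apply: contB|apply: contD]; apply: contM; do ?exact: cont_cst;
  by [exact: continuous_cos|exact: continuous_sin].
Qed.

Lemma segment_image_connected (f : R -> R * R) a b :
  {within `[a, b], continuous f} -> connected (f @` `[a, b]).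
Proof. by move=> cf; apply: connected_continuous_connected => //; exact: segment_connected. Qed.

Lemma star_connected (A : set (R * R)) c :
  (forall x, A x -> exists2 f : R -> R * R, {within `[0, 1], continuous f} &
     [/\ f 0 = c, f 1 = x & forall s, 0 <= s <= 1 -> A (f s)]) -> connected A.
Proof.
move=> H; pose I := {x | A x}.
have [f hf] : exists f : I -> R -> R * R, forall i : I, {within `[0, 1], continuous f i} /\
   [/\ f i 0 = c, f i 1 = sval i & forall s, 0 <= s <= 1 -> A (f i s)].
  have /choice[f hf] : forall i : I, exists f : R -> R * R,
      {within `[0, 1], continuous f} /\
      [/\ f 0 = c, f 1 = sval i & forall s, 0 <= s <= 1 -> A (f s)].
    by move=> [x Ax]; have [f] := H x Ax; exists f.
  by exists f.
have -> : A = \bigcup_(i in [set: I]) (f i @` `[0, 1]).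
  apply/seteqP; split => x.
    move=> Ax; exists (exist _ x Ax) => //; have [_ [_ fx _]] := hf (exist _ x Ax).
    by exists 1; rewrite //= in_itv/= ler01 lexx.
  by move=> [i _ [s /= + <-]]; rewrite in_itv/=; have [_ [_ _]] := hf i; apply.
apply: bigcup_connected.
  exists c => i _; exists 0; first by rewrite /= in_itv/= ler01 lexx.
  by have [_ []] := hf i.
by move=> i _; apply: segment_image_connected; have [] := hf i.
Qed.

(** The contraction, run backwards, joins its end-point to every point of [V] inside [V]. *)
Lemma contractible_connected (V : set (R * R)) : contractible R V -> connected V.
Proof.
move=> [c [H [Vc cH HV H0 H1]]]; apply: (@star_connected _ c) => x Vx.
exists (fun s => H (1 - s, x)); last first.
  rewrite subr0 subrr H0// H1//; split => // s /andP[s0 s1].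
  by apply: HV => //; rewrite in_itv/= subr_ge0 s1/=; lra.
move/subspace_continuousP: cH => cH.
apply/subspace_continuousP => s /=; rewrite in_itv/= => /andP[s0 s1].
apply: (@cvg_comp _ _ _ (fun s => (1 - s, x)) H _
  (within (`[0, 1]%classic `*` V) (nbhs (1 - s, x)))); last first.
  by apply: cH; split => //=; rewrite in_itv/= subr_ge0 s1/=; lra.
move=> A wA.
have cg : continuous (fun s : R => (1 - s, x)).
  by move=> u; apply: (cvg_pair (G := nbhs (1 - u)) (H := nbhs x));
    [apply: cvgB; [exact: cvg_cst|exact: cvg_id]|exact: cvg_cst].
have : \forall u \near s, (`[0, 1]%classic `*` V) (1 - u, x) -> A (1 - u, x).
  exact: (cg s [set y | (`[0, 1]%classic `*` V) y -> A y]).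
apply: filterS => u hu /=; rewrite in_itv/= => /andP[u0 u1]; apply: hu.
by split => //=; rewrite in_itv/= subr_ge0 u1/=; lra.
Qed.

End Rotations.

(** * Contours and open interiors of radially generated tiles *)

Section Tiles.
Context {R : realType}.
Implicit Types (p x y z : R * R) (a b t u v : R) (e : R -> R * R).

(* The contour of a radially generated tile as a point set, with its arc
   parametrized by angle. *)
Definition frame e p a : set (R * R) :=
  [set z | [\/ exists2 u, 0 <= u <= 1 & e u = z,
               exists2 t, 0 <= t <= a & rotation t p (e 1) = z
             | exists2 u, 0 <= u <= 1 & rotation a p (e u) = z]].

(** Simplicity of the contour is split into statements on pairs of its three parts. The set [inside]
    survives only in [tile_out]: a point off the contour and off [V] lies in a connected set that
    misses the contour and reaches arbitrarily far, which forces winding number 0. *)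
Record tile e p a (V : set (R * R)) : Prop := Tile {
  tile_pos : 0 < a ;
  tile_cont : continuous e ;
  tile_start : e 0 = p ;
  tile_inj : forall u v, 0 <= u <= 1 -> 0 <= v <= 1 -> e u = e v -> u = v ;
  tile_sides : forall u v, 0 <= u <= 1 -> 0 <= v <= 1 ->
    e u = rotation a p (e v) -> u = 0 /\ v = 0 ;
  tile_arc : forall u t, 0 <= u <= 1 -> 0 <= t <= a ->
    e u = rotation t p (e 1) -> u = 1 /\ t = 0 ;
  tile_arc' : forall u t, 0 <= u <= 1 -> 0 <= t <= a ->
    rotation a p (e u) = rotation t p (e 1) -> u = 1 /\ t = a ;
  tile_open : open V ;
  tile_conn : connected V ;
  tile_ne : V !=set0 ;
  tile_bd : closure V `\` V = frame e p a ;
  tile_out : forall z, ~ frame e p a z -> ~ V z ->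
    exists K, [/\ connected K, K z, forall x, K x -> ~ frame e p a x
                & forall M, exists2 x, K x & M < d2 x p] }.

(** Clamping makes a generating curve continuous on the whole line and leaves its frame
    unchanged. *)
Definition clamped e := e \o clamp 0 1.

Lemma contour_image e p a : 0 < a ->
  contour e p a @` `[0, 3] = frame e p a.
Proof.
move=> a0; apply/seteqP; split => z.
  move=> [s /=]; rewrite in_itv/= /contour => /andP[s0 s3].
  case: ifPn => [s1|]; first by move=> <-; apply: Or31; exists s => //; rewrite s0.
  rewrite -ltNge => s1; case: ifPn => [s2|].
    move=> <-; apply: Or32; exists (a * (s - 1)) => //.
    rewrite mulr_ge0 ?(ltW a0) ?subr_ge0 ?(ltW s1)//=.
    by rewrite -[X in _ <= X]mulr1 ler_pM2l//; lra.
  by rewrite -ltNge => s2 <-; apply: Or33; exists (3 - s) => //; lra.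
case=> -[u /andP[u0 u1] <-].
- exists u; first by rewrite /= in_itv/= u0; lra.
  by rewrite /contour u1.
- have [->|un] := eqVneq u 0.
    exists 1; first by rewrite /= in_itv/=; lra.
    by rewrite /contour lexx rotation0.
  have up : 0 < u by rewrite lt_neqAle eq_sym un.
  have ua : 0 < u / a by rewrite divr_gt0.
  have ua1 : u / a <= 1 by rewrite ler_pdivrMr// mul1r.
  exists (1 + u / a); first by rewrite /= in_itv/=; lra.
  rewrite /contour ifF; last by apply/negbTE; rewrite -ltNge; lra.
  rewrite ifT; last by lra.
  by congr rotation; field; rewrite gt_eqF.
- have [->|un] := eqVneq u 1.
    exists 2; first by rewrite /= in_itv/=; lra.
    rewrite /contour ifF; last by apply/negbTE; rewrite -ltNge; lra.
    by rewrite lexx; congr rotation; ring.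
  have up : u < 1 by rewrite lt_neqAle un.
  exists (3 - u); first by rewrite /= in_itv/=; lra.
  rewrite /contour ifF; last by apply/negbTE; rewrite -ltNge; lra.
  rewrite ifF; last by apply/negbTE; rewrite -ltNge; lra.
  by congr (rotation _ _ (e _)); ring.
Qed.

Lemma clamped_id e u : 0 <= u <= 1 -> clamped e u = e u.
Proof. by move=> hu; rewrite /clamped /= clamp_id. Qed.

Lemma frame_clamped e p a : frame (clamped e) p a = frame e p a.
Proof.
have h1 : clamped e 1 = e 1 by rewrite clamped_id// ler01 lexx.
apply/seteqP; split => z; case=> -[u hu <-].
- by apply: Or31; exists u; rewrite // clamped_id.
- by apply: Or32; exists u; rewrite // h1.
- by apply: Or33; exists u; rewrite // clamped_id.
- by apply: Or31; exists u; rewrite // clamped_id.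
- by apply: Or32; exists u; rewrite // h1.
- by apply: Or33; exists u; rewrite // clamped_id.
Qed.

Lemma unbounded_far (A : set (R * R)) p : ~ bounded_set A ->
  forall M, exists2 x, A x & M < d2 x p.
Proof.
move=> nb M; apply: contrapT => H; apply: nb.
have HM x : A x -> d2 x p <= M.
  by move=> Ax; rewrite leNgt; apply/negP => h; apply: H; exists x.
pose B := 1 + `|M| + `|p.1| + `|p.2|.
exists B; split; first exact: num_real.
move=> r Br x Ax; have := HM x Ax; rewrite /d2 /dot /= => h.
have k (t : R) : t * t <= M -> `|t| <= 1 + `|M|.
  move=> tM; rewrite leNgt; apply/negP => hh.
  have : `|t| * `|t| = t * t by rewrite -!expr2 real_normK ?num_real.
  have := ler_norm M; have := normr_ge0 M; nra.
have k1 : `|x.1 - p.1| <= 1 + `|M|.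
  by apply: k; have := sqr_ge0 (x.2 - p.2); rewrite expr2; lra.
have k2 : `|x.2 - p.2| <= 1 + `|M|.
  by apply: k; have := sqr_ge0 (x.1 - p.1); rewrite expr2; lra.
have n1 := normr_ge0 p.1; have n2 := normr_ge0 p.2.
have x1 : `|x.1| <= `|x.1 - p.1| + `|p.1| by rewrite -[X in `|X|](subrK p.1) ler_normD.
have x2 : `|x.2| <= `|x.2 - p.2| + `|p.2| by rewrite -[X in `|X|](subrK p.2) ler_normD.
rewrite /Num.norm /= ge_max; apply/andP; split; move: Br; rewrite /B; lra.
Qed.

Lemma radial_tile_tile e p a U : radial_tile e p a U ->
  exists2 V, tile (clamped e) p a V & U = closure V.
Proof.
move=> [/andP[a0 a2] e0 [[cc cE ci] [V [VE oV cV bV UV]]]]; exists V => //.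
have GE := contour_image e p a0.
have I0 : 0 <= (0 : R) <= 1 by lra.
have I1 : 0 <= (1 : R) <= 1 by lra.
have C1 u : 0 <= u <= 1 -> contour e p a u = e u by rewrite /contour => /andP[_ ->].
have C2 t : 0 <= t <= a -> contour e p a (1 + t / a) = rotation t p (e 1).
  move=> /andP[t0 ta]; have [->|tn] := eqVneq t 0.
    by rewrite mul0r addr0 rotation0 C1.
  have tp : 0 < t by rewrite lt_neqAle eq_sym tn.
  have ua : 0 < t / a by rewrite divr_gt0.
  have ua1 : t / a <= 1 by rewrite ler_pdivrMr// mul1r.
  rewrite /contour ifF; last by apply/negbTE; rewrite -ltNge; lra.
  rewrite ifT; last by lra.
  by congr rotation; field; rewrite gt_eqF.
have C3 u : 0 <= u <= 1 -> contour e p a (3 - u) = rotation a p (e u).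
  move=> /andP[u0 u1]; have [->|un] := eqVneq u 1.
    rewrite -(C2 a) ?lexx ?(ltW a0)// divff ?gt_eqF//; congr contour; ring.
  have up : u < 1 by rewrite lt_neqAle un.
  rewrite /contour ifF; last by apply/negbTE; rewrite -ltNge; lra.
  rewrite ifF; last by apply/negbTE; rewrite -ltNge; lra.
  by congr (rotation _ _ (e _)); ring.
have inj s s' : 0 <= s <= 3 -> 0 <= s' <= 3 -> contour e p a s = contour e p a s' ->
    s = s' \/ (s = 0 \/ s = 3) /\ (s' = 0 \/ s' = 3).
  move=> /andP[s0 s3] /andP[s0' s3'] E.
  have lt3 r : 0 <= r <= 3 -> r != 3 -> r \in `[0, 3[%R.
    by move=> /andP[r0 r3] r3n; rewrite in_itv/= r0 lt_neqAle r3n.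
  have z3 : 0 \in `[(0 : R), 3[%R by rewrite in_itv/= lexx ltr0n.
  have [sE|sn] := eqVneq s 3; have [sE'|sn'] := eqVneq s' 3.
  - by left; rewrite sE sE'.
  - right; split; first by right.
    by left; apply: ci => //; [apply: lt3 => //; apply/andP|rewrite -E sE cE].
  - right; split; last by right.
    by left; apply: ci => //; [apply: lt3 => //; apply/andP|rewrite E sE' cE].
  - by left; apply: ci => //; apply: lt3 => //; apply/andP.
have ta t : 0 <= t <= a -> 0 <= t / a <= 1.
  move=> /andP[t0 t1]; rewrite divr_ge0 ?(ltW a0)//=.
  by rewrite ler_pdivrMr// mul1r.
split => //.
- rewrite /clamped; have -> : e \o clamp 0 1 = contour e p a \o clamp 0 1.
    by apply/funext => u /=; rewrite C1// clampP.
  apply: cont_within_clamp => //; apply: continuous_subspaceW cc => s /=.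
  by rewrite !in_itv/= => /andP[-> h]; lra.
- by rewrite clamped_id.
- move=> u v hu hv; rewrite !clamped_id// -!C1// => /inj[||//|]; try lra.
- move=> u v hu hv; rewrite !clamped_id// -C1// -C3// => /inj[|||]; lra.
- move=> u t hu ht; rewrite !clamped_id// -C1// -C2//.
  have tta := ta t ht; have tE : t = (t / a) * a by field; rewrite gt_eqF.
  by move=> /inj[|||]; try lra; move=> h; rewrite tE; nra.
- move=> u t hu ht; rewrite !clamped_id// -C3// -C2//.
  have tta := ta t ht; have tE : t = (t / a) * a by field; rewrite gt_eqF.
  move=> /inj[|||]; try lra; move=> h.
  have u1 : u = 1 by lra.
  have t1 : t / a = 1 by lra.
  by split => //; rewrite tE t1 mul1r.
- exact: contractible_connected.
- by have [c [H [Vc _ _ _ _]]] := cV; exists c.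
- by rewrite frame_clamped -GE.
- rewrite frame_clamped -GE => z Gz Vz.
  exists (connected_component (~` (contour e p a @` `[0, 3])) z); split.
  + exact: component_connected.
  + exact: connected_component_refl.
  + by move=> x /connected_component_sub.
  + by apply: unbounded_far => bd; apply: Vz; rewrite VE.
Qed.

End Tiles.

(** * The tiling of the disk by rotated copies of a tile *)

Section CircleWinding.
Context {R : realType}.
Variables (p e1 : R * R).
Implicit Types z : R * R.
Let circ t := rotation t p e1.
Let chainC := [:: Piece 1 circ 0 (pi *+ 2)].

Let pi2_ge0 : 0 <= pi *+ 2 :> R.
Proof. by rewrite mulrn_wge0// pi_ge0. Qed.

Let okC : ok_chain chainC.
Proof. by split => //=; split => //; exact: cont_circ. Qed.

Let closedC : closed_chain chainC.
Proof.
move=> A; rewrite /bound big_cons big_nil /= /circ.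
by rewrite -[X in rotation X]add0r rotationD2pi subrr mulr0 addr0.
Qed.

Let windC z : wind chainC z = var circ z 0 (pi *+ 2).
Proof. by rewrite /wind big_cons big_nil /= addr0 mul1r. Qed.

Lemma circ_dist t : d2 (rotation t p e1) p = d2 e1 p.
Proof. exact: d2_rotationp. Qed.

Lemma circle_outside z : d2 e1 p < d2 z p -> var circ z 0 (pi *+ 2) = 0.
Proof.
move=> h; rewrite -windC; apply: (wind_outside okC closedC _ h).2.
by split => //= t _; rewrite circ_dist.
Qed.

(** At the centre the argument is explicitly [u0 + t]; the open disc is star-shaped and misses the
    circle, so the winding number is the same everywhere in it. *)
Lemma circle_inside z : d2 z p < d2 e1 p -> var circ z 0 (pi *+ 2) = pi *+ 2.
Proof.
move=> h; have h0 : d2 p p < d2 e1 p by rewrite d2xx (le_lt_trans _ h)// d2_ge0.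
have ep : e1 - p <> 0.
  by move/eqP; rewrite subr_eq0 => /eqP E; move: h0; rewrite E ltxx.
have E : var circ p 0 (pi *+ 2) = pi *+ 2.
  have [u0 hu] := along_ex ep.
  rewrite (varE (f := fun t => u0 + t) pi2_ge0); first by ring.
  split; first by apply: contD; [exact: cont_cst|exact: cont_id].
  move=> t _; rewrite -[X in circ t - X](rotation_center t) rotation_sub.
  exact: (along_rotation t hu).
rewrite -[RHS]E -!windC.
apply: (wind_connected (K := [set x | d2 x p < d2 e1 p])) => //.
  apply: (@star_connected _ _ p) => x /= hx.
  exists (fun s => (p.1 + s * (x.1 - p.1), p.2 + s * (x.2 - p.2))).
    apply: continuous_subspaceT; apply: cont_pair; apply: contD;
      do ?exact: cont_cst; apply: contM; by [exact: cont_id|exact: cont_cst].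
  split; [by case: p => ? ?; congr pair; rewrite /=; ring|
          by case: x {hx} => ? ?; congr pair; rewrite /=; ring|].
  move=> s /andP[s0 s1]; apply: le_lt_trans hx; rewrite /d2 /dot /=.
  have := sqr_ge0 (x.1 - p.1); have := sqr_ge0 (x.2 - p.2); rewrite !expr2.
  set y1 := x.1 - p.1; set y2 := x.2 - p.2.
  have -> : p.1 + s * y1 - p.1 = s * y1 by ring.
  have -> : p.2 + s * y2 - p.2 = s * y2 by ring.
  have ss : s * s <= 1 by nra.
  nra.
move=> x /= hx; split => //= t _ tx; move: hx; rewrite -tx circ_dist ltxx.
by [].
Qed.

End CircleWinding.

(** * Rotated copies of a tile cover the disk once *)

Section Covering.
Context {R : realType}.
Variables (e : R -> R * R) (p : R * R) (a : R) (V : set (R * R)) (N : nat).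
Hypotheses (HT : tile e p a V) (Na : N%:R * a = pi *+ 2).
Implicit Types (x y z : R * R) (i j l : nat) (u v t : R).

Definition rt i := rotation (i%:R * a) p.
Definition irt i := rotation (- (i%:R * a)) p.
Definition side i := rt i \o e.
Definition piece_of i : set (R * R) := [set z | V (irt i z)].
Definition frame_of i : set (R * R) := [set z | frame e p a (irt i z)].

Let a_gt0 : 0 < a := tile_pos HT.
Let I0 : 0 <= (0 : R) <= 1. Proof. by lra. Qed.
Let I1 : 0 <= (1 : R) <= 1. Proof. by lra. Qed.

Lemma irtK i : cancel (irt i) (rt i).
Proof. exact: rotationNK. Qed.

Lemma rtK i : cancel (rt i) (irt i).
Proof. exact: rotationK. Qed.

Lemma rtD i j z : rt i (rt j z) = rt (i + j) z.
Proof. by rewrite /rt rotationD natrD mulrDl. Qed.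

Lemma rtN z : rt N z = z.
Proof. by rewrite /rt Na -[X in rotation X]add0r rotationD2pi rotation0. Qed.

Lemma N_gt0 : (0 < N)%N.
Proof.
rewrite lt0n; apply/eqP => N0; move: Na; rewrite N0 mul0r => /esym/eqP.
by rewrite mulrn_eq0/= gt_eqF// pi_gt0.
Qed.

Lemma cont_side i : continuous (side i).
Proof. apply: cont_comp; [exact: tile_cont HT|exact: cont_rotation]. Qed.

Lemma side0 i : side i 0 = p.
Proof. by rewrite /side /= (tile_start HT) /rt rotation_center. Qed.

Lemma side_eqp i u : 0 <= u <= 1 -> side i u = p -> u = 0.
Proof.
move=> hu; rewrite -[X in _ = X](side0 i) => /rotation_inj.
exact: (tile_inj HT).
Qed.

Lemma r2_gt0 : 0 < d2 (e 1) p.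
Proof.
apply: d2_gt0 => e1p; have := @tile_inj _ _ _ _ _ HT 1 0 I1 I0.
by rewrite e1p (tile_start HT) => /(_ erefl); lra.
Qed.

Lemma frame_ofE i z : frame_of i z <->
  [\/ exists2 u, 0 <= u <= 1 & side i u = z,
      exists2 t, i%:R * a <= t <= i.+1%:R * a & rotation t p (e 1) = z
    | exists2 u, 0 <= u <= 1 & side i.+1 u = z].
Proof.
have rS x : rt i (rotation a p x) = rt i.+1 x.
  by rewrite /rt rotationD -[i.+1]addn1 natrD mulrDl mul1r.
split; case=> -[u hu].
- by move=> h; apply: Or31; exists u; rewrite // /side /= h irtK.
- move=> h; apply: Or32; exists (i%:R * a + u).
    by rewrite lerDl -addn1 natrD mulrDl mul1r lerD2l.
  by rewrite -rotationD h -/(rt i) irtK.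
- by move=> h; apply: Or33; exists u; rewrite // /side /= -rS h irtK.
- by move=> <-; apply: Or31; exists u; rewrite // /side /= rtK.
- move=> <-; apply: Or32; exists (u - i%:R * a).
    move: hu; rewrite -addn1 natrD mulrDl mul1r; lra.
  by rewrite /irt rotationD addrC.
- by move=> <-; apply: Or33; exists u; rewrite // /side /= -rS rtK.
Qed.

Let circ t := rotation t p (e 1).

(** The far side has coefficient -1, so consecutive chains share a side with opposite signs and
    their sum telescopes. *)
Definition tchain i := [:: Piece 1 (side i) 0 1;
  Piece 1 circ (i%:R * a) (i.+1%:R * a); Piece (-1) (side i.+1) 0 1].

Lemma ok_tchain i : ok_chain (tchain i).
Proof.
split => /=; first by split; [exact: cont_side|exact: ler01].
split; first by split; [exact: cont_circ|rewrite ler_pM2r// ler_nat].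
by split => //; split; [exact: cont_side|exact: ler01].
Qed.

Lemma closed_tchain i : closed_chain (tchain i).
Proof.
move=> A; rewrite /bound !big_cons big_nil /= !side0.
rewrite /circ /side /= /rt; ring.
Qed.

Lemma avoids_tchain i z : avoids (tchain i) z <-> ~ frame_of i z.
Proof.
rewrite frame_ofE /avoids /=; split.
  by move=> [h1 [h2 [h3 _]]] [[u /h1]|[u /h2]|[u /h3]].
by move=> h; do !split => //; move=> u hu hz; apply: h;
  [apply: Or31|apply: Or32|apply: Or33]; exists u.
Qed.

Lemma wind_tchainE i z : wind (tchain i) z =
  var (side i) z 0 1 + var circ z (i%:R * a) (i.+1%:R * a) - var (side i.+1) z 0 1.
Proof. by rewrite /wind !big_cons big_nil /= addr0 !mul1r mulN1r addrA. Qed.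

Lemma wind_tchain_rot i z : ~ frame_of i z ->
  wind (tchain i) z = wind (tchain 0) (irt i z).
Proof.
move=> fz; have f0 : ~ frame_of 0 (irt i z).
  by rewrite /frame_of /= /irt mul0r oppr0 rotation0.
move/avoids_tchain: f0 => [/= h1 [h2 [h3 _]]].
have E j u : rt i (side j u) = side (i + j) u by rewrite /side /= rtD.
rewrite !wind_tchainE -[in LHS](irtK i z).
congr (_ + _ - _).
- rewrite -(var_rotation (i%:R * a) p (@cont_side 0) ler01 h1); apply: var_ext => // u _.
  by rewrite /= -/(rt i) E addn0.
- rewrite mul0r mul1r -(var_rotation (i%:R * a) p (@cont_circ _ p (e 1)) (ltW a_gt0)); last first.
    by move=> u hu; apply: h2; rewrite mul0r mul1r.
  transitivity (var (fun u => circ (u + i%:R * a)) (rt i (irt i z)) 0 a).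
    rewrite (@var_shift _ circ)//; last 3 first.
    + exact: (@cont_circ _ p (e 1)).
    + exact: ltW.
    + move=> u hu cz; apply: fz; apply/frame_ofE; apply: Or32; exists u.
        by move: hu; rewrite -addn1 natrD mulrDl mul1r; lra.
      by rewrite -[RHS](irtK i).
    + by rewrite add0r -addn1 natrD mulrDl mul1r addrC.
  apply: var_ext => [|u _]; first exact: ltW.
  by rewrite /= rotationD addrC.
- rewrite -(var_rotation (i%:R * a) p (@cont_side 1) ler01 h3); apply: var_ext => // u _.
  by rewrite /= -/(rt i) E addn1.
Qed.

Lemma frame0 z : frame_of 0 z = frame e p a z.
Proof. by rewrite /frame_of /= /irt mul0r oppr0 rotation0. Qed.

Lemma piece0 z : piece_of 0 z = V z.
Proof. by rewrite /piece_of /= /irt mul0r oppr0 rotation0. Qed.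

Lemma frameE z : frame e p a z <-> closure V z /\ ~ V z.
Proof. by rewrite -(tile_bd HT). Qed.

Lemma d2_irt i x y : d2 (irt i x) (irt i y) = d2 x y.
Proof. exact: d2_rotation. Qed.

Lemma d2_rt i x y : d2 (rt i x) (rt i y) = d2 x y.
Proof. exact: d2_rotation. Qed.

Lemma frame_of_piece i z : frame_of i z -> ~ piece_of i z.
Proof. by move=> /frameE[]. Qed.

Lemma open_piece i : open (piece_of i).
Proof.
apply: open_d2 => z /(open_d2P (tile_open HT))[r r0 hr]; exists r => // y yz.
by apply: hr; rewrite d2_irt.
Qed.

Lemma closure_piece i z : closure (piece_of i) z <-> closure V (irt i z).
Proof.
rewrite !closure_d2; split => H r r0; have [y Vy yr] := H r r0.
  by exists (irt i y) => //; rewrite d2_irt.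
exists (rt i y); first by rewrite /piece_of /= rtK.
by rewrite -(irtK i z) d2_rt.
Qed.

Lemma frame_of_closure i z : frame_of i z -> closure (piece_of i) z.
Proof. by move=> /frameE[h _]; apply/closure_piece. Qed.

Lemma open_frameC i : open (~` frame_of i).
Proof.
suff -> : ~` frame_of i = piece_of i `|` ~` closure (piece_of i).
  by apply: openU; [exact: open_piece|exact: (closed_openC (@closed_closure _ _))].
apply/seteqP; split => z.
  move=> fz; have [pz|pz] := pselect (piece_of i z); first by left.
  by right => cz; apply: fz; apply/frameE; split => //; apply/closure_piece.
by case=> [pz|cz] fz; [exact: (frame_of_piece fz)|exact/cz/frame_of_closure].
Qed.

(** Every point of a frame is a limit of points of its open tile, which are off the frame; so an
    open set can be shrunk away from one frame after another. *)
Lemma off_frames j (O : set (R * R)) : open O -> O !=set0 ->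
  exists2 W : set (R * R), open W /\ W !=set0 &
    W `<=` O /\ forall z i, W z -> (i < j)%N -> ~ frame_of i z.
Proof.
elim: j => [|j IH] oO O0; first by exists O => //; split => // z i _; rewrite ltn0.
have [W [oW [z Wz]] [sW hW]] := IH oO O0.
have [y [Wy fy]] : exists y, W y /\ ~ frame_of j y.
  have [fz|fz] := pselect (frame_of j z); last by exists z.
  have [r r0 hr] := open_d2P oW Wz.
  have /closure_d2/(_ _ r0)[y py yz] := frame_of_closure fz.
  by exists y; split; [exact: hr|move/frame_of_piece].
exists (W `&` ~` frame_of j).
  by split; [exact: (openI oW (@open_frameC j))|exists y].
split=> [x [/sW]//|x i [Wx fx]]; rewrite ltnS leq_eqVlt => /orP[/eqP->//|].
exact: hW.
Qed.

Lemma ex_off_frames (O : set (R * R)) : open O -> O !=set0 ->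
  exists2 z, O z & forall i, (i < N)%N -> ~ frame_of i z.
Proof.
move=> oO O0; have [W [_ [z Oz]] [sO hO]] := off_frames N oO O0.
by exists z; [exact: sO|move=> i; exact: hO].
Qed.

(** By [tile_out] the point is connected, off the contour, to points beyond any disc containing the
    contour. *)
Lemma wind_tchain_out i z : ~ frame_of i z -> ~ piece_of i z ->
  wind (tchain i) z = 0.
Proof.
move=> fz pz; rewrite wind_tchain_rot//.
have [K [cK Kz KF Kfar]] := tile_out HT fz pz.
have aK x : K x -> avoids (tchain 0) x.
  by move=> /KF h; apply/avoids_tchain; rewrite frame0.
have [r hr] := chain_bounded p (ok_tchain 0).
have [x Kx rx] := Kfar r.
rewrite (wind_connected (ok_tchain 0) (closed_tchain 0) cK aK Kz Kx).
exact: (wind_outside (ok_tchain 0) (closed_tchain 0) hr rx).2.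
Qed.

Lemma wind_tchain_piece : exists w, forall i z, piece_of i z ->
  wind (tchain i) z = w.
Proof.
have [c Vc] := tile_ne HT; exists (wind (tchain 0) c) => i z pz.
have fz : ~ frame_of i z by move/frame_of_piece.
rewrite wind_tchain_rot//; apply: (wind_connected (ok_tchain 0) (closed_tchain 0)
  (tile_conn HT)) => // x Vx; apply/avoids_tchain; rewrite frame0.
by move/frameE => [].
Qed.

Lemma circ_avoid t z : d2 z p <> d2 (e 1) p -> circ t <> z.
Proof. by move=> h cz; apply: h; rewrite -cz circ_dist. Qed.

Lemma sum_wind_tchain j z : d2 z p <> d2 (e 1) p ->
  \sum_(i < j) wind (tchain i) z =
  var (side 0) z 0 1 + var circ z 0 (j%:R * a) - var (side j) z 0 1.
Proof.
move=> hz; elim: j => [|j IH].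
  rewrite big_ord0 mul0r addrAC subrr add0r.
  have := @var_cat _ circ z 0 0 0 (@cont_circ _ p (e 1)) (lexx _) (lexx _)
    (fun t _ => circ_avoid hz).
  by move/eqP; rewrite -[X in X == _]addr0 (inj_eq (addrI _)) => /eqP.
rewrite big_ord_recr/= IH wind_tchainE (@var_cat _ circ z 0 (j%:R * a) (j.+1%:R * a)).
- by ring.
- exact: cont_circ.
- by rewrite mulr_ge0// ltW.
- by rewrite ler_pM2r// ler_nat.
- by move=> t _; exact: circ_avoid.
Qed.

Lemma side_mod l : side (l %% N) = side l.
Proof.
apply/funext => u; rewrite /side /= [in RHS](divn_eq l N) -rtD.
elim: (l %/ N)%N => [|d IH]; first by rewrite mul0n /rt mul0r rotation0.
by rewrite mulSn -rtD -IH rtN.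
Qed.

Lemma sideN : side N = side 0.
Proof. by rewrite -(side_mod N) modnn. Qed.

Lemma full_sum z : d2 z p <> d2 (e 1) p ->
  \sum_(i < N) wind (tchain i) z = var circ z 0 (pi *+ 2).
Proof. by move=> hz; rewrite sum_wind_tchain// Na sideN addrAC subrr add0r. Qed.

Lemma count_pieces w : (forall i z, piece_of i z -> wind (tchain i) z = w) ->
  forall z, (forall i, (i < N)%N -> ~ frame_of i z) -> d2 z p <> d2 (e 1) p ->
  w *+ #|[pred i : 'I_N | `[< piece_of i z >]]| = var circ z 0 (pi *+ 2).
Proof.
move=> hw z fz dz; rewrite -full_sum// -sumr_const [LHS]big_mkcond.
apply: eq_bigr => i _; rewrite inE; case: asboolP => pz; first by rewrite hw.
by rewrite wind_tchain_out//; exact: fz.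
Qed.

Lemma cont_d2 (c : R * R) : continuous (fun z => d2 z c).
Proof.
by apply: contD; apply: contM; apply: contB; first [exact: cont_cst|
  by move=> z; exact: cvg_fst|by move=> z; exact: cvg_snd].
Qed.

Lemma open_inner (c : R * R) (r : R) : open [set z | d2 z c < r].
Proof. exact: (open_comp (fun z _ => @cont_d2 c z) (@open_lt R r)). Qed.

Lemma open_outer (c : R * R) (r : R) : open [set z | r < d2 z c].
Proof. exact: (open_comp (fun z _ => @cont_d2 c z) (@open_gt R r)). Qed.

Lemma push_out r z (O : set (R * R)) : open O -> O z -> 0 < r -> r <= d2 z p ->
  exists2 y, O y & r < d2 y p.
Proof.
move=> oO Oz r0 rz; have [s s0 hs] := open_d2P oO Oz.
(* The point moves along the ray from [p]. Since [k <= 1], its squared displacement [k ^ 2 * d2 z p]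
   is at most [k * d2 z p <= s / 2]. *)
pose k := Num.min 1 (s / (2 * d2 z p)).
have zp : 0 < d2 z p by exact: lt_le_trans rz.
have k0 : 0 < k by rewrite lt_min ltr01 divr_gt0// mulr_gt0.
have k1 : k <= 1 by rewrite ge_min lexx.
have ks : k * (2 * d2 z p) <= s.
  by rewrite -ler_pdivlMr ?mulr_gt0// ge_min lexx orbT.
exists (z.1 + k * (z.1 - p.1), z.2 + k * (z.2 - p.2)).
  apply: hs; move: zp ks; rewrite /d2 /dot /=.
  set y1 := z.1 - p.1; set y2 := z.2 - p.2.
  have -> : z.1 + k * y1 - z.1 = k * y1 by ring.
  have -> : z.2 + k * y2 - z.2 = k * y2 by ring.
  move=> zp ks.
  have -> : k * y1 * (k * y1) + k * y2 * (k * y2) = (k * k) * (y1 * y1 + y2 * y2) by ring.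
  have : k * k <= k by nra.
  nra.
apply: (le_lt_trans rz); move: zp; rewrite /d2 /dot /=.
have -> : z.1 + k * (z.1 - p.1) - p.1 = (1 + k) * (z.1 - p.1) by ring.
have -> : z.2 + k * (z.2 - p.2) - p.2 = (1 + k) * (z.2 - p.2) by ring.
set y1 := z.1 - p.1; set y2 := z.2 - p.2 => zp.
have -> : (1 + k) * y1 * ((1 + k) * y1) + (1 + k) * y2 * ((1 + k) * y2) =
  ((1 + k) * (1 + k)) * (y1 * y1 + y2 * y2) by ring.
nra.
Qed.

Lemma pull_in r z (O : set (R * R)) : open O -> O z -> 0 < r -> d2 z p <= r ->
  exists2 y, O y & d2 y p < r.
Proof.
move=> oO Oz r0 rz; have [s s0 hs] := open_d2P oO Oz.
have [zr|zr] := ltP (d2 z p) r; first by exists z.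
have zp : 0 < d2 z p by exact: lt_le_trans zr.
pose k := Num.min 1 (s / (2 * d2 z p)).
have k0 : 0 < k by rewrite lt_min ltr01 divr_gt0// mulr_gt0.
have k1 : k <= 1 by rewrite ge_min lexx.
have ks : k * (2 * d2 z p) <= s.
  by rewrite -ler_pdivlMr ?mulr_gt0// ge_min lexx orbT.
exists (z.1 - k * (z.1 - p.1), z.2 - k * (z.2 - p.2)).
  apply: hs; move: zp ks; rewrite /d2 /dot /=.
  set y1 := z.1 - p.1; set y2 := z.2 - p.2.
  have -> : z.1 - k * y1 - z.1 = - (k * y1) by ring.
  have -> : z.2 - k * y2 - z.2 = - (k * y2) by ring.
  move=> zp ks.
  have -> : - (k * y1) * - (k * y1) + - (k * y2) * - (k * y2) = (k * k) * (y1 * y1 + y2 * y2) by ring.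
  have : k * k <= k by nra.
  nra.
apply: (lt_le_trans _ rz); move: zp; rewrite /d2 /dot /=.
have -> : z.1 - k * (z.1 - p.1) - p.1 = (1 - k) * (z.1 - p.1) by ring.
have -> : z.2 - k * (z.2 - p.2) - p.2 = (1 - k) * (z.2 - p.2) by ring.
set y1 := z.1 - p.1; set y2 := z.2 - p.2 => zp.
have -> : (1 - k) * y1 * ((1 - k) * y1) + (1 - k) * y2 * ((1 - k) * y2) =
  ((1 - k) * (1 - k)) * (y1 * y1 + y2 * y2) by ring.
have : (1 - k) * (1 - k) < 1 by nra.
nra.
Qed.

Lemma inner_off (O : set (R * R)) z : open O -> O z -> d2 z p <= d2 (e 1) p ->
  exists y, [/\ O y, d2 y p < d2 (e 1) p & forall i, (i < N)%N -> ~ frame_of i y].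
Proof.
move=> oO Oz hz; have [x Ox hx] := pull_in oO Oz r2_gt0 hz.
have [||y [Oy hy] fy] := @ex_off_frames (O `&` [set y | d2 y p < d2 (e 1) p]).
- by apply: openI => //; exact: open_inner.
- by exists x.
by exists y.
Qed.

(** The common winding number of the tiles is 2 pi [m]. At a point of the open disk off all frames,
    the contours add up to the circle, so [m] times the number of tiles containing the point is 1;
    both factors are then 1, as the second is a natural number. *)
Lemma winding_count :
  (forall i z, piece_of i z -> wind (tchain i) z = pi *+ 2) /\
  (forall z, (forall i, (i < N)%N -> ~ frame_of i z) -> d2 z p < d2 (e 1) p ->
     #|[pred i : 'I_N | `[< piece_of i z >]]| = 1%N).
Proof.
have [w hw] := wind_tchain_piece.
have pp : pi *+ 2 != 0 :> R by rewrite mulrn_eq0/= gt_eqF ?pi_gt0.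
have [m wE] : exists m : int, w = m%:~R * (pi *+ 2).
  have [c Vc] := tile_ne HT.
  have fc : ~ frame_of 0 c by move/frame_of_piece; rewrite piece0.
  have [m mE] := wind_int (ok_tchain 0) ((avoids_tchain 0 c).2 fc) (closed_tchain 0).
  by exists m; rewrite -mE hw// piece0.
have key z : (forall i, (i < N)%N -> ~ frame_of i z) -> d2 z p < d2 (e 1) p ->
    m * #|[pred i : 'I_N | `[< piece_of i z >]]|%:Z = 1.
  move=> fz hz; have hne : d2 z p <> d2 (e 1) p by move=> E; move: hz; rewrite E ltxx.
  have := count_pieces hw fz hne; rewrite circle_inside// wE => C.
  apply: (@intr_inj R); apply: (mulIf pp).
  by rewrite intrM mul1r -[RHS]C -mulr_natr; ring.
have dpp : d2 p p <= d2 (e 1) p by rewrite d2xx ltW// r2_gt0.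
have [y [_ hy fy]] := @inner_off setT p openT I dpp.
have m1 : m = 1.
  have := key y fy hy; move: #|_| => c mc.
  have : (c%:Z %| 1)%Z by apply/dvdzP; exists m.
  by rewrite dvdz1 => /eqP c1; move: mc; rewrite -[c]/(absz c) c1 mulr1.
split => [i z pz|z fz hz]; first by rewrite (hw _ _ pz) wE m1 mul1r.
by have := key z fz hz; rewrite m1; move: #|_| => c; lia.
Qed.

(** Otherwise the tile contains a point strictly outside the disk and off all frames, where the
    circle has winding number 0 while this tile contributes 2 pi. *)
Lemma piece_inner i z : (i < N)%N -> piece_of i z -> d2 z p < d2 (e 1) p.
Proof.
move=> iN pz; rewrite ltNge; apply/negP => hz.
have [y py hy] := push_out (@open_piece i) pz r2_gt0 hz.
have oO : open (piece_of i `&` [set x | d2 (e 1) p < d2 x p]).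
  by apply: openI; [exact: open_piece|exact: open_outer].
have [|x [px /= hx] fx] := ex_off_frames oO; first by exists y.
have hne : d2 x p <> d2 (e 1) p by move=> E; move: hx; rewrite E ltxx.
have := count_pieces winding_count.1 fx hne; rewrite circle_outside// => /eqP.
have pp : pi *+ 2 != 0 :> R by rewrite mulrn_eq0/= gt_eqF ?pi_gt0.
rewrite mulrn_eq0 (negbTE pp) orbF => /eqP c0.
by have := card0_eq c0 (Ordinal iN); rewrite !inE => /asboolP; apply.
Qed.

(** An overlap is open, so it contains a point off all frames, which would be counted twice. *)
Lemma piece_disjoint i j z : (i < N)%N -> (j < N)%N -> piece_of i z ->
  piece_of j z -> i = j.
Proof.
move=> iN jN pi_ pj.
have oO : open (piece_of i `&` piece_of j) by apply: openI; exact: open_piece.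
have [|x [px px'] fx] := ex_off_frames oO; first by exists z.
have /mem_card1[l hl] := winding_count.2 x fx (piece_inner iN px).
have := hl (Ordinal iN); have := hl (Ordinal jN).
rewrite !inE /= asboolT// asboolT// => /esym/eqP <- /esym/eqP.
by move/(congr1 val).
Qed.

Lemma disk_covered z : d2 z p <= d2 (e 1) p ->
  exists2 i, (i < N)%N & closure (piece_of i) z.
Proof.
move=> hz; apply: contrapT => H.
have [r r0 hr] : exists2 r, 0 < r & forall i y, (i < N)%N -> d2 y z < r ->
    ~ piece_of i y.
  have : (N <= N)%N by []; elim: {-2}N => [|j IH] jN.
    by exists 1 => // i y; rewrite ltn0.
  have [r r0 hr] := IH (ltnW jN).
  have [s s0 hs] : exists2 s, 0 < s & forall y, d2 y z < s -> ~ piece_of j y.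
    apply: contrapT => G; apply: H; exists j => //; apply/closure_d2 => s s0.
    apply: contrapT => G'; apply: G; exists s => // y ys py.
    by apply: G'; exists y.
  exists (Num.min r s); first by rewrite lt_min r0.
  move=> i y; rewrite ltnS leq_eqVlt lt_min => /orP[/eqP->|ij] /andP[yr ys].
    exact: hs.
  exact: (hr i).
have [||y [/= yr hy] fy] := @inner_off [set y | d2 y z < r] z _ _ hz.
- exact: open_inner.
- by rewrite /= d2xx.
have /mem_card1[l hl] := winding_count.2 y fy hy.
have := hl l; rewrite !inE eqxx => /asboolP; exact: hr.
Qed.

Lemma side_in_frame i u : 0 <= u <= 1 -> frame_of i (side i u).
Proof. by move=> hu; apply/frame_ofE; apply: Or31; exists u. Qed.

(** A point of a side is a limit of points of the tile bounded by that side; inside another open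
    tile it would create an overlap. *)
Lemma piece_not_side i l z u : (i < N)%N -> piece_of i z -> 0 <= u <= 1 ->
  side l u <> z.
Proof.
move=> iN pz hu; rewrite -side_mod => E.
have lN : (l %% N < N)%N by rewrite ltn_mod N_gt0.
have fz : frame_of (l %% N) z by rewrite -E; exact: side_in_frame.
have [li|li] := eqVneq (l %% N)%N i; first by move: fz; rewrite li => /frame_of_piece.
have [r r0 hr] := open_d2P (@open_piece i) pz.
have /closure_d2/(_ _ r0)[y py yz] := frame_of_closure fz.
by move/eqP: li; apply; apply: (piece_disjoint lN iN py); exact: hr.
Qed.

(* Inside a small ball around an interior point of the arc, the part of the
   disk lies in a single tile. *)
Lemma arc_not_side0 t j u : 0 < t < a -> 0 <= u <= 1 -> side j u <> circ t.
Proof.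
move=> /andP[t0 ta] hu; rewrite -side_mod.
have : (j %% N < N)%N by rewrite ltn_mod N_gt0.
move: (j %% N)%N => l lN E.
have ht : 0 <= t <= a by rewrite !ltW.
have c0 : forall v, 0 <= v <= 1 -> side 0 v <> circ t.
  move=> v hv; rewrite /side /= /rt mul0r rotation0 => /(tile_arc HT hv ht).
  by move=> [_ t00]; move: t0; rewrite t00 ltxx.
have c1 : forall v, 0 <= v <= 1 -> side 1 v <> circ t.
  move=> v hv; rewrite /side /= /rt mul1r => /(tile_arc' HT hv ht).
  by move=> [_ t00]; move: ta; rewrite t00 ltxx.
pose ch := [:: Piece 1 (side 0) 0 1; Piece 1 (side 1) 0 1].
have okch : ok_chain ch.
  by do !split => //=; first [exact: cont_side|exact: ler01].
have [r r0 [/= h0 [h1 _]]] := @dist_chain _ ch (circ t) okch (conj c0 (conj c1 I)).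
pose K := [set x | d2 x (circ t) < r /\ d2 x p < d2 (e 1) p].
have cf : frame e p a (circ t) by apply: Or32; exists t.
have cVt : closure V (circ t) by case/frameE: cf.
have oK : open K by apply: openI; exact: open_inner.
have KF x : K x -> ~ frame e p a x.
  move=> [xr xp]; rewrite -frame0 => /frame_ofE[[v hv xE]|[v hv xE]|[v hv xE]].
  - by move: xr; rewrite -xE ltNge h0.
  - by move: xp; rewrite -xE circ_dist ltxx.
  - by move: xr; rewrite -xE ltNge h1.
(* [K] is convex, meets [V] and misses the frame, which is the boundary of [V]. *)
have KV : K `<=` V.
  have [x [Vx xr]] : exists x, V x /\ d2 x (circ t) < r.
    by have /closure_d2/(_ _ r0)[x Vx xr] := cVt; exists x.
  have Kx : K x by split => //; apply: (@piece_inner 0) => //; rewrite ?N_gt0// piece0.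
  suff <- : K `&` V = K by move=> ? [].
  have cK : connected K.
    apply: (@star_connected _ _ x) => y [yr yp].
    exists (fun s => (x.1 + s * (y.1 - x.1), x.2 + s * (y.2 - x.2))).
      apply: continuous_subspaceT; apply: cont_pair; apply: contD;
        do ?exact: cont_cst; apply: contM; by [exact: cont_id|exact: cont_cst].
    split; [by case: x {Vx xr Kx} => ? ?; congr pair; rewrite /=; ring|
            by case: y {yr yp} => ? ?; congr pair; rewrite /=; ring|].
    move=> s /andP[s0 s1].
    have conv c k : d2 x c < k -> d2 y c < k ->
        d2 (x.1 + s * (y.1 - x.1), x.2 + s * (y.2 - x.2)) c < k.
      rewrite /d2 /dot /=.
      have -> : x.1 + s * (y.1 - x.1) - c.1 = (1 - s) * (x.1 - c.1) + s * (y.1 - c.1) by ring.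
      have -> : x.2 + s * (y.2 - x.2) - c.2 = (1 - s) * (x.2 - c.2) + s * (y.2 - c.2) by ring.
      set X1 := x.1 - c.1; set X2 := x.2 - c.2; set Y1 := y.1 - c.1; set Y2 := y.2 - c.2.
      move=> hx hy.
      have e1 : ((1 - s) * X1 + s * Y1) * ((1 - s) * X1 + s * Y1) =
        (1 - s) * (X1 * X1) + s * (Y1 * Y1) - s * (1 - s) * (X1 - Y1) ^+ 2 by ring.
      have e2 : ((1 - s) * X2 + s * Y2) * ((1 - s) * X2 + s * Y2) =
        (1 - s) * (X2 * X2) + s * (Y2 * Y2) - s * (1 - s) * (X2 - Y2) ^+ 2 by ring.
      rewrite e1 e2.
      have s10 : 0 <= s * (1 - s) by rewrite mulr_ge0// subr_ge0.
      have q1 := mulr_ge0 s10 (sqr_ge0 (X1 - Y1)).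
      have q2 := mulr_ge0 s10 (sqr_ge0 (X2 - Y2)).
      have [s00|sn0] := eqVneq s 0; first by rewrite s00 in q1 q2 *; nra.
      have sp : 0 < s by rewrite lt_neqAle eq_sym sn0.
      nra.
    by split; apply: conv => //; case: Kx.
  apply: cK; first by exists x.
    by exists V => //; exact: tile_open HT.
  exists (closure V); first exact: closed_closure.
  apply/seteqP; split => y [Ky Vy]; split => //; first exact: subset_closure.
  by apply: contrapT => nV; apply: (KF y Ky); apply/frameE.
have fl : frame_of l (circ t) by rewrite -E; exact: side_in_frame.
have /closure_d2/(_ _ r0)[y py yr] := frame_of_closure fl.
have yV : piece_of 0 y by rewrite piece0; apply: KV; split => //; exact: (piece_inner lN py).
have l0 : l = 0%N by apply: (piece_disjoint lN N_gt0 py yV).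
by move: E; rewrite l0; exact: c0.
Qed.

Lemma arc_not_side t i j u : i%:R * a < t < i.+1%:R * a -> 0 <= u <= 1 ->
  side j u <> circ t.
Proof.
rewrite -addn1 natrD mulrDl mul1r => ht hu E.
(* A further rotation by [m] positions, with [i + m] a multiple of [N], brings the arc back to index
   0. *)
have hN : exists m, (i + m = (i + m) %/ N * N)%N.
  exists (N * i - i)%N; have N0 := N_gt0.
  have -> : (i + (N * i - i) = i * N)%N.
    by rewrite subnKC ?leq_pmull// mulnC.
  by rewrite mulnK.
have [m mE] := hN.
have : rt m (side j u) = circ (t + m%:R * a).
  by rewrite E /rt rotationD addrC.
have -> : rt m (side j u) = side (m + j) u by rewrite /side /= rtD.
have -> : circ (t + m%:R * a) = circ (t - i%:R * a).
  have -> : t + m%:R * a = t - i%:R * a + (i + m)%:R * a by rewrite natrD; ring.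
  rewrite mE; elim: ((i + m) %/ N)%N => [|d IH]; first by rewrite mul0n mul0r addr0.
  rewrite -IH mulSn natrD mulrDl Na addrCA addrC; exact: rotationD2pi.
by apply: arc_not_side0 => //; lra.
Qed.

Lemma connected_piece i : connected (piece_of i).
Proof.
have -> : piece_of i = rt i @` V.
  apply/seteqP; split => z; first by move=> Vz; exists (irt i z); rewrite // irtK.
  by move=> [x Vx <-]; rewrite /piece_of /= rtK.
apply: connected_continuous_connected; first exact: tile_conn HT.
exact/continuous_subspaceT/cont_rotation.
Qed.

Lemma side_in_disk i u : 0 <= u <= 1 -> d2 (side i u) p <= d2 (e 1) p.
Proof.
move=> hu; rewrite leNgt; apply/negP => h; move: (h); rewrite -side_mod => {}h.
have fs := side_in_frame (i %% N) hu.
have [r r0 hr] := open_d2P (@open_outer p (d2 (e 1) p)) h.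
have /closure_d2/(_ _ r0)[y py yz] := frame_of_closure fs.
have := hr _ yz; rewrite /= ltNge => /negP; apply; apply: ltW.
by apply: (piece_inner _ py); rewrite ltn_mod N_gt0.
Qed.

Lemma piece_off_frame i l z : (i < N)%N -> piece_of i z -> ~ frame_of l z.
Proof.
move=> iN pz /frame_ofE[[u hu]|[t ht E]|[u hu]]; [exact: piece_not_side iN pz hu| |
  exact: piece_not_side iN pz hu].
by have := piece_inner iN pz; rewrite -E circ_dist ltxx.
Qed.

Lemma wind_piece_other i l z : (i < N)%N -> (l < N)%N -> i != l -> piece_of i z ->
  wind (tchain l) z = 0.
Proof.
move=> iN lN il pz; apply: wind_tchain_out; first exact: (piece_off_frame iN pz).
by move=> pz'; move/eqP: il; apply; exact: piece_disjoint pz pz'.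
Qed.

(* If the side crossed its image under the rotation by j * a away from p, the
   closed curve made of the two sides and of the arc between them would split
   at the crossing into a loop through p and a loop along the boundary circle.
   Each tile touches both p and the circle, so each loop winds equally often
   around all tiles; but the whole curve winds only around the first j ones. *)
Lemma sides_meet j u v : (0 < j < N)%N -> 0 <= u <= 1 -> 0 <= v <= 1 ->
  side 0 u = side j v -> u = 0.
Proof.
move=> /andP[j0 jN] hu hv E; apply: contrapT => u0.
have v0 : v <> 0.
  by move=> v0; apply: u0; apply: (@side_eqp 0) => //; rewrite E v0 side0.
have [hu0 hu1] := andP hu; have [hv0 hv1] := andP hv.
have ja0 : 0 <= j%:R * a by rewrite mulr_ge0// ltW.
have N0 := N_gt0.
pose L1 := [:: Piece 1 (side 0) 0 u; Piece (-1) (side j) 0 v].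
pose L2 := [:: Piece 1 (side 0) u 1; Piece 1 circ 0 (j%:R * a);
               Piece (-1) (side j) v 1].
have ok1 : ok_chain L1 by refine (conj _ (conj _ Logic.I)) => /=; split => //; exact: cont_side.
have ok2 : ok_chain L2.
  by refine (conj _ (conj _ (conj _ Logic.I))) => /=; split => //;
    first [exact: cont_side|exact: (@cont_circ _ p (e 1))].
have cl1 : closed_chain L1.
  by move=> A; rewrite /bound !big_cons big_nil /= !side0 E; ring.
have cl2 : closed_chain L2.
  move=> A; rewrite /bound !big_cons big_nil /= E.
  have -> : circ 0 = side 0 1 by rewrite /side /= /rt mul0r.
  have -> : circ (j%:R * a) = side j 1 by [].
  ring.
have av1 z i : (i < N)%N -> piece_of i z -> avoids L1 z.
  move=> iN pz; refine (conj _ (conj _ Logic.I)) => /= t /andP[t0 tu];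
  by apply: (piece_not_side iN pz); rewrite t0 (le_trans tu).
have av2 z i : (i < N)%N -> piece_of i z -> avoids L2 z.
  move=> iN pz; refine (conj _ (conj _ (conj _ Logic.I))) => /= t /andP[t0 t1].
  - by apply: (piece_not_side iN pz); rewrite (le_trans _ t0).
  - by move=> tz; have := piece_inner iN pz; rewrite -tz circ_dist ltxx.
  - by apply: (piece_not_side iN pz); rewrite (le_trans _ t0).
have sumL z i : (i < N)%N -> piece_of i z ->
    wind L1 z + wind L2 z = \sum_(l < j) wind (tchain l) z.
  move=> iN pz; have zr : d2 z p <> d2 (e 1) p.
    by move=> h; have := piece_inner iN pz; rewrite h ltxx.
  rewrite sum_wind_tchain// /wind !big_cons !big_nil /=.
  rewrite (@var_cat _ (side 0) z 0 u 1)//; last 2 first.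
  - exact: cont_side.
  - by move=> t ht; exact: piece_not_side iN pz ht.
  rewrite (@var_cat _ (side j) z 0 v 1)//; last 2 first.
  - exact: cont_side.
  - by move=> t ht; exact: piece_not_side iN pz ht.
  ring.
(* [L1] lies in the closed disk and misses the interior of the arc of tile [i]. Near a point of that
   arc there are points of the tile and points outside the disk, where the winding number is 0. *)
have L1_0 i z : (i < N)%N -> piece_of i z -> wind L1 z = 0.
  move=> iN pz; pose t := i%:R * a + a / 2.
  have ht : i%:R * a < t < i.+1%:R * a.
    by rewrite /t -[i.+1]addn1 natrD mulrDl mul1r; have := a_gt0; lra.
  have avc : avoids L1 (circ t).
    by refine (conj _ (conj _ Logic.I)) => /= w /andP[w0 w1];
      apply: (arc_not_side ht); rewrite w0 (le_trans w1).
  have [r r0 hr] := wind_near ok1 avc cl1.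
  have ft : frame_of i (circ t).
    by apply/frame_ofE; apply: Or32; exists t => //; move: ht => /andP[/ltW-> /ltW->].
  have /closure_d2/(_ _ r0)[y py yt] := frame_of_closure ft.
  have [||y' /= yt' hy'] := @push_out (d2 (e 1) p) (circ t)
    [set x | d2 x (circ t) < r] (@open_inner _ _) _ r2_gt0.
  - by rewrite /= d2xx.
  - by rewrite circ_dist.
  rewrite (wind_connected ok1 cl1 (@connected_piece i) (fun x => @av1 x i iN) pz py).
  rewrite (hr y yt).2 -(hr y' yt').2.
  apply: (wind_outside ok1 cl1 _ hy').2.
  by refine (conj _ (conj _ Logic.I)) => /= w /andP[w0 w1];
    apply: side_in_disk; rewrite w0 (le_trans w1).
(* As [L2] misses [p], it winds equally often around the parts of tiles [0] and [j] near [p]; but by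
   [sumL] these two numbers are 2 pi and 0. *)
have avp : avoids L2 p.
  refine (conj _ (conj _ (conj _ Logic.I))) => /= t /andP[t0 t1].
  - move/side_eqp => tE; apply: u0; apply/eqP; rewrite eq_le hu0 andbT.
    by rewrite -tE ?t0// (le_trans hu0 t0) t1.
  - by apply: circ_avoid; rewrite d2xx => h; have := r2_gt0; rewrite -h ltxx.
  - move/side_eqp => tE; apply: v0; apply/eqP; rewrite eq_le hv0 andbT.
    by rewrite -tE ?t0// (le_trans hv0 t0) t1.
have [r r0 hr] := wind_near ok2 avp cl2.
have near_p i : exists2 y, piece_of i y & d2 y p < r.
  have fp : frame_of i p by rewrite -[X in frame_of i X](side0 i); exact: side_in_frame.
  by have /closure_d2/(_ _ r0)[y py yp] := frame_of_closure fp; exists y.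
have [y py yp] := near_p 0%N; have [y' py' yp'] := near_p j.
have := sumL y 0%N N0 py; rewrite (L1_0 0%N)// add0r (hr y yp).2.
have := sumL y' j jN py'; rewrite (L1_0 j)// add0r (hr y' yp').2 => ->.
rewrite big1 => [|l _]; last first.
  have lj := ltn_ord l.
  by apply: wind_piece_other py' => //; [exact: ltn_trans jN|rewrite gtn_eqF].
rewrite (bigD1 (Ordinal j0))//= (winding_count.1 0%N)// big1 => [|l l0]; last first.
  apply: wind_piece_other py => //; first exact: ltn_trans jN.
  by rewrite eq_sym; move: l0; rewrite -val_eqE.
rewrite addr0 => /esym/eqP; rewrite mulrn_eq0/= gt_eqF ?pi_gt0//.
Qed.

Lemma closure_pieceE i z : closure (piece_of i) z -> piece_of i z \/ frame_of i z.
Proof.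
move=> /closure_piece cz; have [pz|pz] := pselect (piece_of i z); first by left.
by right; apply/frameE.
Qed.

Lemma side_meets_tile j u : (0 < j)%N -> (j.+1 < N)%N -> 0 <= u <= 1 ->
  closure (piece_of j) (side 0 u) -> u = 0.
Proof.
move=> j0 jN hu /closure_pieceE[pz|/frame_ofE].
  by have := piece_not_side (ltnW jN) pz hu (l := 0%N).
have m1 v : 0 <= v <= 1 -> side j v = side 0 u -> u = 0.
  by move=> hv /esym; apply: sides_meet => //; rewrite j0 ltnW.
have m2 v : 0 <= v <= 1 -> side j.+1 v = side 0 u -> u = 0.
  by move=> hv /esym; apply: sides_meet.
case=> -[w hw]; [exact: m1| |exact: m2].
have [->|wj] := eqVneq w (j%:R * a); first exact: (m1 1).
have [->|wj'] := eqVneq w (j.+1%:R * a); first exact: (m2 1).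
move=> /esym E; exfalso; move: E; apply: (@arc_not_side w j) => //.
by move/andP: hw; rewrite !lt_neqAle wj' eq_sym wj => -[-> ->].
Qed.

End Covering.

(** * Subdivision of a wedge into k thin tiles *)

Section Subdivision.
Context {R : realType}.
Variables (e : R -> R * R) (p : R * R) (a : R) (V V' : set (R * R)) (N N' k : nat).
Hypotheses (HT : tile e p a V) (Na : N%:R * a = pi *+ 2).
Hypotheses (HT' : tile e p (k%:R * a) V') (Na' : N'%:R * (k%:R * a) = pi *+ 2).

Lemma subdivision_le : (k <= N)%N.
Proof.
have a0 : a != 0 by rewrite gt_eqF// (tile_pos HT).
have : (N' * k)%N = N.
  by apply/eqP; rewrite -(eqr_nat R) natrM -(inj_eq (mulIf a0)) -mulrA Na Na'.
by move=> <-; rewrite leq_pmull// (N_gt0 Na').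
Qed.

Lemma closure_fin_union (B : nat -> set (R * R)) (j : nat) z :
  (forall r, 0 < r -> exists2 y, (exists2 i, (i < j)%N & B i y) & d2 y z < r) ->
  exists2 i, (i < j)%N & closure (B i) z.
Proof.
move=> H; apply: contrapT => G.
suff [r r0 hr] : exists2 r, 0 < r & forall i y, (i < j)%N -> d2 y z < r -> ~ B i y.
  by have [y [i ij By] yr] := H r r0; exact: hr ij yr By.
have {H G} : forall i, (i < j)%N -> ~ closure (B i) z.
  by move=> i ij ci; apply: G; exists i.
elim: j => [|j IH] H; first by exists 1 => // i y; rewrite ltn0.
have [r r0 hr] := IH (fun i ij => H i (ltnW ij)).
have [s s0 hs] : exists2 s, 0 < s & forall y, d2 y z < s -> ~ B j y.
  apply: contrapT => G; apply: (H j) => //; apply/closure_d2 => s s0.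
  apply: contrapT => G'; apply: G; exists s => // y ys By.
  by apply: G'; exists y.
exists (Num.min r s); first by rewrite lt_min r0.
move=> i y; rewrite ltnS leq_eqVlt lt_min => /orP[/eqP->|ij] /andP[yr ys].
  exact: hs.
exact: (hr i).
Qed.

Let off_both (O : set (R * R)) : open O -> O !=set0 -> exists2 z, O z &
  (forall i, (i < N)%N -> ~ frame_of e p a i z) /\ ~ frame_of e p (k%:R * a) 0 z.
Proof.
move=> oO O0; have [W [oW W0] [sW hW]] := off_frames HT N oO O0.
have [X [oX [z Xz]] [sX hX]] := off_frames HT' 1 oW W0.
exists z; first exact/sW/sX.
split; last exact: hX.
by move=> i; apply: hW; exact: sX.
Qed.

(** Off the frames, membership is read off from winding numbers, and the contour of the wedge is the
    sum of the contours of its thin tiles. *)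
Lemma mem_subdivision z : (forall i, (i < N)%N -> ~ frame_of e p a i z) ->
  ~ frame_of e p (k%:R * a) 0 z -> d2 z p <> d2 (e 1) p ->
  V' z <-> exists2 i, (i < k)%N & piece_of p a V i z.
Proof.
move=> fz fz' dz; have pp : pi *+ 2 != 0 :> R by rewrite mulrn_eq0/= gt_eqF ?pi_gt0.
have E : wind (tchain e p (k%:R * a) 0) z = \sum_(i < k) wind (tchain e p a i) z.
  rewrite (sum_wind_tchain HT)// wind_tchainE mul0r mul1r.
  have -> : side e p (k%:R * a) 0 = side e p a 0 by rewrite /side /rt !mul0r.
  by have -> : side e p (k%:R * a) 1 = side e p a k by rewrite /side /rt mul1r.
have lek := subdivision_le.
split=> [Vz|[i ik pz]].
  apply: contrapT => G; move/eqP: pp; apply.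
  rewrite -((winding_count HT' Na').1 0%N z) ?piece0// E big1// => i _.
  apply: (wind_tchain_out HT).
    by apply: fz; exact: leq_trans (ltn_ord i) lek.
  by move=> pz; apply: G; exists i.
apply: contrapT => nV; move/eqP: pp; apply.
have iN : (i < N)%N by exact: leq_trans lek.
rewrite -[RHS](wind_tchain_out HT' fz') ?piece0// E.
rewrite (bigD1 (Ordinal ik))//= ((winding_count HT Na).1 i z pz) big1 ?addr0//.
move=> l li; apply: (wind_piece_other HT Na iN _ _ pz).
  by exact: leq_trans (ltn_ord l) lek.
by rewrite eq_sym; move: li; rewrite -val_eqE.
Qed.

Lemma closure_subdivision z : closure V' z <->
  exists2 i, (i < k)%N & closure (piece_of p a V i) z.
Proof.
split=> [/closure_d2 cz|[i ik /closure_d2 cz]].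
  apply: closure_fin_union => r r0; have [y Vy yr] := cz r r0.
  have [||x [Vx xr] [fx fx']] := @off_both (V' `&` [set x | d2 x z < r]).
  - by apply: openI; [exact: tile_open HT'|exact: open_inner].
  - by exists y.
  exists x => //; apply/(mem_subdivision fx fx') => //.
  have := @piece_inner _ _ _ _ _ _ HT' Na' 0 x (N_gt0 Na').
  by rewrite piece0 => /(_ Vx) h h'; rewrite h' ltxx in h.
apply/closure_d2 => r r0; have [y py yr] := cz r r0.
have iN : (i < N)%N by exact: leq_trans subdivision_le.
have [||x [px xr] [fx fx']] := @off_both (piece_of p a V i `&` [set x | d2 x z < r]).
- by apply: openI; [exact: (open_piece HT)|exact: open_inner].
- by exists y.
exists x => //; apply/(mem_subdivision fx fx'); last by exists i.
by move=> h; have := piece_inner HT Na iN px; rewrite h ltxx.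
Qed.

End Subdivision.

(** * Improper isometries *)

Section Isometries.
Context {R : realType}.
Implicit Types (p q x y z : R * R) (t : R) (s : R * R -> R * R) (A : set (R * R)).

(** Orientation reversing isometries, glide reflections included: [C] and [S] are the cosine and
    sine of twice the angle of the axis. Unlike reflections, they are closed under composition with
    rotations. *)
Definition improper s := exists C S t1 t2 : R, C ^+ 2 + S ^+ 2 = 1 /\
  forall z, s z = (C * z.1 + S * z.2 + t1, S * z.1 - C * z.2 + t2).

Lemma improper_rot s t x z : improper s ->
  s (rotation t x z) = rotation (- t) (s x) (s z).
Proof.
move=> [C [S [t1 [t2 [_ H]]]]]; rewrite !H /rotation /= cosN sinN.
by congr pair; ring.
Qed.

Lemma improper_d2 s x y : improper s -> d2 (s x) (s y) = d2 x y.
Proof.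
move=> [C [S [t1 [t2 [E H]]]]]; rewrite !H /d2 /dot /=.
transitivity ((C ^+ 2 + S ^+ 2) * ((x.1 - y.1) * (x.1 - y.1) +
  (x.2 - y.2) * (x.2 - y.2))); first by ring.
by rewrite E mul1r.
Qed.

Lemma improper_eq s s' x y : improper s -> improper s' -> x <> y ->
  s x = s' x -> s y = s' y -> s = s'.
Proof.
move=> [C [S [t1 [t2 [E H]]]]] [C' [S' [t1' [t2' [E' H']]]]] xy.
rewrite !H !H' => -[e1 e2] [e3 e4].
have d0 := d2_gt0 xy; rewrite /d2 /dot /= in d0.
set v1 := x.1 - y.1 in d0; set v2 := x.2 - y.2 in d0.
have k1 : (C - C') * v1 + (S - S') * v2 = 0 by rewrite /v1 /v2; nra.
have k2 : (S - S') * v1 - (C - C') * v2 = 0 by rewrite /v1 /v2; nra.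
have CC : C = C'.
  apply/eqP; rewrite -subr_eq0 -(mulIr_eq0 _ (mulIf (lt0r_neq0 d0))).
  apply/eqP; transitivity (((C - C') * v1 + (S - S') * v2) * v1 -
    ((S - S') * v1 - (C - C') * v2) * v2); first by ring.
  by rewrite k1 k2; ring.
have SS : S = S'.
  apply/eqP; rewrite -subr_eq0 -(mulIr_eq0 _ (mulIf (lt0r_neq0 d0))).
  apply/eqP; transitivity (((C - C') * v1 + (S - S') * v2) * v2 +
    ((S - S') * v1 - (C - C') * v2) * v1); first by ring.
  by rewrite k1 k2; ring.
by apply/funext => z; rewrite H H' CC SS; congr pair; move: e1 e2; rewrite CC SS; lra.
Qed.

Lemma improper_rotl s t p : improper s -> improper (rotation t p \o s).
Proof.
move=> [C [S [t1 [t2 [E H]]]]].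
exists (cos t * C - sin t * S), (sin t * C + cos t * S),
  (p.1 + (cos t * (t1 - p.1) - sin t * (t2 - p.2))),
  (p.2 + (sin t * (t1 - p.1) + cos t * (t2 - p.2))); split.
  transitivity ((cos t ^+ 2 + sin t ^+ 2) * (C ^+ 2 + S ^+ 2)); first by ring.
  by rewrite cos2Dsin2 E mul1r.
by move=> z; rewrite /= H /rotation /=; congr pair; ring.
Qed.

Lemma improper_rotr s t p : improper s -> improper (s \o rotation t p).
Proof.
move=> hs; have -> : s \o rotation t p = rotation (- t) (s p) \o s.
  by apply/funext => z /=; rewrite improper_rot.
exact: improper_rotl.
Qed.

Lemma improper_comp3 s1 s2 s3 : improper s1 -> improper s2 -> improper s3 ->
  improper (s1 \o s2 \o s3).
Proof.
move=> [C [S [t1 [t2 [E H]]]]] [C' [S' [t1' [t2' [E' H']]]]]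
  [C'' [S'' [t1'' [t2'' [E'' H'']]]]].
exists ((C * C' + S * S') * C'' - (S * C' - C * S') * S''),
  ((C * C' + S * S') * S'' + (S * C' - C * S') * C'').
exists (C * (C' * t1'' + S' * t2'' + t1') + S * (S' * t1'' - C' * t2'' + t2') + t1),
  (S * (C' * t1'' + S' * t2'' + t1') - C * (S' * t1'' - C' * t2'' + t2') + t2).
split; last by move=> z; rewrite /= H H' H'' /=; congr pair; ring.
transitivity ((C ^+ 2 + S ^+ 2) * (C' ^+ 2 + S' ^+ 2) * (C'' ^+ 2 + S'' ^+ 2)).
  by ring.
by rewrite E E' E'' !mul1r.
Qed.

(** A fixed point excludes a proper glide, so the map is a reflection. *)
Lemma improper_involutive s x : improper s -> s x = x -> involutive s.
Proof.
move=> [C [S [t1 [t2 [E H]]]]]; case: x => x1 x2; rewrite H /= => -[e1 e2].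
move=> [z1 z2]; rewrite !H /=; congr pair.
  transitivity ((C ^+ 2 + S ^+ 2) * (z1 - x1) + C * (C * x1 + S * x2 + t1)
    + S * (S * x1 - C * x2 + t2) + t1); first by ring.
  by rewrite e1 e2 E; lra.
transitivity ((C ^+ 2 + S ^+ 2) * (z2 - x2) + S * (C * x1 + S * x2 + t1)
    - C * (S * x1 - C * x2 + t2) + t2); first by ring.
by rewrite e1 e2 E; lra.
Qed.

Lemma reflectionx x y : reflection x y x = x.
Proof.
by case: x => x1 x2; rewrite /reflection /= !subrr !mul0r addr0 mulr0 !mul0r subrr !addr0.
Qed.

Lemma reflectiony x y : x <> y -> reflection x y y = y.
Proof.
move=> xy; have := d2_gt0 xy; rewrite d2C /d2 /dot /= => h.
case: y x xy h => y1 y2 [x1 x2] /= xy h; rewrite /reflection /=.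
have -> : 2 * ((y1 - x1) * (y1 - x1) + (y2 - x2) * (y2 - x2)) /
  ((y1 - x1) ^+ 2 + (y2 - x2) ^+ 2) = 2.
  by rewrite !expr2 mulfK// gt_eqF.
by congr pair; ring.
Qed.

Lemma reflection_improper x y : x <> y -> improper (reflection x y).
Proof.
move=> xy; have := d2_gt0 xy; rewrite d2C /d2 /dot /= -!expr2.
set u1 := y.1 - x.1; set u2 := y.2 - x.2 => h.
have h0 : u1 ^+ 2 + u2 ^+ 2 != 0 by rewrite gt_eqF.
pose C := (u1 ^+ 2 - u2 ^+ 2) / (u1 ^+ 2 + u2 ^+ 2).
pose S := 2 * u1 * u2 / (u1 ^+ 2 + u2 ^+ 2).
exists C, S, (x.1 - C * x.1 - S * x.2), (x.2 - S * x.1 + C * x.2).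
split; first by rewrite /C /S; field.
by move=> z; rewrite /reflection /= -/u1 -/u2 /C /S; congr pair; field.
Qed.

Lemma reflection_involutive x y : x <> y -> involutive (reflection x y).
Proof.
by move=> xy; exact: improper_involutive (reflection_improper xy) (reflectionx x y).
Qed.

Lemma improper_reflection s x : improper s -> s x = x ->
  exists2 y, x <> y & s = reflection x y.
Proof.
move=> hs sx; have [C [S [t1 [t2 [E H]]]]] := hs.
suff [y xy sy] : exists2 y, x <> y & s y = y.
  exists y => //; apply: (improper_eq hs (reflection_improper xy) xy).
    by rewrite reflectionx.
  by rewrite reflectiony.
move: sx; case: x => x1 x2; rewrite H /= => -[e1 e2].
(* The vector [(1 + C, S)] spans the axis, except when it vanishes: then [C = -1] and the axis is
   vertical. *)
have [C1|C1] := eqVneq C (-1).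
  exists (x1, x2 + 1); first by move=> [/eqP]; lra.
  have S0 : S = 0 by apply/eqP; rewrite -sqrf_eq0; apply/eqP; rewrite C1 in E; lra.
  by rewrite H /=; congr pair; rewrite C1 S0 in e1 e2 *; lra.
exists (x1 + (1 + C), x2 + S); first by move=> [h _]; move/eqP: C1; apply; lra.
rewrite H /=; congr pair; first by transitivity (C * x1 + S * x2 + t1 + C + (C ^+ 2 + S ^+ 2)); [ring|rewrite e1 E; ring].
transitivity (S * x1 - C * x2 + t2 + S); [ring|by rewrite e2].
Qed.

Lemma cont_improper s : improper s -> continuous s.
Proof.
move=> [C [S [t1 [t2 [_ H]]]]].
have -> : s = fun z => (C * z.1 + S * z.2 + t1, S * z.1 - C * z.2 + t2) by apply/funext.
have c1 : continuous (fun z : R * R => z.1) by move=> z; exact: cvg_fst.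
have c2 : continuous (fun z : R * R => z.2) by move=> z; exact: cvg_snd.
apply: cont_pair; apply: contD; do ?exact: cont_cst; first [apply: contB|apply: contD];
  by apply: contM => //; exact: cont_cst.
Qed.

(** The fixed points of an improper isometry are collinear, and a line meets a circle in at most two
    points. *)
Lemma improper_fix_line s x y z c : improper s -> s x = x -> s y = y -> s z = z ->
  x <> y -> x <> z -> y <> z -> d2 x c = d2 y c -> d2 x c = d2 z c -> False.
Proof.
move=> [C [S [t1 [t2 [E H]]]]]; case: x y z c => x1 x2 [y1 y2] [z1 z2] [c1 c2].
rewrite !H /d2 /dot /= => -[ex1 ex2] [ey1 ey2] [ez1 ez2] xy xz yz h1 h2.
pose u1 := y1 - x1; pose u2 := y2 - x2; pose w1 := z1 - x1; pose w2 := z2 - x2.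
have hu1 : (C - 1) * u1 + S * u2 = 0 by rewrite /u1 /u2; lra.
have hw1 : (C - 1) * w1 + S * w2 = 0 by rewrite /w1 /w2; lra.
have hu2 : S * u1 - (C + 1) * u2 = 0 by rewrite /u1 /u2; lra.
have hw2 : S * w1 - (C + 1) * w2 = 0 by rewrite /w1 /w2; lra.
pose g1 := x1 - c1; pose g2 := x2 - c2.
have q1 : 2 * (u1 * g1 + u2 * g2) + (u1 * u1 + u2 * u2) = 0.
  by rewrite /u1 /u2 /g1 /g2; lra.
have q2 : 2 * (w1 * g1 + w2 * g2) + (w1 * w1 + w2 * w2) = 0.
  by rewrite /w1 /w2 /g1 /g2; lra.
have col : u1 * w2 - u2 * w1 = 0.
  have a1 : (C - 1) * (u1 * w2 - u2 * w1) = 0.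
    transitivity (((C - 1) * u1 + S * u2) * w2 - ((C - 1) * w1 + S * w2) * u2).
      by ring.
    by rewrite hu1 hw1; ring.
  have a2 : (C + 1) * (u1 * w2 - u2 * w1) = 0.
    transitivity ((S * w1 - (C + 1) * w2) * - u1 + (S * u1 - (C + 1) * u2) * w1).
      by ring.
    by rewrite hu2 hw2; ring.
  lra.
have u0 : 0 < u1 * u1 + u2 * u2.
  by have := d2_gt0 xy; rewrite d2C /d2 /dot /=.
have w0 : 0 < w1 * w1 + w2 * w2.
  by have := d2_gt0 xz; rewrite d2C /d2 /dot /=.
have uw0 : 0 < (u1 - w1) * (u1 - w1) + (u2 - w2) * (u2 - w2).
  have := d2_gt0 yz; rewrite /d2 /dot /= /u1 /u2 /w1 /w2; lra.
pose U := u1 * u1 + u2 * u2.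
have k1 : U * w1 = (u1 * w1 + u2 * w2) * u1.
  transitivity ((u1 * w1 + u2 * w2) * u1 - u2 * (u1 * w2 - u2 * w1)).
    by rewrite /U; ring.
  by rewrite col; ring.
have k2 : U * w2 = (u1 * w1 + u2 * w2) * u2.
  transitivity ((u1 * w1 + u2 * w2) * u2 + u1 * (u1 * w2 - u2 * w1)).
    by rewrite /U; ring.
  by rewrite col; ring.
pose m := (u1 * w1 + u2 * w2) / U.
have U0 : U != 0 by rewrite gt_eqF.
have mw1 : w1 = m * u1 by apply: (mulfI U0); rewrite k1 /m; field.
have mw2 : w2 = m * u2 by apply: (mulfI U0); rewrite k2 /m; field.
have mm : m * (m - 1) * U = 0.
  transitivity (2 * (w1 * g1 + w2 * g2) + (w1 * w1 + w2 * w2) -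
    m * (2 * (u1 * g1 + u2 * g2) + (u1 * u1 + u2 * u2))).
    by rewrite /U mw1 mw2; ring.
  by rewrite q1 q2; ring.
have : (m == 0) || (m - 1 == 0).
  by move/eqP: mm; rewrite mulf_eq0 (negbTE U0) orbF mulf_eq0.
rewrite subr_eq0; clearbody m; move=> /orP[]/eqP m0.
  by move: w0; rewrite mw1 mw2 m0 !mul0r addr0 ltxx.
by move: uw0; rewrite mw1 mw2 m0 !mul1r !subrr mulr0 addr0 ltxx.
Qed.

Lemma bounded_d2 A p : bounded_set A -> exists M, forall x, A x -> d2 x p <= M.
Proof.
move=> [M [_ hM]]; pose r := `|M| + 1; have r0 : 0 <= r by rewrite addr_ge0.
have Mr : M < r by rewrite (le_lt_trans (ler_norm M))// ltrDl.
exists ((r + `|p.1|) ^+ 2 + (r + `|p.2|) ^+ 2) => x Ax.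
have := hM r Mr x Ax; rewrite {1}/Num.norm /= ge_max => /andP[x1 x2].
rewrite /d2 /dot /= -!expr2 lerD// -[leLHS]real_normK ?num_real//.
  by rewrite lerXn2r ?nnegrE ?addr_ge0// (le_trans (ler_normB _ _))// lerD2r.
by rewrite lerXn2r ?nnegrE ?addr_ge0// (le_trans (ler_normB _ _))// lerD2r.
Qed.

Section Image.
Variable s : R * R -> R * R.
Hypotheses (is_ : improper s) (ss : involutive s).

Lemma image_involutive A z : (s @` A) z <-> A (s z).
Proof.
split; first by move=> [x Ax <-]; rewrite ss.
by move=> Az; exists (s z); rewrite // ss.
Qed.

Lemma image_imageK A : s @` (s @` A) = A.
Proof. by apply/seteqP; split => z; rewrite !image_involutive ss. Qed.

Lemma image_closure A : s @` closure A = closure (s @` A).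
Proof.
apply/seteqP; split => z; rewrite image_involutive !closure_d2 => H r r0.
  have [y Ay yr] := H r r0; exists (s y); first by apply/image_involutive; rewrite ss.
  by rewrite -(improper_d2 _ _ is_) ss.
have [y Ay yr] := H r r0; exists (s y); first exact/image_involutive.
by rewrite (improper_d2 _ _ is_).
Qed.

Lemma image_open A : open A -> open (s @` A).
Proof.
move=> oA; apply: open_d2 => z /image_involutive/(open_d2P oA)[r r0 hr].
by exists r => // y yz; apply/image_involutive/hr; rewrite improper_d2.
Qed.

Let component_sub A z : connected_component (s @` A) (s z) `<=`
  s @` connected_component A z.
Proof.
move=> x [C [Cz CA cC] Cx]; apply/image_involutive; exists (s @` C); last first.
  by apply/image_involutive; rewrite ss.
split.
- exact/image_involutive.
- by move=> y /image_involutive/CA/image_involutive; rewrite ss.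
- by apply: connected_continuous_connected => //;
    exact/continuous_subspaceT/cont_improper.
Qed.

Lemma image_component A z :
  s @` connected_component A z = connected_component (s @` A) (s z).
Proof.
apply/seteqP; split; last exact: component_sub.
move=> x /image_involutive h; have := @component_sub (s @` A) (s z).
by rewrite image_imageK ss => /(_ _ h)/image_involutive; rewrite ss.
Qed.

Lemma bounded_image A : bounded_set A -> bounded_set (s @` A).
Proof.
move=> bA; apply: contrapT => nb; have [M hM] := bounded_d2 (s 0) bA.
have [x /image_involutive Ax] := unbounded_far 0 nb M.
by rewrite ltNge -(improper_d2 _ _ is_) hM.
Qed.

Lemma image_setC A : s @` (~` A) = ~` (s @` A).
Proof.
apply/seteqP; split => z; first by move=> /image_involutive h /image_involutive.
by move=> h; apply/image_involutive => Az; apply: h; exact/image_involutive.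
Qed.

Lemma image_inside A : s @` inside A = inside (s @` A).
Proof.
have key B : s @` inside B `<=` inside (s @` B).
  move=> z /image_involutive[Bz bz]; split; first by move/image_involutive.
  rewrite -image_setC -[z]ss -image_component; exact: bounded_image.
apply/seteqP; split; first exact: key.
by move=> z hz; apply/image_involutive; have := key (s @` A) (s z);
  rewrite image_imageK; apply; apply/image_involutive; rewrite ss.
Qed.

Lemma image_contractible A : contractible R A -> contractible R (s @` A).
Proof.
move=> [c [H [Ac cH HA H0 H1]]]; exists (s c), (fun w : R * (R * R) => s (H (w.1, s w.2))); split.
- by apply/image_involutive; rewrite ss.
- move/subspace_continuousP: cH => cH; apply/subspace_continuousP => -[t z] [/= ht Az].
  apply: (@cvg_comp _ _ _ (fun w : R * (R * R) => H (w.1, s w.2)) s _ (nbhs (H (t, s z)))); last exact: cont_improper.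
  apply: (@cvg_comp _ _ _ (fun w : R * (R * R) => (w.1, s w.2)) H _
    (within (`[0, 1]%classic `*` A) (nbhs (t, s z)))); last first.
    by apply: cH; split => //; exact/image_involutive.
  have cg : continuous (fun w : R * (R * R) => (w.1, s w.2)).
    move=> w; apply: (cvg_pair (G := nbhs w.1) (H := nbhs (s w.2))); first exact: cvg_fst.
    by apply: continuous_comp; [exact: cvg_snd|exact: cont_improper].
  move=> B wB; have : \forall w \near (t, z), (`[0, 1]%classic `*` A) (w.1, s w.2) -> B (w.1, s w.2).
    exact: (cg (t, z) [set y | (`[0, 1]%classic `*` A) y -> B y]).
  apply: filterS => -[u x] /= hx [/= hu hAx]; apply: hx; split => //=.
  exact/image_involutive.
- by move=> t z ht /image_involutive Az; apply/image_involutive; rewrite ss; exact: HA.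
- by move=> z /image_involutive Az; rewrite /= H0// ss.
- by move=> z /image_involutive Az; rewrite /= H1.
Qed.

(** Orientation is reversed, so the image contour is run backwards, and the new generating curve is
    the image of the far side. *)
Lemma image_radial_tile e p a (U : set (R * R)) : radial_tile e p a U ->
  radial_tile (fun u => s (rotation a p (e u))) (s p) a (s @` U).
Proof.
move=> [a02 e0 [[cc cE ci] [V [VE oV cV bV UV]]]].
have /andP[a0 _] := a02.
have E u : contour (fun u => s (rotation a p (e u))) (s p) a u = s (contour e p a (3 - u)).
  rewrite /contour; have [u1|u1] := leP u 1.
    have h1 : (3 - u <= 1) = false by apply/negbTE; rewrite -ltNge; lra.
    rewrite h1; have -> : 3 - (3 - u) = u by ring.
    case: (leP (3 - u) 2) => // h2; have -> : u = 1 by lra.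
    by congr (s (rotation _ _ _)); ring.
  have [u2|u2] := leP u 2.
    rewrite improper_rot// rotationD; case: (leP (3 - u) 1) => h1.
      have -> : u = 2 by lra.
      have -> : a * (2 - 1) + - a = 0 by ring.
      by rewrite rotation0; congr (s (e _)); ring.
    rewrite ifT; last by lra.
    by rewrite improper_rot//; congr rotation; ring.
  rewrite ifT; last by lra.
  by rewrite improper_rot// rotationD addrN rotation0.
have imE : contour (fun u => s (rotation a p (e u))) (s p) a @` `[0, 3] =
    s @` (contour e p a @` `[0, 3]).
  apply/seteqP; split => z.
    move=> [u /=]; rewrite in_itv/= => hu <-; rewrite E.
    exists (contour e p a (3 - u)) => //; exists (3 - u) => //=.
    by rewrite in_itv/=; lra.
  move=> [_ [u /= + <-] <-]; rewrite in_itv/= => hu.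
  exists (3 - u); first by rewrite /= in_itv/=; lra.
  by rewrite E; congr (s (contour _ _ _ _)); ring.
split => //; first by rewrite e0 rotation_center.
split; first split.
- have -> : contour (fun u => s (rotation a p (e u))) (s p) a =
      s \o (contour e p a \o (fun u => 3 - u)) by apply/funext => u /=; rewrite E.
  apply/subspace_continuousP => u /=; rewrite in_itv/= => hu.
  apply: cvg_comp; last exact: cont_improper.
  move/subspace_continuousP: cc => cc.
  apply: (@cvg_comp _ _ _ (fun u => 3 - u) (contour e p a) _
    (within `[0, 3]%classic (nbhs (3 - u)))); last first.
    by apply: cc; rewrite /= in_itv/=; lra.
  have cg : continuous (fun u : R => 3 - u).
    by apply: contB; [exact: cont_cst|exact: cont_id].
  move=> B wB; have : \forall x \near u, `[0, 3]%classic (3 - x) -> B (3 - x).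
    exact: (cg u [set y | `[0, 3]%classic y -> B y]).
  apply: filterS => x hx /=; rewrite in_itv/= => h; apply: hx.
  by rewrite /= in_itv/=; lra.
- by rewrite !E subr0 subrr cE.
- move=> u v; rewrite !in_itv/= => /andP[u0 u3] /andP[v0 v3].
  rewrite !E => /(can_inj ss) H.
  have [u00|u00] := eqVneq u 0; have [v00|v00] := eqVneq v 0.
  + by rewrite u00 v00.
  + have up : 0 < v by rewrite lt_neqAle eq_sym v00.
    move: H; rewrite u00 subr0 -cE => H.
    suff : 0 = 3 - v by lra.
    by apply: ci H; rewrite in_itv/=; lra.
  + have up : 0 < u by rewrite lt_neqAle eq_sym u00.
    move: H; rewrite v00 subr0 -cE => H.
    suff : 3 - u = 0 by lra.
    by apply: ci H; rewrite in_itv/=; lra.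
  + have up : 0 < u by rewrite lt_neqAle eq_sym u00.
    have vp : 0 < v by rewrite lt_neqAle eq_sym v00.
    suff : 3 - u = 3 - v by lra.
    by apply: ci => //; rewrite in_itv/=; lra.
exists (s @` V); split.
- by rewrite imE VE image_inside.
- exact: image_open.
- exact: image_contractible.
- rewrite imE -bV; apply/seteqP; split => z.
    rewrite -image_closure => -[/image_involutive cz nz]; apply/image_involutive.
    by split => // Vz; apply: nz; exact/image_involutive.
  move=> /image_involutive[cz nz]; split.
    by rewrite -image_closure; exact/image_involutive.
  by move/image_involutive.
- by rewrite UV image_closure.
Qed.

End Image.
End Isometries.

(** * Maps of simple loops *)

Section Loops.
Context {R : realType}.
Implicit Types (p q z : R * R) (t u v b : R) (c d e : R -> R * R)
  (h : R -> R) (f : R * R -> R * R).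

Lemma cont_d2T (T : topologicalType) (c : T -> R * R) z : continuous c ->
  continuous (fun w : T => d2 (c w) z).
Proof.
by move=> cc; apply: contD; apply: contM; apply: contB;
  do ?[exact: cont_cst|exact: cont_fst|exact: cont_snd].
Qed.

(** By compactness, the points of [c] with parameter at least [r] away from [h t0] stay at positive
    distance from [d t0], so a nearby point [d t] has its parameter close to [h t0]. *)
Lemma param_continuous c a b d h (D : set R) : continuous c -> continuous d ->
  (forall t, D t -> a <= h t <= b /\ c (h t) = d t) ->
  (forall t x, D t -> a <= x <= b -> c x = d t -> x = h t) ->
  {within D, continuous h}.
Proof.
move=> cc cd hD hU; apply/subspace_continuousP => t0 Dt0.
apply/cvgrPdist_lt => r r0.
have [/andP[ah hb] hE] := hD t0 Dt0.
have half l m : a <= l -> m <= b -> (h t0 < l \/ m < h t0) ->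
    exists2 w, 0 < w & forall x, l <= x <= m -> w <= d2 (c x) (d t0).
  move=> al mb hl; have [lm|ml] := leP l m; last first.
    by exists 1 => // x /andP[lx xm]; have := le_lt_trans (le_trans lx xm) ml; rewrite ltxx.
  have [|x xlm hx] := @EVT_min R (fun x => d2 (c x) (d t0)) l m lm.
    exact/continuous_subspaceT/cont_d2T.
  move: xlm; rewrite in_itv/= => /andP[lx xm].
  exists (d2 (c x) (d t0)); last by move=> y hy; apply: hx; rewrite in_itv.
  apply: d2_gt0 => E.
  have := hU t0 x Dt0 _ E; rewrite (le_trans al lx) (le_trans xm mb) => /(_ isT) xh.
  by case: hl; rewrite -xh ltNge ?lx ?xm.
have [w1 w10 hw1] : exists2 w, 0 < w & forall x, a <= x <= h t0 - r -> w <= d2 (c x) (d t0).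
  by apply: half => //; [lra|right; lra].
have [w2 w20 hw2] : exists2 w, 0 < w & forall x, h t0 + r <= x <= b -> w <= d2 (c x) (d t0).
  by apply: half => //; [lra|left; lra].
have w0 : 0 < Num.min w1 w2 by rewrite lt_min w10.
have : \forall t \near t0, d2 (d t) (d t0) < Num.min w1 w2.
  have dd : d2 (d t0) (d t0) < Num.min w1 w2 by rewrite d2xx.
  exact: (cvgr_lt _ (@cont_d2T _ d (d t0) cd t0) _ dd).
move=> H; rewrite /within/=; near_simpl; move: H; apply: filterS => t.
rewrite lt_min => /andP[t1 t2] Dt; have [/andP[aht htb] htE] := hD t Dt.
change (`|h t0 - h t| < r); rewrite ltr_norml; apply/andP; split.
  rewrite ltNge; apply/negP => hh; move: t2; rewrite -htE ltNge hw2//.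
  by rewrite htb andbT; lra.
rewrite ltNge; apply/negP => hh; move: t1; rewrite -htE ltNge hw1//.
by rewrite aht/=; lra.
Qed.

Record simple_loop c (L : R) : Prop := SimpleLoop {
  loop_pos : 0 < L ;
  loop_cont : continuous c ;
  loop_closed : c L = c 0 ;
  loop_inj : forall u v, 0 <= u < L -> 0 <= v < L -> c u = c v -> u = v }.

Lemma loop_inner c L u v : simple_loop c L -> 0 < u < L -> 0 <= v <= L ->
  c u = c v -> u = v.
Proof.
move=> [L0 cc cL ci] /andP[u0 uL] /andP[v0 vL] E.
have [vE|vn] := eqVneq v L.
  have := ci u 0; rewrite E vE cL uL (ltW u0) lexx L0 => /(_ isT isT erefl).
  by move=> u00; rewrite u00 ltxx in u0.
by apply: ci => //; [rewrite ltW|rewrite v0 lt_neqAle vn].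
Qed.

Lemma loop_base c L u : simple_loop c L -> 0 < u < L -> c u <> c 0.
Proof.
move=> hc hu /(loop_inner hc hu); have L0 := loop_pos hc.
by rewrite lexx ltW// => /(_ isT) u0; move: hu; rewrite u0 ltxx.
Qed.

Lemma simple_loop_rev c L : simple_loop c L -> simple_loop (fun u => c (L - u)) L.
Proof.
move=> hc; have [L0 cc cL ci] := hc; split => //.
- apply: (cont_comp (f := fun u => L - u)) => //.
  by apply: contB; [exact: cont_cst|exact: cont_id].
- by rewrite subrr subr0.
- move=> u v /andP[u0 uL] /andP[v0 vL] E.
  have [uE|un] := eqVneq u 0; have [vE|vn] := eqVneq v 0.
  + by rewrite uE vE.
  + have := @loop_inner c L (L - v) (L - u) hc; rewrite -E.
    have vp : 0 < v by rewrite lt_neqAle eq_sym vn.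
    move=> H; have : L - v = L - u by apply: H => //; lra.
    lra.
  + have := @loop_inner c L (L - u) (L - v) hc; rewrite -E.
    have up : 0 < u by rewrite lt_neqAle eq_sym un.
    move=> H; have : L - u = L - v by apply: H => //; lra.
    lra.
  + have up : 0 < u by rewrite lt_neqAle eq_sym un.
    have vp : 0 < v by rewrite lt_neqAle eq_sym vn.
    suff : L - u = L - v by lra.
    by apply: ci => //; lra.
Qed.

(* The parameter change induced on a simple loop by an injective map fixing the
   base point. *)
Lemma loop_map c L f : simple_loop c L -> continuous f -> injective f ->
  f (c 0) = c 0 -> (forall u, 0 <= u <= L -> exists2 v, 0 <= v <= L & f (c u) = c v) ->
  exists h, [/\ forall u, 0 < u < L -> 0 < h u < L,
    forall u, 0 < u < L -> f (c u) = c (h u)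
    & {within `]0, L[, continuous h}].
Proof.
move=> hc cf fi f0 fC.
have H u : exists v, 0 < u < L -> 0 < v < L /\ f (c u) = c v.
  have [hu|hu] := boolP (0 < u < L); last by exists 0.
  have [v /andP[v0 vL] E] : exists2 v, 0 <= v <= L & f (c u) = c v.
    by apply: fC; move: hu => /andP[/ltW-> /ltW->].
  exists v => _; split => //; rewrite !lt_neqAle v0 vL !andbT.
  have ne : f (c u) <> c 0.
    by rewrite -f0 => /fi; exact: loop_base hc hu.
  apply/andP; split; apply/eqP => vE; apply: ne; rewrite E.
    by rewrite -vE.
  by rewrite vE (loop_closed hc).
have [h hh] := choice H; exists h; split.
- by move=> u hu; have [] := hh u hu.
- by move=> u hu; have [] := hh u hu.
- apply: (@param_continuous c 0 L (f \o c) h); first exact: loop_cont hc.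
  + exact: cont_comp (loop_cont hc) cf.
  + move=> t /=; rewrite in_itv/= => ht; have [/andP[/ltW-> /ltW->] ->] := hh t ht.
    by [].
  + move=> t x /=; rewrite in_itv/= => ht hx; have [hht ->] := hh t ht.
    by move=> /esym /(loop_inner hc hht hx).
Qed.

(** Among the parameters whose point is at least as far from [z] as that of [L / 2], let [M] be the
    largest. As [f] preserves the distance to [z], [h M] is another one, and it is larger. *)
Lemma loop_no_up c L f h z : simple_loop c L ->
  (forall x, d2 (f x) z = d2 x z) -> c 0 = z ->
  (forall u, 0 < u < L -> 0 < h u < L) ->
  (forall u, 0 < u < L -> f (c u) = c (h u)) ->
  (forall u, 0 < u < L -> u < h u) -> False.
Proof.
move=> hc fd c0 hL hE hup; have L0 := loop_pos hc.
have hm : 0 < L / 2 < L by lra.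
pose g u := d2 (c u) z.
have g0 : 0 < g (L / 2).
  by apply: d2_gt0; rewrite -c0; exact: loop_base hc hm.
pose S := `[0, L]%classic `&` [set u | g (L / 2) <= g u].
have cg : continuous g by apply: cont_d2T; exact: loop_cont hc.
have cS : compact S.
  apply: (@subclosed_compact _ _ `[0, L]%classic); last by move=> ? [].
    apply: closedI; first exact: interval_closed.
    exact: (closed_comp (fun u _ => cg u) (@closed_ge R (g (L / 2)))).
  exact: segment_compact.
have [|||M] := @compact_EVT_max R R id S.
- by exists (L / 2); split => //=; rewrite in_itv/=; lra.
- exact: cS.
- by apply: continuous_subspaceT => u; exact: cvg_id.
rewrite inE => -[/=]; rewrite in_itv/= => /andP[M0 ML] gM Mmax.
have hM : 0 < M < L.
  rewrite !lt_neqAle M0 ML !andbT; apply/andP; split; apply/eqP => E.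
    by move: gM; rewrite -E /g c0 d2xx leNgt g0.
  by move: gM; rewrite E /g (loop_closed hc) c0 d2xx leNgt g0.
have /Mmax : h M \in S.
  rewrite inE; split => /=.
    by rewrite in_itv/=; have /andP[/ltW-> /ltW->] := hL M hM.
  by rewrite /g -hE// fd.
by rewrite leNgt hup.
Qed.

(** Without a fixed point, [h u - u] has constant sign by the intermediate value theorem. Running
    the loop backwards exchanges the two signs, so [loop_no_up] excludes both. *)
Lemma loop_fix c L f z : simple_loop c L -> continuous f -> injective f -> c 0 = z ->
  f z = z -> (forall x, d2 (f x) z = d2 x z) ->
  (forall u, 0 <= u <= L -> exists2 v, 0 <= v <= L & f (c u) = c v) ->
  exists2 u, 0 < u < L & f (c u) = c u.
Proof.
move=> hc cf fi c0 fz fd fC; have L0 := loop_pos hc.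
have [|h [h1 h2 h3]] := loop_map hc cf fi _ fC; first by rewrite c0.
apply: contrapT => nofix.
have hn u : 0 < u < L -> h u <> u.
  by move=> hu E; apply: nofix; exists u; rewrite // h2// E.
have key u v : 0 < u < L -> 0 < v < L -> u < h u -> h v < v -> False.
  move=> hu hv u1 v1.
  have ch w1 w2 : 0 < w1 < L -> 0 < w2 < L ->
      {within `[w1, w2], continuous (fun w => h w - w)}.
    move=> /andP[w10 w1L] /andP[w20 w2L] w; apply: cvgB; last first.
      by apply: (@continuous_subspaceT _ _ `[w1, w2] (fun w : R => w)) => y; exact: cvg_id.
    apply: (continuous_subspaceW _ h3) => y /=; rewrite !in_itv/=; lra.
  have [uv|uv] := leP u v.
    have [|w] := @IVT R (fun w => h w - w) u v 0 uv (ch _ _ hu hv).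
      by rewrite ge_min le_max; lra.
    rewrite in_itv/= => hw E; have : h w = w by lra.
    by apply: hn; lra.
  have [|w] := @IVT R (fun w => h w - w) v u 0 (ltW uv) (ch _ _ hv hu).
    by rewrite ge_min le_max; lra.
  rewrite in_itv/= => hw E; have : h w = w by lra.
  by apply: hn; lra.
have hm : 0 < L / 2 < L by lra.
have [up|dn|] := ltgtP (L / 2) (h (L / 2)); last by move/esym/(hn _ hm).
  apply: (@loop_no_up c L f h z hc fd c0 h1 h2) => u hu.
  have [//|d|E] := ltgtP u (h u); last by case: (hn u hu).
  by case: (key _ _ hm hu up d).
apply: (@loop_no_up (fun u => c (L - u)) L f (fun u => L - h (L - u)) z).
- exact: simple_loop_rev.
- exact: fd.
- by rewrite subr0 (loop_closed hc).
- by move=> u hu; have := h1 (L - u); lra.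
- move=> u hu; rewrite h2; last by lra.
  by congr c; ring.
- move=> u hu; have hu' : 0 < L - u < L by lra.
  have [d|//|E] := ltgtP (L - u) (h (L - u)).
  + by case: (key _ _ hu' hm d dn).
  + by move=> ?; lra.
  + by case: (hn _ hu').
Qed.

End Loops.

(** * Symmetries of tiles *)

Section TileLoop.
Context {R : realType}.
Implicit Types (p q z : R * R) (a b : R) (c d e : R -> R * R) (X : set (R * R)).

Lemma contPD (T : topologicalType) (f g : T -> R * R) :
  continuous f -> continuous g -> continuous (fun w => f w + g w).
Proof. by move=> cf cg w; apply: cvgD; [exact: cf|exact: cg]. Qed.

Lemma clamp_lo (l r x : R) : l <= r -> x <= l -> clamp l r x = l.
Proof. by move=> lr xl; rewrite /clamp min_r ?max_l// (le_trans xl). Qed.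

Lemma clamp_hi (l r x : R) : l <= r -> r <= x -> clamp l r x = r.
Proof. by move=> lr rx; rewrite /clamp min_l// max_r. Qed.

Lemma rebase c (L u0 : R) : simple_loop c L -> 0 <= u0 < L ->
  exists c', [/\ simple_loop c' L,
    forall x, 0 <= x <= L - u0 -> c' x = c (u0 + x)
    & forall x, L - u0 <= x <= L -> c' x = c (x - (L - u0))].
Proof.
move=> hc /andP[u00 u0L]; have [L0 cc cL ci] := hc.
(* On either side of [L - u0] one of the two clamped terms is frozen at [c 0 = c L] and cancels the
   correction [- c 0]. *)
pose c' x := c (clamp 0 L (u0 + x)) + (c (clamp 0 L (x - (L - u0))) - c 0).
have E1 x : 0 <= x <= L - u0 -> c' x = c (u0 + x).
  move=> hx; rewrite /c' clamp_id; last by lra.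
  by rewrite clamp_lo ?subrr ?addr0//; lra.
have E2 x : L - u0 <= x <= L -> c' x = c (x - (L - u0)).
  move=> hx; rewrite /c' clamp_hi; [|lra|lra].
  by rewrite clamp_id ?cL; [rewrite addrC subrK|lra].
exists c'; split => //; split => //.
- apply: contPD.
    apply: (cont_comp (f := fun x => clamp 0 L (u0 + x))) => //.
    apply: (cont_comp (f := fun x => u0 + x)); last exact: cont_clamp.
    by apply: contD; [exact: cont_cst|exact: cont_id].
  apply: contPD; last exact: cst_continuous.
  apply: (cont_comp (f := fun x => clamp 0 L (x - (L - u0)))) => //.
  apply: (cont_comp (f := fun x => x - (L - u0))); last exact: cont_clamp.
  by apply: contB; [exact: cont_id|exact: cont_cst].
- rewrite E2; last by lra.
  by rewrite E1; [congr c; ring|lra].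
- move=> x y hx hy; have [x1|x1] := leP x (L - u0); have [y1|y1] := leP y (L - u0).
  + rewrite !E1; [|lra|lra] => E.
    have [xe|xn] := eqVneq x (L - u0); have [ye|yn] := eqVneq y (L - u0).
    * by rewrite xe ye.
    * have yl : y < L - u0 by rewrite lt_neqAle yn.
      have : u0 + y = 0.
        apply: ci; [lra|lra|]; rewrite -E xe -cL; congr c; ring.
      lra.
    * have xl : x < L - u0 by rewrite lt_neqAle xn.
      have : u0 + x = 0.
        apply: ci; [lra|lra|]; rewrite E ye -cL; congr c; ring.
      lra.
    * have yl : y < L - u0 by rewrite lt_neqAle yn.
      have xl : x < L - u0 by rewrite lt_neqAle xn.
      have : u0 + x = u0 + y by apply: ci => //; lra.
      lra.
  + rewrite E1; last lra; rewrite E2; last lra; move=> E.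
    have [xe|xn] := eqVneq x (L - u0).
      have : 0 = y - (L - u0).
        apply: ci; [lra|lra|]; rewrite -E xe -cL; congr c; ring.
      lra.
    have xl : x < L - u0 by rewrite lt_neqAle xn.
    have : u0 + x = y - (L - u0) by apply: ci => //; lra.
    lra.
  + rewrite E2; last lra; rewrite E1; last lra; move=> E.
    have [ye|yn] := eqVneq y (L - u0).
      have : 0 = x - (L - u0).
        apply: ci; [lra|lra|]; rewrite E ye -cL; congr c; ring.
      lra.
    have yl : y < L - u0 by rewrite lt_neqAle yn.
    have : u0 + y = x - (L - u0) by apply: ci => //; lra.
    lra.
  + rewrite !E2; [|lra|lra] => E.
    have : x - (L - u0) = y - (L - u0) by apply: ci => //; lra.
    lra.
Qed.

(* A globally continuous version of [contour]. *)
Definition tloop e p a (x : R) : R * R :=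
  e (clamp 0 1 x) + ((rotation (a * clamp 0 1 (x - 1)) p (e 1) - e 1) +
  (rotation a p (e (clamp 0 1 (3 - x))) - rotation a p (e 1))).

Lemma tloop1 e p a x : 0 <= x <= 1 -> tloop e p a x = e x.
Proof.
move=> hx; rewrite /tloop clamp_id// clamp_lo; [|lra|lra].
by rewrite clamp_hi; [rewrite mulr0 rotation0 !subrr !addr0|lra|lra].
Qed.

Lemma tloop2 e p a x : 0 <= x <= 1 -> tloop e p a (1 + x) = rotation (a * x) p (e 1).
Proof.
move=> hx; rewrite /tloop clamp_hi; [|lra|lra].
have -> : 1 + x - 1 = x by ring.
rewrite clamp_id// clamp_hi; [|lra|lra].
by rewrite subrr addr0 addrC subrK.
Qed.

Lemma tloop3 e p a x : 0 <= x <= 1 -> tloop e p a (3 - x) = rotation a p (e x).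
Proof.
move=> hx; rewrite /tloop clamp_hi; [|lra|lra].
rewrite clamp_hi; [|lra|lra].
have -> : 3 - (3 - x) = x by ring.
by rewrite clamp_id// mulr1 addrA [e 1 + _]addrC subrK addrC subrK.
Qed.

Lemma tloop_cases (x : R) : 0 <= x <= 3 -> [\/ 0 <= x <= 1,
  exists2 y, 0 < y <= 1 & x = 1 + y | exists2 u, 0 <= u < 1 & x = 3 - u].
Proof.
move=> hx; have [x1|x1] := leP x 1; first by apply: Or31; lra.
have [x2|x2] := leP x 2; first by apply: Or32; exists (x - 1); lra.
by apply: Or33; exists (3 - x); lra.
Qed.

Lemma tloop_frame e p a z : 0 < a ->
  frame e p a z <-> exists2 x, 0 <= x <= 3 & tloop e p a x = z.
Proof.
move=> a0; split.
  case=> -[u hu <-].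
  - by exists u; [lra|rewrite tloop1].
  - have au : a * (u / a) = u by field; rewrite gt_eqF.
    have ua : 0 <= u / a <= 1 by rewrite divr_ge0 ?ler_pdivrMr ?mul1r//; lra.
    by exists (1 + u / a); [lra|rewrite tloop2// au].
  - by exists (3 - u); [lra|rewrite tloop3].
move=> [x hx <-]; case: (tloop_cases hx) => [h|[y hy ->]|[u hu ->]].
- by rewrite tloop1//; apply: Or31; exists x.
- rewrite tloop2; last lra.
  by apply: Or32; exists (a * y) => //; apply/andP; split; nra.
- by rewrite tloop3; [apply: Or33; exists u => //; lra|lra].
Qed.

Section Tile.
Variables (e : R -> R * R) (p : R * R) (a : R) (V : set (R * R)).
Hypothesis HT : tile e p a V.

Lemma tloop_simple : simple_loop (tloop e p a) 3.
Proof.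
have a0 := tile_pos HT; have ce := tile_cont HT.
have I1 : 0 <= (1 : R) <= 1 by lra.
split.
- by lra.
- apply: contPD; first by apply: (cont_comp (f := clamp 0 1)) => //; exact: cont_clamp.
  apply: contPD.
    apply: contPD; last exact: cst_continuous.
    have ca : continuous (fun x : R => a * clamp 0 1 (x - 1)).
      apply: contM; first exact: cont_cst.
      apply: (cont_comp (f := fun x : R => x - 1) (g := clamp 0 1)); last exact: cont_clamp.
      by apply: contB; [exact: cont_id|exact: cont_cst].
    exact: (cont_comp ca (@cont_circ R p (e 1))).
  apply: contPD; last exact: cst_continuous.
  apply: (cont_comp (f := fun x : R => e (clamp 0 1 (3 - x))) (g := rotation a p)); last exact: cont_rotation.
  apply: (cont_comp (f := fun x : R => clamp 0 1 (3 - x)) (g := e)) => //.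
  apply: (cont_comp (f := fun x : R => 3 - x) (g := clamp 0 1)); last exact: cont_clamp.
  by apply: contB; [exact: cont_cst|exact: cont_id].
- have -> : (3 : R) = 3 - 0 by rewrite subr0.
  rewrite tloop3; last by lra.
  by rewrite tloop1 ?(tile_start HT) ?rotation_center//; lra.
- move=> u v; wlog uv : u v / u <= v.
    move=> H hu hv E; have [uv|uv] := leP u v; first exact: H.
    by apply/esym; apply: H => //; exact: ltW.
  move=> /andP[u0 u3] /andP[v0 v3].
  have hu : 0 <= u <= 3 by rewrite u0 ltW.
  have hv : 0 <= v <= 3 by rewrite v0 ltW.
  case: (tloop_cases hu) => [h|[y hy uE]|[w hw uE]];
    case: (tloop_cases hv) => [h'|[y' hy' vE]|[w' hw' vE]].
  + by rewrite !tloop1//; exact: (tile_inj HT).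
  + rewrite vE tloop1// tloop2; last lra.
    have hay : 0 <= a * y' <= a by apply/andP; split; nra.
    by move=> /(tile_arc HT h hay) [_ ay]; move: hy'; nra.
  + rewrite vE tloop1// tloop3; last lra.
    have hw1 : 0 <= w' <= 1 by lra.
    by move=> /(tile_sides HT h hw1)[_ w0]; lra.
  + lra.
  + rewrite uE vE !tloop2; [|lra|lra] => E.
    have : e 1 = rotation (a * (y' - y)) p (e 1).
      rewrite -[LHS](rotationK (a * y) p) E rotationD; congr rotation; ring.
    have hay : 0 <= a * (y' - y) <= a by apply/andP; split; nra.
    move=> /(tile_arc HT I1 hay) [_ /eqP].
    rewrite mulf_eq0 gt_eqF//= => /eqP; lra.
  + rewrite uE vE tloop2; last lra; rewrite tloop3; last lra.
    have hay : 0 <= a * y <= a by apply/andP; split; nra.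
    have hw1 : 0 <= w' <= 1 by lra.
    by move=> /esym/(tile_arc' HT hw1 hay)[]; lra.
  + lra.
  + lra.
  + rewrite uE vE !tloop3; [|lra|lra] => /rotation_inj E.
    have -> // : w = w' by apply: (tile_inj HT) => //; lra.
Qed.

(** The boundary is expressed by the closed tile alone, so that an isometry preserving this set
    preserves the contour. *)
Definition bdry X z := X z /\ forall r, 0 < r -> exists2 y, d2 y z < r & ~ X y.

Variable N : nat.
Hypotheses (Na : N%:R * a = pi *+ 2) (N2 : (1 < N)%N).

Lemma piece_not_closure i j z : (i < N)%N -> (j < N)%N -> i <> j ->
  piece_of p a V i z -> ~ closure (piece_of p a V j) z.
Proof.
move=> iN jN ij pz /closure_d2 cz.
have [r r0 hr] := open_d2P (@open_piece _ _ _ _ _ HT i) pz.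
have [y py yz] := cz r r0; apply: ij.
exact: (piece_disjoint HT Na iN jN (hr y yz) py).
Qed.

Lemma closure_piece0 z : closure V z <-> closure (piece_of p a V 0) z.
Proof. by split => h; move: h; rewrite closure_piece /irt mul0r oppr0 rotation0. Qed.

(** Points off the closed tile are found in the adjacent tile near a side, and outside the disk near
    the arc. *)
Lemma frame_bdry z : frame e p a z <-> bdry (closure V) z.
Proof.
have N0 : (0 < N)%N by exact: ltnW.
split=> [fz|[cz bz]]; last first.
  apply/(frameE HT); split => // Vz.
  have [r r0 hr] := open_d2P (tile_open HT) Vz.
  have [y yz nVy] := bz r r0; apply: nVy; apply: subset_closure; exact: hr.
split; first by case/(frameE HT): fz.
have near l : (l < N)%N -> l <> 0%N -> frame_of e p a l z ->
    forall r, 0 < r -> exists2 y, d2 y z < r & ~ closure V y.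
  move=> lN l0 /(frame_of_closure HT)/closure_d2 cz r r0.
  have [y py yz] := cz r r0; exists y => //.
  by move=> /closure_piece0; exact: piece_not_closure lN N0 l0 py.
move: fz; rewrite -frame0 => /frame_ofE[[u hu E]|[t ht E]|[u hu E]].
- apply: (near N.-1); [by rewrite prednK|by case: (N) N2 => [|[]]|].
  apply/frame_ofE; apply: Or33; exists u => //.
  by rewrite prednK// -E (sideN e p Na).
- move=> r r0; have [||y yz hy] := @push_out _ p (d2 (e 1) p) z
      [set y | d2 y z < r] (@open_inner _ _ _) _ (r2_gt0 HT).
  + by rewrite /= d2xx.
  + by rewrite -E circ_dist.
  exists y => //; move=> /closure_piece0/closure_d2 cy.
  have [s s0 hs] := open_d2P (@open_outer _ p (d2 (e 1) p)) hy.
  have [x px xy] := cy s s0; have := piece_inner HT Na N0 px.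
  by rewrite ltNge ltW// hs.
- apply: (near 1%N) => //; apply/frame_ofE; apply: Or31; by exists u.
Qed.

Lemma rotation_fix b z x : x <> z -> rotation b z x = x -> forall y, rotation b z y = y.
Proof.
move=> xz; case: x xz => x1 x2 xz; rewrite /rotation /= => -[e1 e2].
have d0 := d2_gt0 xz; rewrite /d2 /dot /= in d0.
have cs := cos2Dsin2 b.
have c1 : cos b = 1.
  have : (1 - cos b) * ((x1 - z.1) * (x1 - z.1) + (x2 - z.2) * (x2 - z.2)) = 0.
    transitivity (- ((z.1 + (cos b * (x1 - z.1) - sin b * (x2 - z.2)) - x1) * (x1 - z.1)
      + (z.2 + (sin b * (x1 - z.1) + cos b * (x2 - z.2)) - x2) * (x2 - z.2))); first by ring.
    by rewrite e1 e2; ring.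
  by move/eqP; rewrite mulf_eq0 (gt_eqF d0) orbF => /eqP; lra.
have s0 : sin b = 0.
  by apply/eqP; rewrite -sqrf_eq0; apply/eqP; move: cs; rewrite c1; lra.
by move=> [y1 y2]; rewrite c1 s0 /=; congr pair; ring.
Qed.

Lemma isometry_bdry (f g : R * R -> R * R) : cancel f g ->
  (forall x y, d2 (f x) (f y) = d2 x y) -> forall X Y : set (R * R),
  (forall x, X x -> Y (f x)) -> (forall x, Y x -> X (g x)) ->
  forall x, bdry X x -> bdry Y (f x).
Proof.
move=> fK fd X Y XY YX x [Xx bx]; split; first exact: XY.
move=> r r0; have [y yx nXy] := bx r r0; exists (f y); first by rewrite fd.
by move=> /YX; rewrite fK.
Qed.

(* A rotation about a boundary point of a tile permutes the contour, hence fixes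
   another of its points. *)
Lemma tile_rotation_sym b z : frame e p a z ->
  (forall x, closure V x -> closure V (rotation b z x)) ->
  (forall x, closure V x -> closure V (rotation (- b) z x)) ->
  forall x, rotation b z x = x.
Proof.
move=> fz h1 h2.
have a0 := tile_pos HT.
have hT := tloop_simple.
have [u0 hu0 u0E] : exists2 u0, 0 <= u0 < 3 & tloop e p a u0 = z.
  have /(tloop_frame _ _ _ a0)[u0 hu0 u0E] := fz.
  have [u3|u3] := eqVneq u0 3; last first.
    by exists u0 => //; move/andP: hu0 => [-> h]; rewrite lt_neqAle u3.
  exists 0; first by rewrite lexx ltr0n.
  by rewrite -(loop_closed hT) -u3.
have [c [hc c1 c2]] := rebase hT hu0.
have cF x : 0 <= x <= 3 -> frame e p a (c x).
  move=> hx; apply/(tloop_frame _ _ _ a0); have [x1|x1] := leP x (3 - u0).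
    by exists (u0 + x); [lra|rewrite c1//; lra].
  by exists (x - (3 - u0)); [lra|rewrite c2//; lra].
have Fc x : frame e p a x -> exists2 v, 0 <= v <= 3 & x = c v.
  move=> /(tloop_frame _ _ _ a0)[v hv <-]; have [vu|vu] := leP u0 v.
    exists (v - u0); first by lra.
    by rewrite c1; [congr (tloop _ _ _ _); ring|lra].
  exists (v + (3 - u0)); first by lra.
  by rewrite c2; [congr (tloop _ _ _ _); ring|lra].
have c0 : c 0 = z by rewrite c1 ?addr0//; lra.
have fd x : d2 (rotation b z x) z = d2 x z by rewrite d2_rotationp.
have [|u hu uE] := loop_fix hc (@cont_rotation _ b z) (@rotation_inj _ b z) c0
  (rotation_center b z) fd.
  move=> u hu; apply: Fc; apply/frame_bdry.
  apply: (isometry_bdry (rotationK b z) (@d2_rotation _ b z) h1 h2).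
  exact/frame_bdry/cF.
apply: (rotation_fix _ uE); rewrite -c0; exact: loop_base hc hu.
Qed.

End Tile.
End TileLoop.

(** * The symmetry of a wedge: the part from p to q, and the groove *)

Section Symmetry.
Context {R : realType}.
Implicit Types (z : R * R).

(** An improper isometry exchanging [p] and [q] fixes their midpoint, so it is the reflection in
    their perpendicular bisector. *)
Lemma improper_equidist (s : R * R -> R * R) (p q x : R * R) : improper s -> p <> q ->
  s p = q -> s q = p -> d2 x p = d2 x q -> s x = x.
Proof.
move=> [C [S [t1 [t2 [E H]]]]] pq; have := d2_gt0 pq.
case: p q x pq => p1 p2 [q1 q2] [x1 x2] _; rewrite !H /d2 /dot /=.
move=> d0 [a1 a2] [b1 b2] dx.
pose u1 := q1 - p1; pose u2 := q2 - p2.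
pose w1 := 2 * x1 - p1 - q1; pose w2 := 2 * x2 - p2 - q2.
have U0 : u1 * u1 + u2 * u2 != 0 by rewrite gt_eqF// /u1 /u2; lra.
have m1 : C * u1 + S * u2 = - u1 by rewrite /u1 /u2; lra.
have m2 : S * u1 - C * u2 = - u2 by rewrite /u1 /u2; lra.
have wu : w1 * u1 + w2 * u2 = 0 by rewrite /w1 /w2 /u1 /u2; lra.
pose K := w2 * u1 - w1 * u2.
have k1 : (u1 * u1 + u2 * u2) * w1 = - u2 * K.
  transitivity (- u2 * K + u1 * (w1 * u1 + w2 * u2)); first by rewrite /K; ring.
  by rewrite wu mulr0 addr0.
have k2 : (u1 * u1 + u2 * u2) * w2 = u1 * K.
  transitivity (u1 * K + u2 * (w1 * u1 + w2 * u2)); first by rewrite /K; ring.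
  by rewrite wu mulr0 addr0.
have n1 : C * w1 + S * w2 = w1.
  apply: (mulfI U0); transitivity (C * ((u1 * u1 + u2 * u2) * w1) +
    S * ((u1 * u1 + u2 * u2) * w2)); first by ring.
  rewrite k1 k2; transitivity (K * (S * u1 - C * u2)); first by ring.
  by rewrite m2; ring.
have n2 : S * w1 - C * w2 = w2.
  apply: (mulfI U0); transitivity (S * ((u1 * u1 + u2 * u2) * w1) -
    C * ((u1 * u1 + u2 * u2) * w2)); first by ring.
  rewrite k1 k2; transitivity (- K * (C * u1 + S * u2)); first by ring.
  by rewrite m1; ring.
by congr pair; move: n1 n2; rewrite /w1 /w2; lra.
Qed.

Variables (e : R -> R * R) (p q : R * R) (al : R) (V : set (R * R)) (N : nat) (u0 : R).
Hypotheses (HT : tile e p al V) (Na : N%:R * al = pi *+ 2) (N4 : (3 < N)%N).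
Hypotheses (hu0 : 0 <= u0 <= 1) (qE : e u0 = q) (pq : p <> q).
Variable s : R * R -> R * R.
Hypotheses (is_ : improper s) (sV : s @` closure V = closure V).

Let sym_mem x : closure V x -> closure V (s x).
Proof. by move=> cx; rewrite -sV; exists x. Qed.

Let N2 : (1 < N)%N. Proof. exact: leq_trans N4. Qed.

Lemma u0_gt0 : 0 < u0.
Proof.
rewrite lt_neqAle andbC; case/andP: hu0 => -> _ /=; apply/eqP => u00; apply: pq.
by rewrite -qE -u00 (tile_start HT).
Qed.

(* A symmetry fixing p and q would put q in a tile next but one to the two tiles
   meeting along the side through q. *)
Lemma symmetry_not_fix : s p = p -> s q = q -> False.
Proof.
move=> sp sq; have sE x : s (rotation al p x) = rotation (- al) p (s x).
  by rewrite improper_rot// sp.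
have u00 := u0_gt0; have hu1 := hu0; suff : u0 = 0 by move=> E; move: u00; rewrite E ltxx.
apply: (side_meets_tile HT Na (j := 1%N)) => //; first by exact: ltn_trans N4.
apply/closure_piece.
have -> : side e p al 0 u0 = q by rewrite /side /rt /= mul0r rotation0.
have -> : irt p al 1 q = s (rotation al p q) by rewrite sE sq /irt mul1r.
apply: sym_mem.
have fq : frame e p al (rotation al p q) by apply: Or33; exists u0; rewrite // qE.
by case/(frameE HT): fq.
Qed.

Hypotheses (sp : s p = q) (sq : s q = p).

Lemma sym_involutive : involutive s.
Proof.
apply: (improper_involutive (x := ((p.1 + q.1) / 2, (p.2 + q.2) / 2))) => //.
by apply: (improper_equidist is_ pq) => //; rewrite /d2 /dot /=; field.
Qed.

Lemma sym_frame x : frame e p al x -> frame e p al (s x).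
Proof.
move=> /(frame_bdry HT Na N2) h; apply/(frame_bdry HT Na N2).
exact: (isometry_bdry sym_involutive (fun x y => improper_d2 x y is_) sym_mem sym_mem).
Qed.

Let G := tloop e p al.
Let hG : simple_loop G 3 := tloop_simple HT.

Lemma G_lo u : 0 <= u <= 1 -> G u = e u. Proof. exact: tloop1. Qed.
Lemma G0 : G 0 = p. Proof. by rewrite G_lo ?(tile_start HT)//; lra. Qed.
Lemma Gu0 : G u0 = q. Proof. by rewrite G_lo. Qed.

Lemma sym_G u : 0 <= u <= 3 -> exists2 v, 0 <= v <= 3 & s (G u) = G v.
Proof.
move=> hu; have : frame e p al (s (G u)).
  by apply: sym_frame; apply/(tloop_frame _ _ _ (tile_pos HT)); exists u.
by move=> /(tloop_frame _ _ _ (tile_pos HT))[v hv vE]; exists v.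
Qed.

(** The side crosses the bisector of [p] and [q] at some parameter [w] before [u0], and that point
    is fixed by [s]. The induced parameter change is continuous and equals [w] there; it cannot
    reach [u0], since [s] sends only [p] to [q]. So it stays below [u0]. *)
Lemma sym_center u : 0 <= u <= u0 -> exists2 v, 0 <= v <= u0 & s (G u) = G v.
Proof.
have u00 := u0_gt0; have hu1 := hu0; have sI := inv_inj sym_involutive.
have lo u' : 0 < u' < u0 -> exists2 v, 0 < v < 3 & s (G u') = G v.
  move=> hu'; have [|v /andP[v0 v3] E] := @sym_G u'; first by lra.
  exists v => //; rewrite !lt_neqAle v0 v3 !andbT.
  have ne : G v <> p.
    rewrite -E -sq => /sI E'; have : u' = u0; last by lra.
    by apply: (loop_inner hG); rewrite ?E' ?Gu0//; lra.
  apply/andP; split; apply/eqP => vE; apply: ne.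
    by rewrite -vE G0.
  by rewrite vE (loop_closed hG) G0.
have /choice[h hh] : forall u', exists v, 0 < u' < u0 -> 0 < v < 3 /\ s (G u') = G v.
  move=> u'; have [hu'|hu'] := boolP (0 < u' < u0); last by exists 0.
  by have [v hv E] := lo u' hu'; exists v.
have ch : {within `]0, u0[, continuous h}.
  apply: (@param_continuous _ G 0 3 (s \o G) h).
  - exact: loop_cont hG.
  - exact: cont_comp (loop_cont hG) (cont_improper is_).
  - move=> t /=; rewrite in_itv/= => ht; have [/andP[/ltW-> /ltW->] ->] := hh t ht.
    by [].
  - move=> t x /=; rewrite in_itv/= => ht hx; have [hht ->] := hh t ht.
    by move=> /esym /(loop_inner hG hht hx).
have [w hw wE] : exists2 w, 0 < w < u0 & h w = w.
  have dpq := d2_gt0 pq.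
  have [||w] := @IVT R (fun u => d2 (e u) p - d2 (e u) q) 0 u0 0 (ltW u00).
  - apply: continuous_subspaceT; apply: contB; apply: cont_d2T; exact: tile_cont HT.
  - rewrite (tile_start HT) qE !d2xx sub0r subr0 (d2C q p) ge_min le_max; lra.
  rewrite in_itv/= => /andP[w0 wu] wE.
  have sw : s (e w) = e w by apply: (improper_equidist is_ pq) => //; lra.
  have hw : 0 < w < u0.
    rewrite !lt_neqAle w0 wu !andbT; apply/andP; split; apply/eqP => E.
      by move: sw; rewrite -E (tile_start HT) sp => /esym.
    by move: sw; rewrite E qE sq.
  exists w => //; have [hhw E] := hh w hw.
  apply: (loop_inner hG hhw); first by lra.
  by rewrite -E G_lo ?sw//; lra.
have below u' : 0 < u' < u0 -> h u' < u0.
  move=> hu'; rewrite ltNge; apply/negP => uh.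
  have cv a b : 0 < a < u0 -> 0 < b < u0 -> {within `[a, b], continuous h}.
    by move=> ha hb; apply: (continuous_subspaceW _ ch) => y /=; rewrite !in_itv/=; lra.
  have [x hx xE] : exists2 x, 0 < x < u0 & h x = u0.
    have [uw|uw] := leP u' w.
      have [|x] := @IVT R h u' w u0 uw (cv _ _ hu' hw).
        by rewrite ge_min le_max wE; lra.
      by rewrite in_itv/= => hx E; exists x => //; lra.
    have [|x] := @IVT R h w u' u0 (ltW uw) (cv _ _ hw hu').
      by rewrite ge_min le_max wE; lra.
    by rewrite in_itv/= => hx E; exists x => //; lra.
  have [_] := hh x hx; rewrite xE Gu0 -sp => /sI; rewrite -G0.
  apply: loop_base hG _; lra.
move=> /andP[u1 u2].
have [uE|un] := eqVneq u 0; first by exists u0; rewrite ?lexx ?(ltW u00)// uE G0 sp Gu0.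
have [uE|un'] := eqVneq u u0; first by exists 0; rewrite ?lexx ?(ltW u00)// uE G0 Gu0 sq.
have hu' : 0 < u < u0 by rewrite !lt_neqAle u1 u2 eq_sym un un'.
have [/andP[h1 _] E] := hh u hu'; exists (h u) => //.
by rewrite ltW//= ltW// below.
Qed.

Lemma sym_rest u : u0 <= u <= 3 -> exists2 v, u0 <= v <= 3 & s (G u) = G v.
Proof.
have u00 := u0_gt0; have hu1 := hu0; move=> hu.
have [|v /andP[v0 v3] E] := @sym_G u; first by lra.
have [uv|vu] := leP u0 v; first by exists v; rewrite ?uv.
have [|w hw wE] := @sym_center v; first by lra.
have : G u = G w by rewrite -wE -E sym_involutive.
have [uE _|un] := eqVneq u 3.
  by exists u0; [lra|rewrite uE (loop_closed hG) G0 sp Gu0].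
have u3 : u < 3 by rewrite lt_neqAle un; lra.
move=> /(loop_inner hG) h; have uw : u = w by apply: h; lra.
exists 3; first by lra.
have -> : u = u0 by lra.
by rewrite Gu0 sq (loop_closed hG) G0.
Qed.

Lemma G_inj_rest u v : u0 <= u <= 3 -> u0 <= v <= 3 -> G u = G v -> u = v.
Proof.
have u00 := u0_gt0; have hu1 := hu0; move=> hu hv E.
have [uE|un] := eqVneq u 3; last first.
  have u3 : u < 3 by rewrite lt_neqAle un; lra.
  by apply: (loop_inner hG) => //; lra.
have [vE|vn] := eqVneq v 3; first by rewrite uE vE.
have v3 : v < 3 by rewrite lt_neqAle vn; lra.
by apply/esym; apply: (loop_inner hG) => //; lra.
Qed.

Lemma groove_param : exists H : R -> R, [/\ forall u, u0 <= u <= 3 -> u0 <= H u <= 3,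
  forall u, u0 <= u <= 3 -> s (G u) = G (H u),
  forall u, u0 <= u <= 3 -> H (H u) = u,
  forall u v, u0 <= u <= 3 -> u0 <= v <= 3 -> (H u <= H v) = (v <= u)
  & H u0 = 3 /\ {within `[u0, 3], continuous H}].
Proof.
have u00 := u0_gt0; have hu1 := hu0.
have /choice[H hH] : forall u, exists v, u0 <= u <= 3 -> u0 <= v <= 3 /\ s (G u) = G v.
  move=> u; have [hu|hu] := boolP (u0 <= u <= 3); last by exists 0.
  by have [v hv E] := sym_rest hu; exists v.
have H1 u : u0 <= u <= 3 -> u0 <= H u <= 3 by move=> /hH[].
have H2 u : u0 <= u <= 3 -> s (G u) = G (H u) by move=> /hH[].
have HH u : u0 <= u <= 3 -> H (H u) = u.
  move=> hu; apply: G_inj_rest => //; first exact/H1/H1.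
  by rewrite -H2 ?H1// -H2// sym_involutive.
have I3 : u0 <= (3 : R) <= 3 by lra.
have Iu : u0 <= u0 <= 3 by lra.
have Hu0 : H u0 = 3.
  by apply: G_inj_rest => //; [exact: H1|rewrite -H2// Gu0 sq (loop_closed hG) G0].
have cH : {within `[u0, 3], continuous H}.
  apply: (@param_continuous _ G u0 3 (s \o G) H).
  - exact: loop_cont hG.
  - exact: cont_comp (loop_cont hG) (cont_improper is_).
  - by move=> t /=; rewrite in_itv/= => ht; split; [exact: H1|rewrite H2].
  - move=> t x /=; rewrite in_itv/= => ht hx E.
    by apply: G_inj_rest => //; [exact: H1|rewrite -H2].
exists H; split => // u v hu hv.
have H3 : H 3 = u0 by rewrite -Hu0 HH.
have := @segment_continuous_inj_ge R H u0 3.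
rewrite Hu0 H3; apply; rewrite ?in_itv//=; first by lra.
by move=> x y; rewrite !in_itv/= => hx hy E; rewrite -(HH x)// -(HH y)// E.
Qed.

Lemma groove_image delta : 0 < delta <= 1 -> exists x2 v2, [/\ 1 < x2 <= 1 + delta,
  0 <= v2 <= 1,
  forall x, u0 <= x <= x2 -> exists2 v, 0 <= v <= v2 & s (G x) = rotation al p (e v)
  & forall v, 0 <= v <= v2 -> exists2 x, u0 <= x <= x2 & s (G x) = rotation al p (e v)].
Proof.
move=> /andP[d0 d1]; have u00 := u0_gt0; have hu1 := hu0.
have [H [H1 H2 HH Hd [Hu0 cH]]] := groove_param.
have I3 : u0 <= (3 : R) <= 3 by lra.
have H3 : H 3 = u0 by rewrite -Hu0 HH//; lra.
have I1 : u0 <= (1 : R) <= 3 by lra.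
have I2 : u0 <= (2 : R) <= 3 by lra.
(* The end of the side is sent to the far side, beyond the arc. Otherwise some point
   [rotation al p (e w)] is sent to [e w]; then [s \o rotation al p] has a fixed point, is
   involutive, and applying it twice to [p] gives [rotation al p q = q]. *)
have H12 : 2 < H 1.
  rewrite ltNge; apply/negP => H1le.
  have H2le : H 2 <= 1 by rewrite -[leRHS](HH 1)// Hd ?H1.
  have ck : {within `[0, 1], continuous (fun u => H (3 - u) - u)}.
    move=> x; apply: cvgB; last first.
      by apply: (@continuous_subspaceT _ _ `[(0 : R), 1] (fun w : R => w)) => y; exact: cvg_id.
    move: x; apply/subspace_continuousP => x /=; rewrite in_itv/= => hx.
    apply: (@cvg_comp _ _ _ (fun u => 3 - u) H _ (within `[u0, 3]%classic (nbhs (3 - x)))).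
      move=> A wA; have cg : continuous (fun u : R => 3 - u).
        by apply: contB; [exact: cont_cst|exact: cont_id].
      have : \forall y \near x, `[u0, 3]%classic (3 - y) -> A (3 - y).
        exact: (cg x [set y | `[u0, 3]%classic y -> A y]).
      by apply: filterS => y hy /=; rewrite in_itv/= => h; apply: hy;
        rewrite /= in_itv/=; lra.
    by move/subspace_continuousP: cH; apply; rewrite /= in_itv/=; lra.
  have [|w] := @IVT R (fun u => H (3 - u) - u) 0 1 0 ler01 ck.
    have -> : 3 - 1 = 2 :> R by ring.
    by rewrite !subr0 H3 ge_min le_max; lra.
  rewrite in_itv/= => hw wE.
  have h3w : u0 <= 3 - w <= 3 by lra.
  have Hw : H (3 - w) = w by lra.
  have E : s (rotation al p (e w)) = e w.
    have -> : rotation al p (e w) = G (3 - w) by rewrite /G tloop3.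
    by rewrite H2// Hw G_lo.
  have gi : involutive (s \o rotation al p).
    by apply: (improper_involutive (x := e w)) => //; exact: improper_rotr.
  have := gi p; rewrite /= rotation_center sp -[X in _ = X]sq => /(inv_inj sym_involutive).
  rewrite -qE => /esym/(tile_sides HT hu0 hu0)[h _]; move: u00; rewrite h ltxx.
  by [].
(* [x2] lies strictly beyond 1: by continuity a genuine piece of the arc is still sent to the far
   side. *)
have [x2 [hx2 Hx2]] : exists x2, 1 < x2 <= 1 + delta /\ 2 <= H x2.
  have [h2|h2] := leP 2 (H (1 + delta)); first by exists (1 + delta); split => //; lra.
  have [|||x] := @IVT R H 1 (1 + delta) 2.
  - by lra.
  - by apply: (continuous_subspaceW _ cH) => y /=; rewrite !in_itv/=; lra.
  - by rewrite ge_min le_max; lra.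
  rewrite in_itv/= => hx xE; exists x; rewrite xE lexx; split => //.
  have [x1|x1] := eqVneq x 1; first by move: xE H12; rewrite x1 => ->; rewrite ltxx.
  have : 1 < x by rewrite lt_neqAle eq_sym x1; lra.
  lra.
have I2' : u0 <= x2 <= 3 by lra.
exists x2, (3 - H x2); have := H1 x2 I2'; split => //; first by lra.
- move=> x hx; have hx3 : u0 <= x <= 3 by lra.
  have h : H x2 <= H x by rewrite Hd//; lra.
  have := H1 x hx3 => h'.
  exists (3 - H x); first by lra.
  rewrite H2// -tloop3; last by lra.
  by congr (tloop _ _ _ _); ring.
- move=> v hv; have h3v : u0 <= 3 - v <= 3 by lra.
  exists (H (3 - v)).
    have -> : (u0 <= H (3 - v)) by case/andP: (H1 _ h3v).
    by rewrite -[X in _ <= X](HH x2)// Hd ?H1//; lra.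
  by rewrite -H2// sym_involutive -tloop3//; lra.
Qed.

End Symmetry.

(** * Isometries between unflipped and flipped tiles *)

Section TileSymmetries.
Context {R : realType}.
Implicit Types (t : R) (i j : nat).

(* If e (kappa v) is the image of e v under an involution fixing e 0, then kappa
   cannot exceed the identity, by the intermediate value theorem; since it is its
   own inverse, it is the identity. *)
Lemma involution_fix_path (e : R -> R * R) (f : R * R -> R * R) (m M : R) :
  continuous e -> continuous f -> involutive f -> 0 <= M <= 1 ->
  (forall u v, 0 <= u <= 1 -> 0 <= v <= 1 -> e u = e v -> u = v) ->
  0 <= m <= 1 -> f (e 0) = e 0 ->
  (forall v, 0 <= v <= m -> exists2 w, 0 <= w <= M & f (e v) = e w) ->
  forall v, 0 <= v <= m -> f (e v) = e v.
Proof.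
move=> ce cf fI hM ei hm f0 H.
have /choice[K hK] : forall v, exists w, 0 <= v <= m -> 0 <= w <= M /\ f (e v) = e w.
  move=> v; have [hv|hv] := boolP (0 <= v <= m); last by exists 0.
  by have [w hw E] := H v hv; exists w.
have K1 v : 0 <= v <= m -> 0 <= K v <= M by move=> /hK[].
have K2 v : 0 <= v <= m -> f (e v) = e (K v) by move=> /hK[].
have cK : {within `[0, m], continuous K}.
  apply: (@param_continuous _ e 0 1 (f \o e) K) => //.
  - exact: cont_comp.
  - move=> t /=; rewrite in_itv/= => ht; rewrite K2//; split => //.
    by have := K1 t ht; lra.
  - move=> t x /=; rewrite in_itv/= => ht hx; rewrite K2// => /ei; apply => //.
    by have := K1 t ht; lra.
have K0 : K 0 = 0.
  have h0 : 0 <= (0 : R) <= m by lra.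
  by apply: ei; [have := K1 0 h0; lra|lra|rewrite -K2].
have up v : 0 <= v <= m -> K v <= v.
  move=> hv; rewrite leNgt; apply/negP => vK.
  have [|||w] := @IVT R K 0 v v.
  - by case/andP: hv.
  - by apply: (continuous_subspaceW _ cK) => y /=; rewrite !in_itv/=; lra.
  - by rewrite K0 ge_min le_max; lra.
  rewrite in_itv/= => hw wE; have hwm : 0 <= w <= m by lra.
  have : e (K v) = e w by rewrite -K2// -wE -K2// fI.
  move=> /ei h; have : K v = w; last by lra.
  by apply: h; [have := K1 v hv; lra|lra].
move=> v hv; rewrite K2//; congr e; apply/eqP; rewrite eq_le up//=.
have hKv : 0 <= K v <= m by have := up v hv; have := K1 v hv; lra.
have E : K (K v) = v.
  apply: ei; [by have := K1 _ hKv; lra|lra|].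
  by rewrite -K2// -K2// fI.
by rewrite -[X in X <= _]E up.
Qed.

(** The induced parameter change is continuous and injective, hence monotone, and an increasing
    involution is the identity. *)
Lemma loop_involution (c : R -> R * R) (L : R) (f : R * R -> R * R) :
  simple_loop c L -> improper f -> f (c 0) = c 0 ->
  (forall u, 0 <= u <= L -> exists2 v, 0 <= v <= L & f (c u) = c v) ->
  (forall u, 0 < u < L -> f (c u) = c u) \/
  exists h : R -> R, [/\ forall u, 0 < u < L -> 0 < h u < L,
    forall u, 0 < u < L -> f (c u) = c (h u),
    forall u, 0 < u < L -> h (h u) = u
    & forall u v, 0 < u < L -> 0 < v < L -> u < v -> h v < h u].
Proof.
move=> hc if_ fc fC; have fI : involutive f := improper_involutive if_ fc.
have [h [h1 h2 ch]] := loop_map hc (cont_improper if_) (inv_inj fI) fc fC.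
have hh u : 0 < u < L -> h (h u) = u.
  move=> hu; apply: (loop_inner hc); first exact/h1/h1.
    by case/andP: hu => /ltW-> /ltW->.
  by rewrite -h2 ?h1// -h2// fI.
have hi : {in `]0, L[ &, injective h}.
  by move=> x y; rewrite !in_itv/= => hx hy E; rewrite -(hh x)// -(hh y)// E.
have [inc|dec] := itv_continuous_inj_mono ch hi.
  left => w hw; have mono u v : 0 < u < L -> 0 < v < L -> u < v -> h u < h v.
    by move=> hu hv; apply: inc; rewrite in_itv.
  rewrite h2//; congr c; have [l|l|//] := ltgtP (h w) w.
    by have := mono _ _ (h1 _ hw) hw l; rewrite hh// ltNge (ltW l).
  by have := mono _ _ hw (h1 _ hw) l; rewrite hh// ltNge (ltW l).
right; exists h; split => // u v hu hv; apply: dec; rewrite in_itv//.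
Qed.

Variables (e : R -> R * R) (p q : R * R) (a : R) (V V' : set (R * R)).
Variables (N N' k : nat) (u0 : R) (s : R * R -> R * R).
Hypotheses (HT : tile e p a V) (Na : N%:R * a = pi *+ 2).
Hypotheses (HT' : tile e p (k%:R * a) V') (Na' : N'%:R * (k%:R * a) = pi *+ 2).
Hypotheses (N4 : (3 < N')%N) (k0 : (0 < k)%N).
Hypotheses (hu0 : 0 <= u0 <= 1) (qE : e u0 = q) (pq : p <> q).
Hypotheses (is_ : improper s) (sV : s @` closure V' = closure V').
Hypotheses (sp : s p = q) (sq : s q = p).
Hypothesis swap : forall f, improper f -> involutive f ->
  f @` closure V' = closure V' -> f p = q.

Local Notation rt := (rt p a).
Local Notation irt := (irt p a).
Local Notation piece := (piece_of p a V).
Local Notation side := (side e p a).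

Lemma NE : N = (N' * k)%N.
Proof.
have a0 : a != 0 by rewrite gt_eqF// (tile_pos HT).
by apply/esym/eqP; rewrite -(eqr_nat R) natrM -(inj_eq (mulIf a0)) -mulrA Na Na'.
Qed.

Lemma k1N : (k.+1 < N)%N.
Proof. rewrite NE; move: N4 k0; nia. Qed.

Let N2 : (1 < N)%N. Proof. by move: k1N k0; lia. Qed.
Let N0 : (0 < N)%N. Proof. exact: ltnW. Qed.
Let ss : involutive s := sym_involutive pq is_ sp sq.
Let u00 : 0 < u0 := u0_gt0 HT' hu0 qE pq.

Lemma q_tile i : (0 < i)%N -> (i < k)%N -> ~ closure (piece i) q.
Proof.
move=> i0 ik cq; have : u0 = 0.
  apply: (side_meets_tile HT Na i0 _ hu0); first by move: k1N; lia.
  by rewrite /side /= /rt mul0r rotation0 qE.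
by move=> E; move: u00; rewrite E ltxx.
Qed.

(* Near p, the flipped block consists of a single tile. *)
Lemma flipped_near : exists2 r, 0 < r &
  forall x, d2 x p < r -> closure V' x -> closure V (s x).
Proof.
apply: contrapT => G.
have [i ik] : exists2 i, (i < k.-1)%N & closure (closure (piece i.+1)) q.
  apply: closure_fin_union => r r0; apply: contrapT => G'; apply: G; exists r => // x xr cx.
  have : closure V' (s x) by rewrite -sV; exists x.
  move=> /(closure_subdivision HT Na HT' Na')[[|i] ik ci]; first exact/(closure_piece0 p a).
  exfalso; apply: G'; exists (s x); last by rewrite -sp improper_d2.
  by exists i => //; lia.
move=> /(@closed_closure _ (piece i.+1)).
by apply: q_tile => //; lia.
Qed.

Lemma closure_piece_block i x : (i < k)%N -> closure (piece i) x -> closure V' x.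
Proof. by move=> ik cx; apply/(closure_subdivision HT Na HT' Na'); exists i. Qed.

(** Near [p] the flipped tile fills the whole block, which spans at least two positions; so it
    overlaps its own rotation by one position in an open set. Through [g], an unflipped tile would
    overlap its rotation by [j] positions. *)
Lemma unflipped_not_flipped (f g : R * R -> R * R) j : (1 < k)%N ->
  cancel f g -> cancel g f -> (forall x y, d2 (f x) (f y) = d2 x y) ->
  f p = p -> (0 < j < N)%N -> (forall x, f (rt j x) = rt 1 (f x)) ->
  (forall x, closure V (s x) -> closure V (g x)) -> False.
Proof.
move=> k1 fK gK fd fp /andP[j0 jN] fr fV.
have [r r0 hr] := flipped_near.
have fp1 : frame_of e p a 1 p.
  by rewrite -[X in frame_of _ _ _ _ X](side0 HT 1); apply: side_in_frame; lra.
have /closure_d2/(_ _ r0)[x px xr] := frame_of_closure HT fp1.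
pose W := piece 1 `&` [set x | d2 x p < r].
have oW : open W by apply: openI; [exact: (open_piece HT)|exact: open_inner].
have inW y : W y -> closure V (g y) /\ closure (piece j) (g y).
  move=> [py yr]; split.
    apply/fV/hr => //; apply: (@closure_piece_block 1) => //; exact: subset_closure.
  apply/closure_piece.
  have E : g y = rt j (g (irt 1 y)).
    by apply: (can_inj fK); rewrite gK fr gK irtK.
  rewrite E rtK; apply/fV/hr; first by rewrite d2_rotationp.
  apply: (@closure_piece_block 0) => //; apply: subset_closure.
  by rewrite piece0.
have [s0 s00 hs] := open_d2P oW (conj px xr : W x).
have [/(closure_piece0 p a) cg _] := inW x (conj px xr).
have /closure_d2/(_ _ s00)[y py yx] := cg.
have [_ cy] := inW (f y) (hs (f y) ltac:(by rewrite -[x]gK fd)).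
move: cy; rewrite fK; apply: (piece_not_closure HT Na _ jN _ py) => //.
by move=> E; move: j0; rewrite -E.
Qed.

(** Followed by [rt k.-1], the reflection reverses the order of the [k] thin tiles of the wedge, so
    it is a symmetry of the wedge; yet it fixes [p], against [swap]. *)
Lemma reflection_unflipped f : improper f -> f p = p ->
  (forall x, closure V x -> closure V (f x)) -> False.
Proof.
move=> if_ fp fV; pose g := rt k.-1 \o f.
have ig : improper g by exact: improper_rotl.
have gp : g p = p by rewrite /g /= fp /rt rotation_center.
have gI : involutive g := improper_involutive ig gp.
have gV x : closure V' x -> closure V' (g x).
  move=> /(closure_subdivision HT Na HT' Na')[i ik /closure_piece ci].
  apply/(closure_subdivision HT Na HT' Na'); exists (k.-1 - i)%N; first by lia.
  apply/closure_piece; have := fV _ ci; congr (closure V _).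
  rewrite /irt improper_rot// fp opprK /g /= /rt rotationD; congr rotation.
  have -> : k.-1 = ((k.-1 - i) + i)%N by lia.
  by rewrite addnK natrD; ring.
apply: pq; rewrite -gp; apply: swap => //.
apply/seteqP; split => x; first by move=> [y cy <-]; exact: gV.
by move=> cx; exists (g x); [exact: gV|rewrite gI].
Qed.

(** Conjugation by [s] gives a rotation about [q], which is a boundary point of the unflipped
    tile. *)
Lemma rotation_flipped b : (forall x, closure V (s x) -> closure V (s (rotation b p x))) ->
  (forall x, closure V (s x) -> closure V (s (rotation (- b) p x))) ->
  forall x, rotation b p x = x.
Proof.
move=> h1 h2; have fq : frame e p a q by apply: Or31; exists u0.
have E t x : s (rotation t p x) = rotation (- t) q (s x) by rewrite improper_rot// sp.
have K : forall x, rotation (- b) q x = x.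
  apply: (tile_rotation_sym HT Na N2 fq) => x cx.
    by rewrite -[x]ss -E; apply: h1; rewrite ss.
  by rewrite -[x]ss -E; apply: h2; rewrite ss.
by move=> x; apply: (inv_inj ss); rewrite E K.
Qed.

Lemma rotation_unflipped b : (forall x, closure V x -> closure V (rotation b p x)) ->
  (forall x, closure V x -> closure V (rotation (- b) p x)) ->
  forall x, rotation b p x = x.
Proof.
apply: (tile_rotation_sym HT Na N2); apply: Or31; exists 0; first by lra.
exact: tile_start HT.
Qed.

Local Tactic Notation "just" hyp(A) :=
  clear -A e p q a V V' N N' k u0 s HT Na HT' Na' N4 k0 hu0 qE pq is_ sV sp sq swap N2 N0 ss u00.
Local Tactic Notation "just" hyp(A) hyp(B) :=
  clear -A B e p q a V V' N N' k u0 s HT Na HT' Na' N4 k0 hu0 qE pq is_ sV sp sq swap N2 N0 ss u00.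
Local Tactic Notation "just" hyp(A) hyp(B) hyp(C) :=
  clear -A B C e p q a V V' N N' k u0 s HT Na HT' Na' N4 k0 hu0 qE pq is_ sV sp sq swap N2 N0 ss u00.
Local Tactic Notation "just" hyp(A) hyp(B) hyp(C) hyp(D) :=
  clear -A B C D e p q a V V' N N' k u0 s HT Na HT' Na' N4 k0 hu0 qE pq is_ sV sp sq swap N2 N0 ss u00.

Lemma arc_not_fixed f (y2 : R) : improper f -> 1 < y2 <= 2 ->
  (forall y, 1 <= y <= y2 -> f (tloop e p a y) = tloop e p a y) -> False.
Proof.
move=> if_ hy2 H; pose ym := (1 + y2) / 2.
have J1 : 1 <= (1 : R) <= y2 by just hy2; lra.
have J2 : 1 <= ym <= y2 by just hy2 ym; rewrite /ym; lra.
have J3 : 1 <= y2 <= y2 by just hy2; lra.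
have dd y : 1 <= y <= y2 -> d2 (tloop e p a y) p = d2 (e 1) p.
  move=> hy; have -> : y = 1 + (y - 1) by ring.
  by rewrite tloop2 ?circ_dist//; just hy hy2; lra.
have ne y y' : 1 <= y <= y2 -> 1 <= y' <= y2 -> y < y' -> tloop e p a y <> tloop e p a y'.
  move=> hy hy' yy /(loop_inner (tloop_simple HT)) E; have : y = y'.
    by apply: E; just hy hy' hy2; lra.
  by move=> E'; rewrite E' ltxx in yy.
have y1m : 1 < ym by just hy2 ym; rewrite /ym; lra.
have ym2 : ym < y2 by just hy2 ym; rewrite /ym; lra.
apply: (improper_fix_line if_ (H _ J1) (H _ J2) (H _ J3) (c := p)).
- exact: ne.
- by apply: ne => //; exact: lt_trans ym2.
- exact: ne.
- by rewrite !dd.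
- by rewrite !dd.
Qed.

(** By [involution_fix_path], [f] fixes [e] pointwise up to [v2]. Since [s] carries a piece of arc
    into the copy of this segment under [rt k], conjugating [f] by [rt k] and by [s] gives an
    improper map that fixes a piece of arc. *)
Lemma fixed_groove f (v2 y2 : R) : improper f -> f p = p -> 1 < y2 <= 2 ->
  0 <= v2 <= 1 ->
  (forall y, 1 <= y <= y2 -> exists2 v, 0 <= v <= v2 & s (tloop e p a y) = rt k (e v)) ->
  (forall v, 0 <= v <= v2 -> exists2 w, 0 <= w <= u0 & f (e v) = e w) -> False.
Proof.
move=> if_ fp hy2 hv2 B2 H; have fI : involutive f := improper_involutive if_ fp.
have F v : 0 <= v <= v2 -> f (e v) = e v.
  by apply: (involution_fix_path (M := u0) (tile_cont HT) (cont_improper if_) fI) => //;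
    [exact: tile_inj HT|rewrite (tile_start HT)].
pose f1 := s \o (rt k \o f \o irt k) \o s.
apply: (@arc_not_fixed f1 y2) => //.
  by apply: improper_comp3 => //; exact: improper_rotr (improper_rotl _ _ if_).
by move=> y /B2[v hv E]; rewrite /f1 /= E rtK F// -E ss.
Qed.

(** Here [f] fixes both [p] and [q], so [s \o f \o s = f], as two points determine an improper
    isometry. The equation for [e w] then makes side 0 meet side 1 when [y < u0], and side [k.+1]
    otherwise, away from [p]. *)
Lemma fixed_center f (w y z : R) : improper f -> f p = p ->
  (forall v, 0 <= v <= u0 -> f (e v) = e v) ->
  0 < w <= u0 -> 0 <= y <= 1 -> f (s (rt 1 (e w))) = e y ->
  (u0 <= y -> 0 <= z <= 1 /\ s (e y) = rt k (e z)) -> False.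
Proof.
move=> if_ fp F hw hy E1 hz; have fI : involutive f := improper_involutive if_ fp.
have hu := hu0; have /andP[w0 wu] := hw.
have hw1 : 0 <= w <= 1 by rewrite ltW//= (le_trans wu)//; case/andP: hu.
have fq : f q = q by rewrite -qE F// ltW ?u00/=.
have sf x : s (f (s x)) = f x.
  have E : s \o f \o s = f.
    apply: (improper_eq _ if_ pq); first exact: improper_comp3.
      by rewrite /= sp fq sq fp.
    by rewrite /= sq fp sp fq.
  exact: (congr1 (fun F => F x) E).
have [yu|yu] := leP u0 y; last first.
  have hyu : 0 <= y <= u0 by case/andP: hy => -> _; exact: ltW.
  have [w' hw' wE] := sym_center HT' Na' N4 hu0 qE pq is_ sV sp sq hyu.
  have hw1' : 0 <= w' <= 1.
    by case/andP: hw' => -> h; rewrite (le_trans h)//; case/andP: hu.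
  move: wE; rewrite !tloop1// => wE.
  have : e w' = rotation a p (e w).
    rewrite -wE -(F y hyu) -E1 fI ss /rt mul1r//.
  by move=> /(tile_sides HT hw1' hw1)[_ w00]; rewrite w00 ltxx in w0.
have [hz1 zE] := hz yu.
have E2 : f (rt 1 (e w)) = rt k (e z) by rewrite -sf E1 zE.
have f_rt x : f (rt 1 x) = irt 1 (f x) by rewrite /rt improper_rot// fp.
have E3 : e w = rt k.+1 (e z).
  have E4 : irt 1 (e w) = rt k (e z) by rewrite -E2 f_rt F// ltW.
  by rewrite -[LHS](irtK p a 1) E4 rtD.
suff : w = 0 by move=> w00; rewrite w00 ltxx in w0.
apply: (sides_meet HT Na (j := k.+1) _ hw1 hz1); first by rewrite k1N.
by rewrite /side /= {1}/rt mul0r rotation0.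
Qed.

(** Wedge and thin tile share the first side and the start of the arc, where the parameters differ
    by the factor [k]. The choice [delta = 1 / k] stays within the arc of the first thin tile. *)
Lemma small_groove : exists y2 v2, [/\ 1 < y2 <= 2, 0 <= v2 <= 1,
  forall x, u0 <= x <= y2 -> exists2 v, 0 <= v <= v2 & s (tloop e p a x) = rt k (e v)
  & forall v, 0 <= v <= v2 -> exists2 x, u0 <= x <= y2 & s (tloop e p a x) = rt k (e v)].
Proof.
have kp : 0 < k%:R :> R by rewrite ltr0n.
have k1 : 1 <= k%:R :> R by rewrite ler1n.
have GE y : 0 <= y <= 1 -> tloop e p (k%:R * a) (1 + y / k%:R) = tloop e p a (1 + y).
  move=> hy; rewrite !tloop2//.
    by congr rotation; field; rewrite gt_eqF.
  by rewrite divr_ge0 ?ler_pdivrMr//; just hy kp k1; lra.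
have [|x2 [v2 [hx2 hv2 A2 A2']]] := groove_image HT' Na' N4 hu0 qE pq is_ sV sp sq
  (delta := k%:R^-1).
  by rewrite invr_gt0 kp invf_le1.
have hu := hu0; have hu00 := u00.
have kx : k%:R * (x2 - 1) <= 1.
  by rewrite -[leRHS](divff (lt0r_neq0 kp)) ler_pM2l//; just hx2; lra.
have kx0 : 0 < k%:R * (x2 - 1) by rewrite mulr_gt0//; just hx2; lra.
exists (1 + k%:R * (x2 - 1)), v2; split => //.
- by just kx kx0; lra.
- move=> x hx; have [x1|x1] := leP x 1.
    have [|v hv E] := A2 x; first by just hx x1 hx2; lra.
    exists v => //; move: E; rewrite !tloop1//; just hx x1 hu00; lra.
  have hx1 : (x - 1) / k%:R <= x2 - 1.
    by rewrite ler_pdivrMr// mulrC; just hx; lra.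
  have hx0 : 0 <= (x - 1) / k%:R by apply: divr_ge0; just x1 kp; lra.
  have [|v hv E] := A2 (1 + (x - 1) / k%:R); first by just hx0 hx1 hu; lra.
  exists v => //; move: E; rewrite GE; last by just hx x1 kx; lra.
  by have -> : 1 + (x - 1) = x by ring.
- move=> v /A2'[x hx E]; have [x1|x1] := leP x 1.
    exists x; first by just hx x1 kx0; lra.
    by move: E; rewrite !tloop1//; just hx x1 hu00; lra.
  have hx0 : 0 <= k%:R * (x - 1) by apply: mulr_ge0; just kp x1; lra.
  have hx1 : k%:R * (x - 1) <= k%:R * (x2 - 1) by rewrite ler_pM2l//; just hx; lra.
  exists (1 + k%:R * (x - 1)); first by just hx0 hx1 hu; lra.
  rewrite -GE; last by just hx0 hx1 kx; lra.
  by rewrite /rt -E; congr (s (tloop _ _ _ _)); field; rewrite gt_eqF.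
Qed.

(** The image under [s] of the contour of the thin tile, started at the parameter [u0] of [q] so
    that its base point is [s q = p]. *)
Lemma flipped_loop : exists c, [/\ simple_loop c 3, c 0 = p,
  forall x, 0 <= x <= 3 - u0 -> c x = s (tloop e p a (u0 + x)),
  forall x, 3 - u0 <= x <= 3 -> c x = s (e (x - (3 - u0)))
  & forall f, improper f -> f p = p ->
     (forall x, closure V (s x) -> closure V (s (f x))) ->
     forall u, 0 <= u <= 3 -> exists2 v, 0 <= v <= 3 & f (c u) = c v].
Proof.
have hu := hu0; have hu00 := u00; have a0 := tile_pos HT.
have hg := tloop_simple HT.
have hsg : simple_loop (s \o tloop e p a) 3.
  have [_ cg cl ci] := hg; split => //; first exact: cont_comp (cont_improper is_).
    by rewrite /= cl.
  by move=> u v hu1 hv1 /= /(inv_inj ss); exact: ci.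
have hu3 : 0 <= u0 < 3 by just hu; lra.
have [c [hc c1 c2]] := rebase hsg hu3.
exists c; split => //.
- rewrite c1; last by just hu; lra.
  by rewrite addr0 /= tloop1// qE.
- move=> x hx; rewrite c2//= tloop1//; just hx hu; lra.
move=> f if_ fp fV; have fI : involutive f := improper_involutive if_ fp.
have fF x : frame e p a x -> frame e p a (s (f (s x))).
  move=> /(frame_bdry HT Na N2) h; apply/(frame_bdry HT Na N2).
  have fs : cancel (s \o f \o s) (s \o f \o s) by move=> y /=; rewrite ss fI ss.
  apply: (isometry_bdry (f := s \o f \o s) fs) h.
  - by move=> y z; rewrite /= !improper_d2.
  - by move=> y cy; apply: fV; rewrite ss.
  - by move=> y cy; apply: fV; rewrite ss.
move=> u hu1; have [w hw wE] : exists2 w, 0 <= w <= 3 & c u = s (tloop e p a w).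
  have [x1|x1] := leP u (3 - u0).
    by exists (u0 + u); [just hu1 x1 hu; lra|rewrite c1//; just hu1 x1; lra].
  by exists (u - (3 - u0)); [just hu1 x1 hu; lra|rewrite c2//; just hu1 x1; lra].
have : frame e p a (s (f (s (tloop e p a w)))).
  by apply: fF; apply/(tloop_frame _ _ _ a0); exists w.
rewrite -wE => /(tloop_frame _ _ _ a0)[v hv vE].
have {}vE : f (c u) = s (tloop e p a v) by rewrite vE ss.
have [vu|vu] := leP u0 v.
  exists (v - u0); first by just vu hv hu; lra.
  rewrite vE c1; last by just vu hv; lra.
  by rewrite /=; congr (s (tloop _ _ _ _)); ring.
exists (v + (3 - u0)); first by just vu hv hu; lra.
rewrite vE c2; last by just vu hv hu; lra.
by rewrite /=; congr (s (tloop _ _ _ _)); ring.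
Qed.

(** The loop leaves [p] along [rt k \o e], up to parameter [y2 - u0], and returns along [e], from
    parameter [3 - u0]. If [f] fixes the loop, it fixes a piece of the image of the arc. Otherwise
    it exchanges the two ends, and [irt k \o f] is a reflection relating initial segments of [e]. *)
Lemma reflection_flipped f : (1 < k)%N -> improper f -> f p = p ->
  (forall x, closure V (s x) -> closure V (s (f x))) -> False.
Proof.
move=> k1 if_ fp fV; have hu := hu0; have hu00 := u00.
have [y2 [v2 [hy2 hv2 B2 B2']]] := small_groove.
have [c [hc c00 c1 c2 fC]] := flipped_loop.
have f_rt x : f (rt k x) = irt k (f x) by rewrite /rt improper_rot// fp.
have if' : improper (irt k \o f) by exact: improper_rotl.
have f'p : (irt k \o f) p = p by rewrite /= fp /irt rotation_center.
have f'I := improper_involutive if' f'p.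
have e0 : e 0 = p := tile_start HT.
have [||id|[h [h1 h2 hh Hd]]] := @loop_involution c 3 f hc if_.
- by rewrite c00.
- exact: fC.
- have sfs : improper (s \o f \o s) by exact: improper_comp3.
  apply: (arc_not_fixed sfs hy2) => y hy; rewrite /=; apply: (inv_inj ss); rewrite ss.
  have E : s (tloop e p a y) = c (y - u0).
    rewrite c1; last by just hy hy2 hu; lra.
    by congr (s (tloop _ _ _ _)); ring.
  rewrite E; have [->|yu] := eqVneq y u0; first by rewrite subrr c00 fp.
  apply: id; have : u0 < y by rewrite lt_neqAle eq_sym yu; just hy hu; lra.
  by just hy hy2 hu00; lra.
have inj_e := tile_inj HT.
have f'E v x : s (tloop e p a x) = rt k (e v) -> (irt k \o f) (e v) = f (s (tloop e p a x)).
  by move=> ->; rewrite f_rt.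
have hm1 : 0 < y2 - u0 < 3 by just hy2 hu hu00; lra.
have hm2 : 0 < 3 - u0 < 3 by just hu hu00; lra.
have A1 x : 3 - u0 <= x < 3 -> exists2 v, 0 <= v <= u0 & c x = e v.
  move=> hx; have hx' : 0 <= x - (3 - u0) <= u0 by just hx hu; lra.
  have [v hv E] := sym_center HT' Na' N4 hu0 qE pq is_ sV sp sq hx'.
  exists v => //; rewrite c2; last by just hx; lra.
  by move: E; rewrite !tloop1//; [just hv hu; lra|just hx' hu; lra].
have A2 x : 0 <= x <= y2 - u0 -> exists2 v, 0 <= v <= v2 & c x = rt k (e v).
  move=> hx; have [|v hv E] := B2 (u0 + x); first by just hx; lra.
  by exists v => //; rewrite c1//; just hx hy2; lra.
(* As [h] is decreasing, either [f] maps the whole starting segment into the returning one, or it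
   maps the returning one, and a little more, into the starting one. *)
have [hm|hm] := leP (3 - u0) (h (y2 - u0)).
  have B1 y : 1 <= y <= y2 -> exists2 v, 0 <= v <= v2 & s (tloop e p a y) = rt k (e v).
    by move=> hy; apply: B2; just hy hu; lra.
  apply: (fixed_groove if' f'p hy2 hv2 B1) => v /B2'[x hx xE].
  rewrite (f'E _ _ xE); have [xu|xu] := eqVneq x u0.
    exists 0; first by just hu00; lra.
    by rewrite xu tloop1// qE sq fp e0.
  have xu' : u0 < x by rewrite lt_neqAle eq_sym xu; case/andP: hx.
  have hx3 : 0 < x - u0 < 3 by just hx xu' hy2 hu00; lra.
  have hx3' : 3 - u0 <= h (x - u0) < 3.
    have /andP[_ ->] := h1 _ hx3; rewrite andbT (le_trans hm)//.
    have [->|xn] := eqVneq x y2; first by [].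
    have xy2 : x - u0 < y2 - u0 by rewrite ltrD2r lt_neqAle xn; case/andP: hx.
    exact/ltW/Hd.
  have [w hw wE] := A1 _ hx3'; exists w => //.
  rewrite -wE -h2// c1; last by just hx xu' hy2; lra.
  by congr (f (s (tloop _ _ _ _))); ring.
have hlt x : h (y2 - u0) < x < 3 -> 0 < h x < y2 - u0.
  move=> /andP[hx x3]; have /andP[h0 _] := h1 _ hm1.
  have hx3 : 0 < x < 3 by rewrite (lt_trans h0 hx).
  have /andP[-> _] /= := h1 _ hx3.
  by rewrite -[ltRHS]hh//; apply: Hd => //; exact: h1.
have F v : 0 <= v <= u0 -> (irt k \o f) (e v) = e v.
  apply: (involution_fix_path (M := v2) (tile_cont HT) (cont_improper if') f'I) => //.
    by rewrite e0.
  move=> w hw; have [w' hw' wE] := sym_center HT' Na' N4 hu0 qE pq is_ sV sp sq hw.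
  have hw1 : 0 <= w <= 1 by just hw hu; lra.
  have hw1' : 0 <= w' <= 1 by just hw' hu; lra.
  move: wE; rewrite !tloop1// => wE.
  have ew : e w = s (e w') by rewrite -wE ss.
  have [wu|wu] := eqVneq w' u0.
    exists 0; first by just hv2; lra.
    by rewrite ew wu qE sq f'p e0.
  have wu' : w' < u0 by rewrite lt_neqAle wu; case/andP: hw'.
  have hx : h (y2 - u0) < 3 - u0 + w' < 3 by just hm hw' wu'; lra.
  have [|v' hv' vE] := A2 (h (3 - u0 + w')).
    by have /andP[/ltW-> /ltW->] := hlt _ hx.
  exists v' => //; rewrite /= -[RHS](rtK p a k) -vE -h2; last by just hw' wu' hm2; lra.
  rewrite c2; last by just hw' wu'; lra.
  by rewrite ew; congr (irt k (f (s (e _)))); ring.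
(* The loop parameter [3 - u0 - w], just before the returning segment, gives the point
   [s (rt 1 (e w))]; [w] is small enough for [f] to send it still into the starting segment. *)
pose w := Num.min u0 (3 - u0 - h (y2 - u0)) / 2.
have w0 : 0 < w by rewrite divr_gt0// lt_min hu00 subr_gt0.
have wu0 : w <= u0 / 2 by rewrite ler_pM2r ?invr_gt0// ge_min lexx.
have wh : w <= (3 - u0 - h (y2 - u0)) / 2.
  by rewrite ler_pM2r ?invr_gt0// ge_min lexx orbT.
have hx : h (y2 - u0) < 3 - u0 - w < 3.
  by just w0 wh hm hu00; lra.
have hx3 : 0 < 3 - u0 - w < 3.
  by just w0 wu0 hu hu00; lra.
have [|y hy yE] := A2 (h (3 - u0 - w)); first by have /andP[/ltW-> /ltW->] := hlt _ hx.
have hy1 : 0 <= y <= 1 by just hy hv2; lra.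
have hwu : 0 < w <= u0 by just w0 wu0 hu00; lra.
have E1 : (irt k \o f) (s (rt 1 (e w))) = e y.
  rewrite /= -[RHS](rtK p a k) -yE -h2// c1; last by just hx3 w0; lra.
  rewrite /rt mul1r -tloop3; last by just hwu hu; lra.
  by congr (irt k (f (s (tloop _ _ _ _)))); ring.
have [uy|uy] := leP u0 y.
  have [|z hz zE] := B2 y; first by rewrite uy/=; just hy1 hy2; lra.
  have hz1 : 0 <= z <= 1 by just hz hv2; lra.
  apply: (fixed_center if' f'p F hwu hy1 E1 (z := z)) => _; split => //.
  by rewrite -zE tloop1.
apply: (fixed_center if' f'p F hwu hy1 E1 (z := 0)).
by move=> uy'; move: uy; rewrite ltNge uy'.
Qed.

Definition plain i : set (R * R) := rt i @` closure V.
(** The image of the first thin tile of the block at [i]: its side passes through [q], so this is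
    the tile of the flipped block that contains [p]. *)
Definition flip i : set (R * R) := rt i @` (s @` closure V).

Let kN := k1N.

Lemma plainE i x : plain i x <-> closure V (irt i x).
Proof.
split; first by move=> [y cy <-]; rewrite rtK.
by move=> cx; exists (irt i x); rewrite // irtK.
Qed.

Lemma flipE i x : flip i x <-> closure V (s (irt i x)).
Proof.
split; first by move=> [_ [y cy <-] <-]; rewrite rtK ss.
by move=> cx; exists (irt i x); [exists (s (irt i x)); rewrite // ss|rewrite irtK].
Qed.

Lemma irtp i : irt i p = p. Proof. exact: rotation_center. Qed.
Lemma rtp i : rt i p = p. Proof. exact: rotation_center. Qed.

Lemma refl_plain f i j : improper f -> f p = p -> f @` plain i = plain j -> False.
Proof.
move=> if_ fp E; apply: (@reflection_unflipped (irt j \o f \o rt i)).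
- exact: improper_rotr (improper_rotl _ _ if_).
- by rewrite /= rtp fp irtp.
- move=> x cx; apply/plainE; rewrite -E; exists (rt i x) => //; by exists x.
Qed.

Lemma refl_flip f i j : (1 < k)%N -> improper f -> f p = p -> f @` flip i = flip j -> False.
Proof.
move=> k1 if_ fp E; apply: (@reflection_flipped (irt j \o f \o rt i)) => //.
- exact: improper_rotr (improper_rotl _ _ if_).
- by rewrite /= rtp fp irtp.
- move=> x cx; apply/flipE; rewrite -E; exists (rt i x) => //.
  by apply/flipE; rewrite rtK.
Qed.

Lemma rot_plain_flip b i j : (1 < k)%N -> rotation b p @` plain i = flip j -> False.
Proof.
move=> k1 E; pose O := irt j \o rotation b p \o rt i.
pose O' := irt i \o rotation (- b) p \o rt j.
apply: (@unflipped_not_flipped O O' 1) => //.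
- by move=> x; rewrite /O /O' /= irtK rotationK rtK.
- by move=> x; rewrite /O /O' /= irtK rotationNK rtK.
- by move=> x y; rewrite /O /= !d2_rotation.
- by rewrite /O /= rtp rotation_center irtp.
- by move=> x; rewrite /O /= /irt /rt !rotationD; congr rotation; ring.
- move=> x cx; have : flip j (rt j x) by apply/flipE; rewrite rtK.
  rewrite -E => -[y /plainE cy yE]; rewrite /O' /= -yE rotationK//.
Qed.

Lemma refl_plain_flip f i j : (1 < k)%N -> improper f -> f p = p ->
  f @` plain i = flip j -> False.
Proof.
move=> k1 if_ fp E; have fI : involutive f := improper_involutive if_ fp.
pose O := irt j \o f \o rt i.
have iO : improper O by exact: improper_rotr (improper_rotl _ _ if_).
have Op : O p = p by rewrite /O /= rtp fp irtp.
have OI : involutive O := improper_involutive iO Op.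
(* A reflection reverses the cyclic order, so it conjugates the rotation by [N.-1] positions to that
   by one position. *)
apply: (@unflipped_not_flipped O O N.-1) => //.
- by move=> x y; rewrite improper_d2.
- by move: kN k0; lia.
- move=> x; rewrite /rt improper_rot// Op mul1r.
  rewrite -rotationD2pi -Na; congr rotation.
  have -> : N = (N.-1 + 1)%N by move: kN; lia.
  by rewrite addn1 /= -[in N.-1.+1%:R]addn1 natrD; ring.
- move=> x cx; have : flip j (rt j x) by apply/flipE; rewrite rtK.
  rewrite -E => -[y /plainE cy yE].
  by rewrite -[x](rtK p a j) -yE -[y](irtK p a i) -/(O _) OI.
Qed.

Lemma rot_plain b i j : rotation b p @` plain i = plain j ->
  rotation (i%:R * a + b) p = rt j.
Proof.
move=> E; have K : forall x, rotation (- (j%:R * a) + (b + i%:R * a)) p x = x.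
  have E' x : plain j x -> plain i (rotation (- b) p x).
    by rewrite -E => -[y hy <-]; rewrite rotationK.
  apply: rotation_unflipped => x cx.
    rewrite -!rotationD; apply/plainE; rewrite -E.
    by exists (rotation (i%:R * a) p x) => //; apply/plainE; rewrite /irt rotationK.
  have : plain j (rt j x) by apply/plainE; rewrite rtK.
  move=> /E'/plainE; rewrite /irt /rt !rotationD; congr (closure V (rotation _ _ _)); ring.
apply/funext => x; rewrite -[RHS](K (rt j x)) /rt !rotationD; congr rotation.
ring.
Qed.

Lemma rot_flip b i j : rotation b p @` flip i = flip j ->
  rotation (i%:R * a + b) p = rt j.
Proof.
move=> E; have K : forall x, rotation (- (j%:R * a) + (b + i%:R * a)) p x = x.
  have E' x : flip j x -> flip i (rotation (- b) p x).
    by rewrite -E => -[y hy <-]; rewrite rotationK.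
  apply: rotation_flipped => x cx.
    rewrite -!rotationD; apply/flipE; rewrite -E.
    by exists (rotation (i%:R * a) p x) => //; apply/flipE; rewrite /irt rotationK.
  have : flip j (rt j x) by apply/flipE; rewrite rtK.
  move=> /E'/flipE; rewrite /irt /rt !rotationD; congr (closure V (s (rotation _ _ _))); ring.
apply/funext => x; rewrite -[RHS](K (rt j x)) /rt !rotationD; congr rotation.
ring.
Qed.

Lemma rt_mod i : rt (i %% N) = rt i.
Proof.
apply/funext => x; rewrite [in RHS](divn_eq i N) addnC -rtD.
elim: (i %/ N)%N => [|d IH]; first by rewrite mul0n /rt mul0r rotation0.
by rewrite mulSn -rtD (rtN _ Na).
Qed.

Lemma rt_eq_mod i j : rt i = rt j -> (i = j %[mod N])%N.
Proof.
move=> E; wlog ij : i j E / (i %% N <= j %% N)%N.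
  by move=> H; have [h|h] := leqP (i %% N) (j %% N); [exact: H|apply/esym/H => //; exact: ltnW].
apply/eqP; rewrite eqn_leq ij leqNgt; apply/negP => ji.
have jN : (j %% N < N)%N by rewrite ltn_mod; move: kN; lia.
have I1 : 0 <= (1 : R) <= 1 by lra.
have : (1 : R) = 0; last by move/eqP; rewrite oner_eq0.
apply: (sides_meet HT Na (j := (j %% N - i %% N)%N) _ I1 I1); first by lia.
apply: (can_inj (rtK p a (i %% N))); rewrite /side /= !rtD addn0 subnKC//.
by rewrite !rt_mod E.
Qed.

End TileSymmetries.

(** * Affine maps preserving a disk *)

Section AffineDisk.
Context {R : realType}.
Variables (p : R * R) (r2 : R) (a b c d e g : R) (f : R * R -> R * R).
Hypotheses (r20 : 0 < r2) (det0 : a * d - b * c <> 0).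
Hypothesis fE : forall z, f z = (a * z.1 + b * z.2 + e, c * z.1 + d * z.2 + g).
Hypothesis fD : f @` [set z | d2 z p <= r2] = [set z | d2 z p <= r2].

Let nrm (w : R * R) := w.1 ^+ 2 + w.2 ^+ 2.

Let scale (w : R * R) : nrm w <> 0 -> exists2 t, 0 < t & t ^+ 2 * nrm w = r2.
Proof.
move=> w0; have wp : 0 < nrm w.
  by rewrite lt_neqAle addr_ge0 ?sqr_ge0// andbT eq_sym; apply/eqP.
exists (Num.sqrt (r2 / nrm w)); first by rewrite sqrtr_gt0 divr_gt0.
by rewrite sqr_sqrtr ?divfK ?gt_eqF// ltW// divr_gt0.
Qed.

Let in_disk z : d2 z p <= r2 -> d2 (f z) p <= r2.
Proof.
move=> hz; have : (f @` [set z | d2 z p <= r2]) (f z) by exists z.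
by rewrite fD.
Qed.

Let from_disk z : d2 z p <= r2 -> exists2 x, d2 x p <= r2 & f x = z.
Proof.
move=> hz; have : [set z | d2 z p <= r2] z by [].
by rewrite -{1}fD => -[x hx <-]; exists x.
Qed.

(** If [f] moves [p] by [v], let [f x] be the boundary point in direction [- v]. The point of the
    disk opposite to [x] is then sent to [p + (t + 2) v], outside the disk of radius [t |v|]. *)
Lemma affine_disk_center : f p = p.
Proof.
apply: contrapT => fp; pose v := f p - p.
have v0 : nrm v <> 0.
  move=> v0; apply: fp; apply: d2_eq0; rewrite -v0 /d2 /dot /nrm /v /=; ring.
have [t t0 tE] := scale v0.
have hy : d2 (p.1 - t * v.1, p.2 - t * v.2) p <= r2.
  by rewrite -tE /d2 /dot /nrm /= le_eqVlt; apply/orP; left; apply/eqP; ring.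
have [x hx xE] := from_disk hy.
have hx' : d2 (2 * p.1 - x.1, 2 * p.2 - x.2) p <= r2.
  by move: hx; congr (_ <= _); rewrite /d2 /dot /=; ring.
have := in_disk hx'.
have -> : f (2 * p.1 - x.1, 2 * p.2 - x.2) =
    (p.1 + (t + 2) * v.1, p.2 + (t + 2) * v.2).
  have := xE; rewrite !fE => -[x1 x2]; rewrite /v fE /=.
  by move: x1 x2; rewrite /v fE /= => x1 x2; congr pair; lra.
have -> : d2 (p.1 + (t + 2) * v.1, p.2 + (t + 2) * v.2) p = (t + 2) ^+ 2 * nrm v.
  by rewrite /d2 /dot /nrm /=; ring.
rewrite -tE; have vp : 0 < nrm v.
  by rewrite lt_neqAle addr_ge0 ?sqr_ge0// andbT eq_sym; apply/eqP.
by rewrite ler_pM2r//; nra.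
Qed.

Let lin (w : R * R) : R * R := (a * w.1 + b * w.2, c * w.1 + d * w.2).

Let f_lin w : f (p.1 + w.1, p.2 + w.2) = (p.1 + (lin w).1, p.2 + (lin w).2).
Proof.
have := affine_disk_center; rewrite !fE /lin; case: p => p1 p2 /= -[e1 e2].
by congr pair; lra.
Qed.

Let lin_inj w w' : lin w = lin w' -> w = w'.
Proof.
case: w w' => w1 w2 [v1 v2]; rewrite /lin /= => -[e1 e2].
have k1 : (a * d - b * c) * (w1 - v1) = 0.
  transitivity (d * (a * w1 + b * w2 - (a * v1 + b * v2)) - b * (c * w1 + d * w2 - (c * v1 + d * v2))).
    by ring.
  by rewrite e1 e2; ring.
have k2 : (a * d - b * c) * (w2 - v2) = 0.
  transitivity (a * (c * w1 + d * w2 - (c * v1 + d * v2)) - c * (a * w1 + b * w2 - (a * v1 + b * v2))).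
    by ring.
  by rewrite e1 e2; ring.
move/eqP: det0 => d0.
by congr pair; apply/eqP; rewrite -subr_eq0;
  [move/eqP: k1|move/eqP: k2]; rewrite mulf_eq0 (negbTE d0).
Qed.

Let d2D w : d2 (p.1 + w.1, p.2 + w.2) p = nrm w.
Proof. by rewrite /d2 /dot /nrm /=; ring. Qed.

Let nrmZ t w : nrm (t * w.1, t * w.2) = t ^+ 2 * nrm w.
Proof. by rewrite /nrm /=; ring. Qed.

Let linZ t w : lin (t * w.1, t * w.2) = (t * (lin w).1, t * (lin w).2).
Proof. by rewrite /lin /=; congr pair; ring. Qed.

Let nrm0 w : nrm w = 0 -> w = (0, 0).
Proof.
case: w => w1 w2; rewrite /nrm /= => /eqP.
by rewrite paddr_eq0 ?sqr_ge0// !sqrf_eq0 => /andP[/eqP-> /eqP->].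
Qed.

Let lin_le w : nrm (lin w) <= nrm w.
Proof.
have [w0|w0] := pselect (nrm w = 0).
  by rewrite (nrm0 w0) /lin /nrm /= !mulr0 !addr0.
have [t t0 tE] := scale w0.
have [w' w'E] : exists w', w' = (t * w.1, t * w.2) by exists (t * w.1, t * w.2).
have : d2 (f (p.1 + w'.1, p.2 + w'.2)) p <= r2.
  by apply: in_disk; rewrite d2D w'E nrmZ tE.
rewrite f_lin d2D w'E linZ nrmZ -tE ler_pM2l// exprn_gt0//.
Qed.

Let lin_nrm w : nrm (lin w) = nrm w.
Proof.
apply/eqP; rewrite eq_le lin_le/=.
have [w0|w0] := pselect (nrm w = 0).
  by rewrite w0 addr_ge0// sqr_ge0.
have l0 : nrm (lin w) <> 0.
  move=> /nrm0 E; apply: w0; have -> : w = (0, 0).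
    by apply: lin_inj; rewrite E /lin /= !mulr0 !addr0.
  by rewrite /nrm /= expr0n /= addr0.
have [t t0 tE] := scale l0.
have [w' w'E] : exists w', w' = (t * (lin w).1, t * (lin w).2) by eexists.
have hd : d2 (p.1 + w'.1, p.2 + w'.2) p <= r2 by rewrite d2D w'E nrmZ tE.
have [x hx xE] := from_disk hd.
have [v xv] : exists v, x = (p.1 + v.1, p.2 + v.2).
  by exists (x.1 - p.1, x.2 - p.2); case: (x) => ? ? /=; congr pair; ring.
move: hx xE; rewrite xv d2D f_lin => hx [/addrI h1 /addrI h2].
have vE : v = (t * w.1, t * w.2).
  by apply: lin_inj; rewrite linZ -w'E [RHS]surjective_pairing -h1 -h2.
by move: hx; rewrite vE nrmZ -tE ler_pM2l// exprn_gt0.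
Qed.

Lemma affine_disk_isometry :
  (0 < a * d - b * c /\ exists t, f = rotation t p) \/
  (a * d - b * c < 0 /\ improper f).
Proof.
have h1 : a ^+ 2 + c ^+ 2 = 1.
  by have := lin_nrm (1, 0); rewrite /nrm /lin /= !mulr0 !mulr1 !addr0 expr0n/= addr0 expr1n.
have h2 : b ^+ 2 + d ^+ 2 = 1.
  by have := lin_nrm (0, 1); rewrite /nrm /lin /= !mulr0 !mulr1 !add0r expr0n/= add0r expr1n.
have h3 : a * b + c * d = 0.
  by have := lin_nrm (1, 1); rewrite /nrm /lin /= !mulr1 expr1n; nra.
have dd : (a * d - b * c) ^+ 2 = 1.
  transitivity ((a ^+ 2 + c ^+ 2) * (b ^+ 2 + d ^+ 2) - (a * b + c * d) ^+ 2); first by ring.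
  by rewrite h1 h2 h3; ring.
have : (a * d - b * c - 1) * (a * d - b * c + 1) = 0.
  by transitivity ((a * d - b * c) ^+ 2 - 1); [ring|rewrite dd subrr].
move/eqP; rewrite mulf_eq0 => /orP[]/eqP dE.
  have det1 : a * d - b * c = 1 by lra.
  have ad : d = a.
    transitivity (d * (a ^+ 2 + c ^+ 2) - c * (a * b + c * d)); first by rewrite h1 h3; ring.
    transitivity (a * (a * d - b * c)); [ring|by rewrite det1 mulr1].
  have bc : b = - c.
    transitivity (b * (a ^+ 2 + c ^+ 2) - a * (a * b + c * d)); first by rewrite h1 h3; ring.
    transitivity (- c * (a * d - b * c)); [ring|by rewrite det1 mulr1].
  left; split; first by rewrite det1.
  have [|t [r r0 [aE cE]]] := @along_ex R (a, c).
    by move=> [a0 c0]; move: h1; rewrite a0 c0 expr0n/= addr0 => /eqP; rewrite eq_sym oner_eq0.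
  have r1 : r = 1.
    have : r ^+ 2 = 1.
      by rewrite -h1 aE cE !exprMn -mulrDr cos2Dsin2 mulr1.
    by move/eqP; rewrite sqrf_eq1 => /orP[]/eqP; lra.
  exists t; apply/funext => z.
  have := f_lin (z.1 - p.1, z.2 - p.2); rewrite /= !(addrC _ (_ - _)) !subrK.
  rewrite -surjective_pairing => ->; rewrite /rotation ad bc aE cE r1 !mul1r.
  by congr pair; ring.
have det1 : a * d - b * c = -1 by lra.
have ad : d = - a.
  transitivity (d * (a ^+ 2 + c ^+ 2) - c * (a * b + c * d)); first by rewrite h1 h3; ring.
  transitivity (a * (a * d - b * c)); [ring|by rewrite det1; ring].
have bc : b = c.
  transitivity (b * (a ^+ 2 + c ^+ 2) - a * (a * b + c * d)); first by rewrite h1 h3; ring.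
  transitivity (- c * (a * d - b * c)); [ring|by rewrite det1; ring].
right; split; first by rewrite det1 ltrN10.
exists a, c, e, g; split => // z; rewrite fE ad bc.
by congr pair; ring.
Qed.

End AffineDisk.

(** * Subsets of a cycle with large gaps *)

Section Gaps.
Local Close Scope classical_set_scope.
Local Open Scope nat_scope.
Variable k : nat.
Hypothesis k0 : 0 < k.

(* The starting positions of successive blocks of length k, the first one at x,
   when t lists the lengths of the gaps after the blocks. *)
Fixpoint starts (x : nat) (t : seq nat) : seq nat :=
  if t is g :: t' then x :: starts (x + g + k) t' else [::].

Definition extent t := sumn t + k * size t.

Lemma extent_cat t1 t2 : extent (t1 ++ t2) = extent t1 + extent t2.
Proof. by rewrite /extent sumn_cat size_cat mulnDr addnACA. Qed.

Lemma extent_cons g t : extent (g :: t) = g + k + extent t.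
Proof. by rewrite /extent /= mulnS addnACA. Qed.

Lemma starts_cat x t1 t2 : starts x (t1 ++ t2) = starts x t1 ++ starts (x + extent t1) t2.
Proof.
elim: t1 x => [|g t1 IH] x /=; first by rewrite /extent /= muln0 !addn0.
by rewrite IH extent_cons !addnA.
Qed.

Lemma size_starts x t : size (starts x t) = size t.
Proof. by elim: t x => //= g t IH x; rewrite IH. Qed.

Lemma starts_shift x y t : starts (y + x) t = [seq y + z | z <- starts x t].
Proof. by elim: t x => //= g t IH x; rewrite -IH !addnA. Qed.

Lemma path_starts x t : sorted (fun y z => y + k <= z) (starts x t).
Proof.
elim: t x => //= g [|g' t] IH x //=; have /= -> := IH (x + g + k).
by rewrite addnAC leq_addr.
Qed.

Lemma starts_bounds x t y : y \in starts x t -> x <= y /\ y + k <= x + extent t.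
Proof.
elim: t x => //= g t IH x; rewrite extent_cons inE => /orP[/eqP->|/IH[]]; lia.
Qed.

Lemma mem_starts x t y : y \in starts x t -> exists t1 t2, t = t1 ++ t2 /\ y = x + extent t1.
Proof.
elim: t x => //= g t IH x; rewrite inE => /orP[/eqP->|/IH[t1 [t2 [-> ->]]]].
  by exists [::], (g :: t); rewrite /extent /= muln0 !addn0.
by exists (g :: t1), t2; rewrite extent_cons !addnA.
Qed.

Lemma starts_inj x t t' : extent t = extent t' -> starts x t = starts x t' -> t = t'.
Proof.
elim: t t' x => [|g t IH] [|g' t'] x //=; rewrite !extent_cons => E [H].
suff gg : g = g' by rewrite gg in E H *; congr cons; apply: IH H; lia.
case: t t' {IH} E H => [|h t] [|h' t'] //=; first by rewrite /extent /=; lia.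
by move=> _ [H _]; lia.
Qed.

Lemma gaps_exist M x s : path (fun y z => y + k <= z) x s -> last x s + k <= M ->
  exists2 t, starts x t = x :: s & x + extent t = M.
Proof.
elim: s x => [|y s IH] x /=.
  move=> _ xM; exists [:: M - (x + k)] => //; rewrite /extent /=; lia.
move=> /andP[xy ps] /(IH y ps)[t tE tM]; exists (y - (x + k) :: t) => /=.
  by rewrite (_ : x + _ + k = y) ?tE//; lia.
by rewrite extent_cons; lia.
Qed.

Lemma sorted_starts x t : sorted ltn (starts x t).
Proof. by apply: sub_sorted (path_starts x t) => y z; lia. Qed.

Section Cyclic.
Variable M : nat.
Local Notation N := M.+1.
Implicit Types (B : {set 'I_N}) (c x y : 'I_N).

Definition translate B c : {set 'I_N} := [set y | (y - c)%R \in B]%SET.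

Lemma in_translate B c y : (y \in translate B c) = ((y - c)%R \in B).
Proof. by rewrite inE. Qed.

Lemma translateD B c c' : translate (translate B c) c' = translate B (c + c')%R.
Proof. by apply/setP => y; rewrite !in_translate opprD addrA addrAC. Qed.

Lemma translate0 B : translate B 0%R = B.
Proof. by apply/setP => y; rewrite in_translate subr0. Qed.

Lemma card_translate B c : #|translate B c| = #|B|.
Proof.
rewrite -[RHS](card_imset (mem B) (addIr c)); apply: eq_card => y; rewrite in_translate.
apply/idP/imsetP => [h|[x xB ->]]; last by rewrite addrK.
by exists (y - c)%R; rewrite ?subrK.
Qed.

(** The cyclic difference is computed with natural numbers, so that the condition makes sense for
    any [N'] and not only for a successor, which the group structure on ordinals requires. *)
Definition spaced N' (B : {set 'I_N'}) :=
  [forall x in B, forall y in B, (x != y) ==> (k <= (y + (N' - x)) %% N')].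

Lemma subZE x y : val (y - x)%R = (y + (N - x)) %% N.
Proof. by rewrite /= modnDmr. Qed.

Lemma spacedP B : reflect (forall x y, x \in B -> y \in B -> x != y -> k <= val (y - x)%R)
  (spaced B).
Proof.
apply: (iffP forall_inP) => [h x y xB yB xy|h x xB].
  by rewrite subZE; have /forall_inP/(_ y yB)/implyP := h x xB; apply.
by apply/forall_inP => y yB; apply/implyP => xy; rewrite -subZE; exact: h.
Qed.

Lemma spaced_translate B c : spaced B -> spaced (translate B c).
Proof.
move=> /spacedP h; apply/spacedP => x y; rewrite !in_translate => xB yB xy.
have := h _ _ xB yB; rewrite opprB addrA subrK; apply.
by apply: contra xy => /eqP/addIr->.
Qed.

(** The orbit of [B], used as the name of its class up to rotation. *)
Definition translates B : {set {set 'I_N}} := [set translate B c | c in [set: 'I_N]%SET].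

Lemma translates_eq B B' : translates B = translates B' <-> exists c, B' = translate B c.
Proof.
split=> [E|[c ->]].
  have : B' \in translates B by rewrite E; apply/imsetP; exists 0%R; rewrite ?translate0 ?inE.
  by move=> /imsetP[c _ ->]; exists c.
apply/setP => X; apply/imsetP/imsetP => -[d _ ->].
  by exists (d - c)%R; rewrite ?inE// translateD addrC subrK.
by exists (c + d)%R; rewrite ?inE// translateD.
Qed.

Definition start_set t : {set 'I_N} := [set y | val y \in starts 0 t]%SET.

(** Exchanging the two parts of the gap list moves the origin to the start of the first block of
    [t2], at distance [extent t2] before the end of the circle. *)
Lemma start_set_rot t1 t2 : extent (t1 ++ t2) = N ->
  translate (start_set (t1 ++ t2)) (inZp (extent t2)) = start_set (t2 ++ t1).
Proof.
rewrite extent_cat => PQ; apply/setP => y; rewrite in_translate !inE !starts_cat !mem_cat !add0n.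
have yN := ltn_ord y.
have -> : val (y - inZp (extent t2))%R = if extent t2 <= y then y - extent t2 else y + extent t1.
  rewrite subZE /=; have [E|lt] := eqVneq (extent t2) N.
    have -> : extent t2 <= y = false by lia.
    by rewrite E modnn subn0 modnDr modn_small// (_ : extent t1 = 0) ?addn0//; lia.
  rewrite (@modn_small (extent t2)); last by lia.
  case: ifP => h; last by rewrite modn_small; lia.
  rewrite (_ : y + _ = y - extent t2 + N); last by lia.
  by rewrite modnDr modn_small; lia.
have notin (x : nat) t z : ~~ (x <= z < x + extent t) -> (z \in starts x t) = false.
  by move=> h; apply/negP => /starts_bounds; lia.
have sh (x : nat) z t : (x + z \in starts x t) = (z \in starts 0 t).
  have := starts_shift 0 x t; rewrite addn0 => ->.
  by rewrite mem_map//; exact: addnI.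
case: ifP => h.
  rewrite (notin (extent t1)) ?orbF; last by lia.
  by rewrite (notin 0 t2 y) /=; [rewrite -(sh (extent t2)) subnKC|lia].
rewrite (notin 0 t1) /=; last by lia.
by rewrite (notin (extent t2)) ?orbF; [rewrite addnC sh|lia].
Qed.

Lemma start_set_inj t t' : extent t = N -> extent t' = N -> start_set t = start_set t' -> t = t'.
Proof.
move=> tN tN' E; apply: (@starts_inj 0); first by rewrite tN.
apply: (irr_sorted_eq ltn_trans ltnn) => [||z]; try exact: sorted_starts.
have [zN|zN] := ltnP z N; first by have /setP/(_ (Ordinal zN)) := E; rewrite !inE.
by apply/idP/idP => /starts_bounds; lia.
Qed.

(** Position 0 starts a block of the second set, so [- c] starts a block of the first one, and the
    gap list is cut there. *)
Lemma translate_start_set t t' c : extent t = N -> extent t' = N ->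
  translate (start_set t) c = start_set t' -> exists t1 t2, t = t1 ++ t2 /\ t' = t2 ++ t1.
Proof.
move=> tN tN' E; have : (0%R : 'I_N) \in start_set t'.
  rewrite inE /=; case: t' tN' {E} => [|g t' _ /=]; last by rewrite inE eqxx.
  by rewrite /extent /= muln0.
rewrite -E in_translate inE sub0r => /mem_starts[t1 [t2 [tE yE]]].
exists t1, t2; split => //; apply: start_set_inj => //.
  by rewrite extent_cat addnC -extent_cat -tE.
rewrite -start_set_rot -?tE// -E; congr (translate _ _).
have : (inZp (extent t1) + inZp (extent t2) : 'I_N)%R = 0%R.
  by apply/val_inj; rewrite /= modnDm -extent_cat -tE tN modnn.
have -> : (inZp (extent t1) : 'I_N) = (- c)%R.
  by apply/val_inj; rewrite /= -[extent t1]add0n -yE /= modn_mod.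
by move/eqP; rewrite addrC subr_eq0 => /eqP.
Qed.

Lemma spaced_start_set t : extent t = N -> spaced (start_set t).
Proof.
move=> tN; have key x y : x \in start_set t -> y \in start_set t -> x < y ->
    x + k <= y /\ y + k <= x + N.
  rewrite !inE => xt yt xy; split; last first.
    by have [_ /=] := starts_bounds yt; rewrite tN; lia.
  move: (path_starts 0 t) xt yt.
  rewrite sorted_pairwise; last by move=> a b c; lia.
  elim: (starts 0 t) (sorted_starts 0 t) => //= z s IH zs /andP[/allP zk ps].
  rewrite !inE => /orP[/eqP xz|xs] /orP[/eqP yz|ys]; first by lia.
  - by rewrite xz; exact: zk.
  - by have := zk _ xs; lia.
  - by apply: IH => //; exact: path_sorted zs.
apply/spacedP => x y xB yB xy; rewrite subZE; have xN := ltn_ord x; have yN := ltn_ord y.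
case: (ltngtP x y) => [lt|lt|/val_inj E]; last by rewrite E eqxx in xy.
  have := key x y xB yB lt; rewrite (_ : y + (N - x) = y - x + N); last by lia.
  by rewrite modnDr modn_small; lia.
by have := key y x yB xB lt; rewrite modn_small; lia.
Qed.

Lemma card_start_set t : extent t = N -> #|start_set t| = size t.
Proof.
move=> tN; rewrite -(size_starts 0) cardE -(size_map val); apply/perm_size/uniq_perm.
- by rewrite map_inj_uniq ?enum_uniq//; exact: val_inj.
- exact: (sorted_uniq ltn_trans ltnn (sorted_starts 0 t)).
move=> z; apply/mapP/idP => [[y]|zt]; first by rewrite mem_enum inE => yt ->.
have zN : z < N by have := starts_bounds zt; lia.
by exists (Ordinal zN); rewrite // mem_enum inE.
Qed.

Lemma spaced_gaps B : k <= N -> spaced B -> 0 < #|B| ->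
  exists t c, [/\ extent t = N, size t = #|B| & translate B c = start_set t].
Proof.
move=> kN sB /card_gt0P[x xB]; pose B0 := translate B (- x)%R.
have B00 : 0%R \in B0 by rewrite in_translate sub0r opprK.
have /spacedP sB0 : spaced B0 by exact: spaced_translate.
pose s := [seq val y | y <- enum B0].
have ms y : (val y \in s) = (y \in B0).
  by rewrite mem_map ?mem_enum//; exact: val_inj.
have ss : sorted ltn s.
  apply: (subseq_sorted ltn_trans) (iota_ltn_sorted 0 N).
  by rewrite -val_enum_ord; apply: map_subseq; rewrite enumT; exact: filter_subseq.
have s0 : 0 \in s by rewrite -[0]/(val (0%R : 'I_N)) ms.
have [s' sE] : exists s', s = 0 :: s'.
  case: (s) s0 ss => // a s'; rewrite inE => /orP[/eqP<- _|]; first by exists s'.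
  by move=> h /= /(order_path_min ltn_trans)/allP/(_ _ h).
have in_s z : z \in s -> exists2 y, y \in B0 & z = val y.
  by move=> /mapP[y]; rewrite mem_enum => yB ->; exists y.
have kk (y z : nat) : y \in s -> z \in s -> y < z -> y + k <= z /\ z + k <= y + N.
  move=> /in_s[y' yB ->] /in_s[z' zB ->] /= lt; have ne : y' != z' by rewrite neq_ltn lt.
  have := sB0 y' z' yB zB ne; have := sB0 z' y' zB yB; rewrite eq_sym => /(_ ne).
  rewrite !subZE; have := ltn_ord z'; have := ltn_ord y' => h1 h2.
  rewrite (_ : z' + (N - y') = z' - y' + N); last by lia.
  by rewrite modnDr !modn_small; lia.
have [||t tE tN] := @gaps_exist N 0 s'.
- have : sorted (fun y z : nat => y + k <= z) s.
    apply: (@sub_in_sorted _ (fun z => z \in s) ltn) ss; last exact/allP.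
    by move=> y z ys zs yz; case: (kk y z).
  by rewrite sE.
(* For a singleton spacedness says nothing about the only gap, and [k <= N] is what bounds it. *)
- case: (posnP (last 0 s')) => [->//|l0].
  by have [] := kk 0 (last 0 s'); rewrite ?sE ?mem_last ?inE.
exists t, (- x)%R; split; first by rewrite -[LHS]add0n.
  by rewrite -(size_starts 0) tE -sE size_map -cardE card_translate.
by apply/setP => y; rewrite [RHS]inE tE -sE ms.
Qed.

End Cyclic.

End Gaps.

(** * Cardinals of images, and sums over a cyclic group by order *)

Section Classes.
Local Close Scope classical_set_scope.
Local Open Scope nat_scope.

Lemma card_imset_eq (T U W : finType) (D : {set T}) (g : T -> U) (h : T -> W) :
  {in D &, forall x y, g x = g y <-> h x = h y} -> #|g @: D| = #|h @: D|.
Proof.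
move=> gh; pose gh_ x := (g x, h x).
transitivity #|gh_ @: D|; [symmetry|]; last first.
  rewrite (_ : h @: D = [set z.2 | z in gh_ @: D]%SET); last by rewrite -imset_comp.
  symmetry; apply: card_in_imset => _ _ /imsetP[x xD ->] /imsetP[y yD ->] /= E.
  by rewrite /gh_ E (proj2 (gh x y xD yD) E).
rewrite (_ : g @: D = [set z.1 | z in gh_ @: D]%SET); last by rewrite -imset_comp.
symmetry; apply: card_in_imset => _ _ /imsetP[x xD ->] /imsetP[y yD ->] /= E.
by rewrite /gh_ E (proj1 (gh x y xD yD) E).
Qed.

Lemma card_imset_split (T U : finType) (D : {set T}) (g : T -> U) (w : T -> nat) m :
  {in D &, forall x y, g x = g y -> w x = w y} -> {in D, forall x, w x < m} ->
  #|g @: D| = \sum_(0 <= i < m) #|g @: [set x in D | w x == i]%SET|.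
Proof.
move=> gw wm; rewrite -sum1_card big_mkord.
under [RHS]eq_bigr do rewrite -sum1_card big_mkcond.
rewrite exchange_big [LHS]big_mkcond /=; apply: eq_bigr => C _; case: ifP => [|nC].
  move=> /imsetP[x xD ->]; rewrite (bigD1 (Ordinal (wm x xD)))//= big1 => [|i ix].
    by rewrite imset_f ?inE ?xD ?eqxx.
  case: ifP => // /imsetP[y]; rewrite inE => /andP[yD /eqP wy] /(gw x y xD yD) E.
  by move: ix; rewrite -(inj_eq val_inj) /= -wy E eqxx.
rewrite big1// => i _; case: ifP => // /imsetP[x]; rewrite inE => /andP[xD _] E.
by rewrite E imset_f in nC.
Qed.

Lemma sum_divisors (F : nat -> nat) n : 0 < n ->
  \sum_(d <- divisors n) F d = \sum_(d < n.+1 | d %| n) F d.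
Proof.
move=> n0; rewrite -(big_mkord (fun d => d %| n)) -[RHS]big_filter; apply/perm_big/uniq_perm.
- exact: divisors_uniq.
- by rewrite filter_uniq ?iota_uniq.
move=> d; rewrite mem_filter mem_index_iota -dvdn_divisors// ltnS.
by case: (boolP (d %| n)) => // /dvdn_leq ->.
Qed.

Lemma cycle_order n (c c' : 'I_n.+1) : #[c]%g = #[c']%g -> <[c]>%g = <[c']>%g.
Proof.
move=> E; have cG : cyclic [set: 'I_n.+1]%G.
  by apply/cyclicP; exists Zp1; rewrite -Zp_cycle.
apply/eqP; rewrite (@eq_subG_cyclic _ [set: 'I_n.+1]%G <[c]>%G <[c']>%G cG) ?finset.subsetT//.
by rewrite -2!orderE E.
Qed.

Lemma order_Zp1_div n d : d %| n.+1 -> #[(Zp1 : 'I_n.+1) ^+ (n.+1 %/ d)]%g = d.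
Proof.
move=> dN; rewrite orderXdiv order_Zp1 ?dvdn_div//.
by rewrite divnA// mulKn.
Qed.

(** The elements of order [d] are the [totient d] generators of the unique subgroup of order [d], on
    which [F] is constant. *)
Lemma sum_cycles n (F : 'I_n.+1 -> nat) :
  (forall c c', <[c]>%g = <[c']>%g -> F c = F c') ->
  \sum_c F c = \sum_(d <- divisors n.+1) totient d * F (Zp1 ^+ (n.+1 %/ d))%g.
Proof.
move=> hF; have dG (c : 'I_n.+1) : #[c]%g %| n.+1.
  by rewrite -[X in _ %| X]card_ord -cardsT order_dvdG ?inE.
have dn (c : 'I_n.+1) : #[c]%g < n.+2 by rewrite ltnS dvdn_leq.
rewrite sum_divisors// (partition_big (fun c => Ordinal (dn c)) (fun d : 'I_n.+2 => d %| n.+1))//=.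
apply: eq_bigr => d dN; set y := (Zp1 ^+ _)%g.
have oy : #[y]%g = d := order_Zp1_div dN.
rewrite -[X in totient X]oy totient_gen -sum_nat_const; apply: eq_big => c.
  rewrite inE; apply/eqP/eqP => [/(congr1 val)/= E|E].
    by apply: cycle_order; rewrite oy E.
  by apply/val_inj; rewrite /= -oy !orderE E.
by move=> /eqP/(congr1 val)/= E; apply/hF/cycle_order; rewrite oy E.
Qed.

End Classes.

(** * Cyclic words of given sum, by Burnside's lemma *)

Section Necklaces.
Local Close Scope classical_set_scope.
Local Open Scope nat_scope.

(** Stars and bars. The bound [S] on the letters only provides a finite type: no letter exceeds the
    sum [s <= S]. *)
Lemma card_ffun_sum g s S : s <= S ->
  #|[set h : {ffun 'I_g.+1 -> 'I_S.+1} | \sum_x h x == s]%SET| = 'C(g + s, g).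
Proof.
move=> sS; have sS1 : s.+1 <= S.+1 by [].
rewrite -card_ord_partitions.
pose F (t : g.+1.-tuple 'I_s.+1) : {ffun 'I_g.+1 -> 'I_S.+1} :=
  [ffun x => widen_ord sS1 (tnth t x)].
have Fi : injective F.
  move=> t t' /ffunP E; apply: eq_from_tnth => x; apply/val_inj.
  by have := congr1 val (E x); rewrite !ffunE.
have sF t : \sum_x F t x = \sum_(x <- t) x.
  by rewrite [RHS]big_tuple; apply: eq_bigr => x _; rewrite ffunE.
rewrite -(card_imset _ Fi); apply: eq_card => h; apply/idP/imsetP; last first.
  by move=> [t]; rewrite !inE => tE ->; rewrite sF.
rewrite inE => /eqP hs; have hb x : h x < s.+1 by rewrite ltnS -hs (bigD1 x)//= leq_addr.
exists [tuple Ordinal (hb x) | x < g.+1].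
  by rewrite inE big_tuple; under eq_bigr do rewrite tnth_mktuple/=; rewrite hs.
by apply/ffunP => x; rewrite ffunE tnth_mktuple; apply/val_inj.
Qed.

Lemma sum_modn (F : nat -> nat) g d :
  \sum_(0 <= x < d * g) F (x %% g) = d * \sum_(0 <= x < g) F x.
Proof.
elim: d => [|d IH]; first by rewrite mul0n big_nil.
rewrite mulSn addnC (@big_cat_nat _ _ _ (d * g))//= ?leq_addr// IH mulSn addnC; congr addn.
rewrite -[X in \sum_(X <= _ < _) _]add0n big_addn addKn big_nat [RHS]big_nat.
by apply: eq_bigr => x xg; rewrite addnC modnMDl modn_small.
Qed.

Variables n S : nat.
Local Notation word := {ffun 'I_n.+1 -> 'I_S.+1}.

Definition turn_word (f : word) (c : 'I_n.+1) : word := [ffun x => f (x + c)%R].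

Lemma turn_word1 : turn_word^~ 1%g =1 id.
Proof. by move=> f; apply/ffunP => x; rewrite ffunE; congr (f _); exact: addr0. Qed.

Lemma turn_wordM f : act_morph turn_word f.
Proof.
move=> a b; apply/ffunP => x; rewrite !ffunE; congr (f _).
by rewrite -addrA [(b + a)%R]addrC.
Qed.

Definition turn_action : {action 'I_n.+1 &-> word} := TotalAction turn_word1 turn_wordM.

Definition words : {set word} := [set f : word | \sum_x f x == S]%SET.

Lemma sum_turn_word (f : word) c : \sum_x turn_word f c x = \sum_x f x.
Proof.
rewrite [RHS](reindex_inj (addIr c)).
by apply: eq_bigr => x _; rewrite ffunE.
Qed.

Lemma fixed_wordsP d (f : word) : d %| n.+1 ->
  reflect (forall x : 'I_n.+1, f (inZp (x %% (n.+1 %/ d))) = f x)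
    (f \in 'Fix_turn_action[(Zp1 ^+ (n.+1 %/ d))%g])%g.
Proof.
move=> dN; set g := n.+1 %/ d; set y := (Zp1 ^+ g)%g.
have yE : y = inZp g.
  by apply/val_inj; rewrite /y Zp_expg /= modnMml mul1n.
have gN : g * d = n.+1 by rewrite divnK.
apply: (iffP afix1P) => [h x|h]; last first.
  apply/ffunP => x; rewrite ffunE -h -[RHS]h; congr (f (inZp _)).
  have gd : g %| n.+1 by rewrite -gN dvdn_mulr.
  by rewrite yE /= modn_dvdm // -modnDmr modn_dvdm // modnn addn0.
have hm m : f (x + inZp (m * g))%R = f x.
  elim: m => [|m IH]; first by congr (f _); apply/val_inj; rewrite /= mod0n addn0 modn_small.
  rewrite -IH -{2}h ffunE; congr (f _).
  by rewrite yE -addrA; congr (x + _)%R; apply/val_inj; rewrite /= modnDm mulSn addnC.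
have g0 : 0 < g by case: (g) gN; rewrite ?mul0n.
have xd : x %/ g < d by rewrite ltn_divLR// mulnC gN.
rewrite -(hm (d - x %/ g)); congr (f _); apply/val_inj => /=.
rewrite modnDmr {2}(divn_eq x g) addnAC -mulnDl subnKC ?(ltnW xd)// [d * g]mulnC gN.
by rewrite modnDl.
Qed.

(** A fixed word is a word of length [n.+1 %/ d] repeated [d] times, so its sum is [d] times that of
    the shorter word. *)
Lemma card_fixed_words d : d %| n.+1 ->
  #|words :&: 'Fix_turn_action[(Zp1 ^+ (n.+1 %/ d))%g]%g| =
  if d %| S then 'C(S %/ d + n.+1 %/ d - 1, n.+1 %/ d - 1) else 0.
Proof.
move=> dN; set g := n.+1 %/ d; have gN : d * g = n.+1 by rewrite mulnC divnK.
have g0 : 0 < g by case: (g) gN; rewrite ?muln0.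
have d0 : 0 < d by case: (d) gN; rewrite ?mul0n.
have gE : g = g.-1.+1 by rewrite prednK.
pose L (h : {ffun 'I_g.-1.+1 -> 'I_S.+1}) : word := [ffun x : 'I_n.+1 => h (inord (x %% g))].
have xg (x : 'I_n.+1) : x %% g < g.-1.+1 by rewrite -gE ltn_mod.
have gn : g.-1.+1 <= n.+1 by rewrite -gE -gN leq_pmull.
have Li : injective L.
  move=> h h' /ffunP E; apply/ffunP => x; have := E (widen_ord gn x).
  by rewrite !ffunE /= modn_small ?inord_val// [X in _ < X]gE.
have Ls h : \sum_x L h x = d * \sum_x h x.
  pose F m : nat := h (inord m).
  transitivity (\sum_(0 <= x < d * g) F (x %% g)).
    by rewrite gN big_mkord; apply: eq_bigr => x _; rewrite ffunE.
  rewrite sum_modn [in \sum_(0 <= _ < g) _]gE big_mkord; congr (_ * _).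
  by apply: eq_bigr => x _; rewrite /F inord_val.
have -> : words :&: 'Fix_turn_action[(Zp1 ^+ g)%g]%g =
    L @: [set h : {ffun 'I_g.-1.+1 -> 'I_S.+1} | d * \sum_x h x == S]%SET.
  apply/setP => f; apply/setIP/imsetP => [[]|[h]].
    rewrite inE => fS /(fixed_wordsP _ dN) fx.
    pose h := [ffun x : 'I_g.-1.+1 => f (widen_ord gn x)].
    have fL : f = L h.
      apply/ffunP => x; rewrite !ffunE -fx; congr (f _); apply/val_inj => /=.
      by rewrite inordK// modn_small// (leq_trans (xg x)).
    by exists h; rewrite // inE -Ls -fL.
  rewrite inE => hS ->; split; first by rewrite inE Ls.
  apply/(fixed_wordsP _ dN) => x; rewrite !ffunE /=; congr (h (inord _)).
  rewrite (@modn_small (x %% g)) ?modn_mod//.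
  exact: leq_trans (xg x) gn.
rewrite (card_imset _ Li); case: ifP => dS; last first.
  apply: eq_card0 => h; rewrite inE; apply/negbTE; apply: contraFN dS => /eqP <-.
  exact: dvdn_mulr.
rewrite -addnBA// addnC subn1 -(@card_ffun_sum _ _ S) ?leq_div//; apply: eq_card => h; rewrite !inE.
by rewrite eqn_div// mulnC.
Qed.

Lemma card_necklaces : n.+1 * #|orbit turn_action [set: 'I_n.+1] @: words| =
  \sum_(d <- divisors n.+1 | d %| S)
    totient d * 'C(S %/ d + n.+1 %/ d - 1, n.+1 %/ d - 1).
Proof.
have act_words : [acts [set: 'I_n.+1], on words | turn_action].
  apply/actsP => c _ f; rewrite !inE; congr (_ == S); exact: sum_turn_word.
have := Frobenius_Cauchy act_words; rewrite cardsT card_ord mulnC => <-.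
under eq_bigl => c do rewrite inE.
rewrite (@sum_cycles _ (fun c => #|words :&: 'Fix_turn_action[c]%g|)); last first.
  by move=> c c' E; rewrite -!afix_cycle E.
rewrite [RHS]big_mkcond /=; apply: eq_big_seq => d; rewrite -dvdn_divisors// => dN.
by rewrite card_fixed_words//; case: ifP; rewrite ?muln0.
Qed.

End Necklaces.

(** * Classes of spaced sets as necklaces of gaps *)

Section SpacedClasses.
Local Close Scope classical_set_scope.
Local Open Scope nat_scope.
Variable k : nat.
Hypothesis k0 : 0 < k.

Section Words.
Variables n S : nat.
Local Notation word := {ffun 'I_n.+1 -> 'I_S.+1}.

Definition letters (f : word) : seq nat := [seq val (f x) | x <- enum 'I_n.+1].

Lemma size_letters f : size (letters f) = n.+1.
Proof. by rewrite size_map size_enum_ord. Qed.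

Lemma nth_letters f j : j < n.+1 -> nth 0 (letters f) j = f (inord j).
Proof.
move=> jn; rewrite (nth_map ord0) ?size_enum_ord//; congr (val (f _)).
by apply/val_inj; rewrite /= nth_enum_ord// inordK.
Qed.

Lemma letters_inj : injective letters.
Proof.
move=> f f' E; apply/ffunP => x; apply/val_inj.
by rewrite /= -{1}(inord_val x) -{2}(inord_val x) -!nth_letters// E.
Qed.

Lemma letters_turn f (c : 'I_n.+1) : letters (turn_word f c) = rot c (letters f).
Proof.
have cn := ltn_ord c.
apply: (@eq_from_nth _ 0) => [|j]; rewrite ?size_rot !size_letters// => jn.
rewrite nth_letters// ffunE nth_cat size_drop size_letters nth_drop.
case: ltnP => h.
  rewrite nth_letters; last by lia.
  by congr (val (f _)); apply/val_inj; rewrite /= !inordK ?modn_small//; lia.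
rewrite nth_take ?nth_letters; [|lia|lia].
congr (val (f _)); apply/val_inj; rewrite /= !inordK//; last by lia.
by rewrite (_ : j + c = j - (n.+1 - c) + n.+1) ?modnDr ?modn_small//; lia.
Qed.

Lemma sumn_letters f : sumn (letters f) = \sum_x f x.
Proof. by rewrite sumnE big_map big_enum. Qed.

Lemma letters_exist t : size t = n.+1 -> sumn t = S -> exists2 f, f \in words n S & letters f = t.
Proof.
move=> tn tS; pose f : word := [ffun x : 'I_n.+1 => inord (nth 0 t x)].
have fE : letters f = t.
  apply: (@eq_from_nth _ 0) => [|j]; rewrite size_letters ?tn// => jn.
  rewrite nth_letters// ffunE inordK// inordK// ltnS -tS.
  by rewrite sumnE (big_nth 0) big_mkord (bigD1 (Ordinal (etrans (congr1 _ tn) jn)))//= leq_addr.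
by exists f; rewrite // inE -sumn_letters fE tS.
Qed.

End Words.

(** A spaced set with [n.+1] elements is, up to translation, the start set of a word of [n.+1] gaps
    with total the uncovered length; translating start sets amounts to rotating words. *)
Lemma card_spaced_size M n : n.+1 * k <= M.+1 ->
  #|@translates M @: [set B : {set 'I_M.+1} | spaced k B && (#|B| == n.+1)]%SET| =
  #|orbit (turn_action n (M.+1 - n.+1 * k)) [set: 'I_n.+1] @: words n (M.+1 - n.+1 * k)|.
Proof.
move=> nk; set S := M.+1 - n.+1 * k; pose Bs f := start_set k M (@letters n S f).
have extent_l f : f \in words n S -> extent k (letters f) = M.+1.
  rewrite inE -sumn_letters => /eqP fS.
  by rewrite /extent fS size_letters mulnC subnK.
transitivity #|(@translates M \o Bs) @: words n S|.
  rewrite imset_comp; apply: eq_card => C; apply/imsetP/imsetP => -[B]; last first.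
    move=> /imsetP[f fS ->] ->; exists (Bs f) => //; rewrite inE.
    by rewrite spaced_start_set ?card_start_set ?size_letters ?extent_l ?eqxx.
  rewrite inE => /andP[sB /eqP Bn] ->.
  have kN : k <= M.+1 by apply: leq_trans nk; rewrite leq_pmull.
  have [|t [c [tN tn cE]]] := spaced_gaps k0 kN sB; first by rewrite Bn.
  have [||f fS fE] := @letters_exist n S t; first by rewrite tn.
    by move: tN; rewrite /extent tn Bn /S mulnC => <-; rewrite addnK.
  exists (Bs f); first exact: imset_f.
  by apply/translates_eq; exists c; rewrite cE /Bs fE.
apply: card_imset_eq => f f' fS fS' /=; split.
  move=> /translates_eq[c cE].
  have [||t1 [t2 [E1 E2]]] := translate_start_set k0 _ _ (esym cE).
  - exact: extent_l.
  - exact: extent_l.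
  apply/eqP; rewrite eq_sym; apply/eqP/orbit_eqP/orbitP.
  exists (inZp (size t1)); rewrite ?inE//=; apply: letters_inj; rewrite letters_turn E2 /=.
  have : size t1 <= n.+1 by rewrite -(size_letters f) E1 size_cat leq_addr.
  rewrite leq_eqVlt => /orP[/eqP E|lt]; last by rewrite modn_small// E1 rot_size_cat.
  rewrite E modnn rot0 E1; suff -> : t2 = [::] by rewrite cats0.
  by apply: size0nil; have := size_letters f; rewrite E1 size_cat; lia.
move=> E; have /orbitP[c _ /= cE] : f' \in orbit (turn_action n S) [set: 'I_n.+1] f.
  by rewrite E; apply: orbit_refl.
have lt := size_letters f.
apply/translates_eq; exists (inZp (extent k (drop c (letters f)))).
rewrite /Bs -cE letters_turn /rot -start_set_rot ?cat_take_drop ?extent_l//.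
Qed.

(** The class map is existential because [translates] lives on ordinals below a successor, a form
    that the product [N] does not have. *)
Theorem card_spaced_classes (N n : nat) : 0 < n -> N = 2 * n * k ->
  exists g : {set 'I_N} -> {set {set 'I_N}},
    (forall B B', g B = g B' <-> exists c, forall i j : 'I_N,
      j = i + c %[mod N] -> (i \in B) = (j \in B')) /\
    ((#|g @: [set B | spaced k B]%SET|)%:R = \sum_(0 <= i < (2 * n).+1)
      (if i == 0%N then 1
       else \sum_(d <- divisors i | (d %| (2 * n - i) * k)%N)
         (totient d)%:R / i%:R *
         'C((2 * n - i) * k %/ d + i %/ d - 1, i %/ d - 1)%:R) :> rat)%R.
Proof.
move=> n0 NE; have : 0 < N by rewrite NE !muln_gt0 n0.
case: N NE => [//|M] NE _.
have kN : k <= M.+1 by rewrite NE -[X in X <= _]mul1n leq_mul2r muln_gt0 n0 orbT.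
have card_bound (B : {set 'I_M.+1}) : spaced k B -> #|B| * k <= M.+1.
  move=> sB; case: (posnP #|B|) => [->//|B0].
  have [t [c [tN tn _]]] := spaced_gaps k0 kN sB B0.
  by rewrite mulnC -tn (leq_trans (leq_addl (sumn t) _)) // -tN.
have bound m : m * k <= M.+1 -> m <= 2 * n by rewrite NE leq_pmul2r.
exists (@translates M); split.
  move=> B B'; rewrite translates_eq; split=> [[c ->]|[c cE]].
    exists c => i j jE; rewrite in_translate; congr (_ \in B); apply/eqP.
    rewrite eq_sym subr_eq; apply/eqP/val_inj; rewrite /= -jE modn_small//.
  exists (inZp c); apply/setP => j; rewrite in_translate; symmetry; apply: cE.
  have {1}-> : j = (j - inZp c + inZp c)%R by rewrite subrK.
  by rewrite /= modn_mod modnDmr.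
rewrite (@card_imset_split _ _ _ _ (fun B : {set 'I_M.+1} => #|B|) (2 * n).+1); last 2 first.
- by move=> B B' _ _ /translates_eq[c ->]; rewrite card_translate.
- by move=> B; rewrite inE => /card_bound/bound.
rewrite natr_sum; apply: eq_big_nat => i /andP[_]; rewrite ltnS => ib.
case: i ib => [|i] ib.
  rewrite eqxx (_ : finset _ = [set finset.set0]%SET) ?imset_set1 ?cards1//.
  apply/setP => B; rewrite !inE finset.cards_eq0 andbC; case: eqP => // ->.
  by apply/forall_inP => x; rewrite inE.
have iN : i.+1 * k <= M.+1 by rewrite NE leq_mul2r ib orbT.
have -> : [set B in [set B : {set 'I_M.+1} | spaced k B] | #|B| == i.+1]%SET =
    [set B : {set 'I_M.+1} | spaced k B && (#|B| == i.+1)]%SET by apply/setP => B; rewrite !inE.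
rewrite (card_spaced_size iN).
have SE : M.+1 - i.+1 * k = (2 * n - i.+1) * k by rewrite NE mulnBl.
have i0 : (i.+1%:R != 0 :> rat)%R by rewrite pnatr_eq0.
apply: (mulfI i0); rewrite -natrM card_necklaces SE natr_sum /= mulr_sumr.
by apply: eq_bigr => d _; rewrite natrM mulrA mulrCA divff// mulr1.
Qed.

End SpacedClasses.

(** * Tilings with flipped blocks *)

Section AffineDeterminant.
Context {R : realType}.
Implicit Types (f g : R * R -> R * R).

(** Keeping the determinant, of either sign, as a parameter makes it multiplicative under
    composition with reflections; its sign separates mirror images from unmirrored tilings. *)
Definition affine_det f (D : R) := exists a b c d e g : R, D = a * d - b * c /\
  forall z, f z = (a * z.1 + b * z.2 + e, c * z.1 + d * z.2 + g).

Lemma affine_opP f : affine_op f <-> exists2 D, 0 < D & affine_det f D.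
Proof.
split.
  move=> [a [b [c [d [e [g [D0 fE]]]]]]]; exists (a * d - b * c) => //.
  by exists a, b, c, d, e, g.
by move=> [D D0 [a [b [c [d [e [g [DE fE]]]]]]]]; exists a, b, c, d, e, g; rewrite -DE.
Qed.

Lemma affine_comp f g (D D' : R) : affine_det f D -> affine_det g D' ->
  affine_det (f \o g) (D * D').
Proof.
move=> [a [b [c [d [e [h [DE fE]]]]]]] [a' [b' [c' [d' [e' [h' [DE' gE]]]]]]].
exists (a * a' + b * c'), (a * b' + b * d'), (c * a' + d * c'), (c * b' + d * d'),
  (a * e' + b * h' + e), (c * e' + d * h' + h).
split=> [|z]; first by rewrite DE DE'; ring.
by rewrite /= fE gE /=; congr pair; ring.
Qed.

Lemma affine_id : affine_det id 1.
Proof.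
exists 1, 0, 0, 1, 0, 0; split=> [|[x y]]; first by ring.
by rewrite /=; congr pair; ring.
Qed.

Lemma affine_improper f : improper f -> affine_det f (-1).
Proof.
move=> [C [S [t1 [t2 [E fE]]]]]; exists C, S, S, (- C), t1, t2.
split=> [|z]; first by rewrite -E; ring.
by rewrite fE mulNr.
Qed.

Lemma affine_rotation (t : R) p : affine_op (rotation t p).
Proof.
exists (cos t), (- sin t), (sin t), (cos t),
  (p.1 - cos t * p.1 + sin t * p.2), (p.2 - sin t * p.1 - cos t * p.2).
split=> [|z]; last by rewrite /rotation; congr pair; ring.
by have := cos2Dsin2 t; rewrite mulNr opprK -!expr2 => ->.
Qed.

Lemma affine_inv f : affine_op f -> exists2 g, affine_op g & cancel f g /\ cancel g f.
Proof.
move=> [a [b [c [d [e [h [D0 fE]]]]]]]; set D := a * d - b * c in D0.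
have DD : D != 0 by rewrite gt_eqF.
exists (fun z => (d / D * z.1 + - b / D * z.2 + (b * h - d * e) / D,
                  - c / D * z.1 + a / D * z.2 + (c * e - a * h) / D)).
  exists (d / D), (- b / D), (- c / D), (a / D), ((b * h - d * e) / D), ((c * e - a * h) / D).
  split => //; have -> : d / D * (a / D) - - b / D * (- c / D) = D^-1.
    by rewrite [in RHS](_ : D^-1 = D / D ^+ 2) /D; field.
  by rewrite invr_gt0.
by split => -[x y]; rewrite !fE /=; congr pair; rewrite /D; field.
Qed.

Lemma image_tilingK (f g : R * R -> R * R) T :
  cancel g f -> image_tiling f (image_tiling g T) = T.
Proof.
move=> fg; have K X : f @` (g @` X) = X.
  apply/seteqP; split => x; first by move=> [_ [y Xy <-] <-]; rewrite fg.
  by move=> Xx; exists (g x); rewrite ?fg//; exists x.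
apply/seteqP; split => X; first by move=> [_ [Y TY <-] <-]; rewrite K.
by move=> TX; exists (g @` X); rewrite ?K//; exists X.
Qed.

Lemma image_tiling_comp (f g : R * R -> R * R) T :
  image_tiling (f \o g) T = image_tiling f (image_tiling g T).
Proof.
apply/seteqP; split => X.
  by move=> [Y TY <-]; exists (g @` Y); [exists Y|rewrite image_comp].
by move=> [_ [Y TY <-] <-]; exists Y; rewrite // image_comp.
Qed.

Lemma same_tiling_refl (T : set (set (R * R))) : same_tiling T T.
Proof.
exists id; first by apply/affine_opP; exists 1; [exact: ltr01|exact: affine_id].
by rewrite /image_tiling; apply/seteqP; split => X;
  [move=> [Y TY <-]; rewrite image_id|exists X; rewrite ?image_id].
Qed.

Lemma same_tiling_sym (T T' : set (set (R * R))) : same_tiling T T' -> same_tiling T' T.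
Proof.
move=> [f /affine_inv[g ag [fg gf]] <-]; exists g => //; exact: image_tilingK.
Qed.

Lemma same_tiling_trans (T2 T1 T3 : set (set (R * R))) :
  same_tiling T1 T2 -> same_tiling T2 T3 -> same_tiling T1 T3.
Proof.
move=> [f /affine_opP[D D0 fD] <-] [g /affine_opP[D' D0' gD] <-].
exists (g \o f); last exact: image_tiling_comp.
by apply/affine_opP; exists (D' * D); [exact: mulr_gt0|exact: affine_comp].
Qed.

Lemma tiling_classes_count (P W : finType) (C : set (set (set (R * R)))) (D : {set P})
    (F : P -> set (set (R * R))) (g : P -> W) :
  (forall x, x \in D -> C (F x)) ->
  (forall T, C T -> exists2 x, x \in D & same_tiling (F x) T) ->
  (forall x y, x \in D -> y \in D -> same_tiling (F x) (F y) <-> g x = g y) ->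
  number_of_different_tilings C #|g @: D|.
Proof.
move=> CF FC Fg; pose cls T := [set T' | C T' /\ same_tiling T T'].
pose h w := if [pick x in D | g x == w] is Some x then cls (F x) else set0.
have clsE T T' : same_tiling T T' -> cls T = cls T'.
  move=> TT'; apply/seteqP; split => X [CX TX]; split => //.
    exact: same_tiling_trans (same_tiling_sym TT') TX.
  exact: same_tiling_trans TT' TX.
have hE x : x \in D -> h (g x) = cls (F x).
  move=> xD; rewrite /h; case: pickP => [y /andP[yD /eqP yx]|/(_ x)]; last by rewrite xD eqxx.
  by apply: clsE; apply/Fg.
have E : [set [set T' | C T' /\ same_tiling T T'] | T in C] = h @` [set` g @: D].
  apply/seteqP; split => X.
    move=> [T CT <-]; have [x xD xT] := FC T CT.
    by exists (g x); [exact: imset_f|rewrite hE// (clsE _ _ xT)].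
  by move=> [_ /imsetP[x xD ->] <-]; rewrite hE//; exists (F x) => //; exact: CF.
rewrite /number_of_different_tilings E; apply: (@card_eq_trans _ _ _ _ [set` g @: D]).
  apply: inj_card_eq => _ _ /set_mem/imsetP[x xD ->] /set_mem/imsetP[y yD ->].
  rewrite !hE// => xy; apply/Fg => //.
  have : cls (F x) (F y) by rewrite xy; split; [exact: CF|exact: same_tiling_refl].
  by case.
have -> : `I_#|g @: D| = (fun w => index w (enum (g @: D))) @` [set` g @: D].
  apply/seteqP; split => [i /= iD|_ [w wD <-]] /=.
    have [w0 _] : exists w0, w0 \in g @: D by apply/card_gt0P; exact: leq_ltn_trans iD.
    exists (nth w0 (enum (g @: D)) i); first by rewrite /= -mem_enum mem_nth// -cardE.
    by rewrite index_uniq// ?enum_uniq// -cardE.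
  by rewrite cardE index_mem mem_enum.
rewrite card_eq_sym; apply: inj_card_eq => x y /set_mem xD /set_mem yD.
by apply: (index_inj x); rewrite mem_enum.
Qed.

End AffineDeterminant.

(** * The tilings of the family and their equivalences *)

Section Tilings.
Context {R : realType}.
Variables (n k : nat).
Local Notation N := (2 * n * k)%N.
Local Notation a := (pi / (n * k)%:R : R).
Variables (e : R -> R * R) (p q : R * R) (V V' : set (R * R)).
Variables (u0 : R) (s : R * R -> R * R).
Hypotheses (n3 : (3 <= n)%N) (k0 : (0 < k)%N).
Hypotheses (HT : tile e p a V) (HT' : tile e p (k%:R * a) V').
Hypotheses (hu0 : 0 <= u0 <= 1) (qE : e u0 = q) (pq : p <> q).
Hypotheses (is_ : improper s) (sV : s @` closure V' = closure V').
Hypotheses (sp : s p = q) (sq : s q = p).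
Hypothesis swap : forall f, improper f -> involutive f ->
  f @` closure V' = closure V' -> f p = q.

Local Notation rt := (rt p a).
Local Notation irt := (irt p a).
Local Notation plain := (plain p a V).
Local Notation flip := (flip p a V s).

Let nk0 : ((n * k)%:R : R) != 0.
Proof. by rewrite pnatr_eq0; move: n3 k0; nia. Qed.

Let Na : N%:R * a = pi *+ 2.
Proof. by rewrite -mulnA natrM; move: ((n * k)%:R) nk0 => m m0; field. Qed.

Let Na' : (2 * n)%:R * (k%:R * a) = pi *+ 2.
Proof. by rewrite mulrA -natrM Na. Qed.

Let N4 : (3 < 2 * n)%N. Proof. by move: n3; lia. Qed.
Let N0 : (0 < N)%N. Proof. by move: n3 k0; nia. Qed.
Let ss : involutive s := sym_involutive pq is_ sp sq.

Definition ftile j i : set (R * R) := rt j @` (s @` plain i).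

Definition Tset (A : set 'I_N) : set (set (R * R)) := [set X |
  (exists2 m : 'I_N, (forall j, A j -> ~ in_block j m) & X = plain m) \/
  (exists j : 'I_N, exists2 i, (i < k)%N & A j /\ X = ftile j i)].

Lemma plain_mod i : plain (i %% N) = plain i.
Proof. by rewrite /plain (rt_mod p Na). Qed.

Lemma ftileE j i x : ftile j i x <-> closure V (irt i (s (irt j x))).
Proof.
split; first by move=> [_ [_ [y cy <-] <-] <-]; rewrite rtK ss rtK.
move=> cx; exists (irt j x); last by rewrite irtK.
by exists (s (irt j x)); [apply/plainE|rewrite ss].
Qed.

Lemma ftile0 j : ftile j 0 = flip j.
Proof.
rewrite /ftile /flip; congr (_ @` (_ @` _)).
by apply/seteqP; split => x; rewrite plainE /irt mul0r oppr0 rotation0.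
Qed.

(** Brought back to position 0, the reflection is an improper involution preserving the wedge, so by
    [swap] it exchanges [p] and [q]; it then agrees with [s] at two points. *)
Lemma block_reflection (j : nat) f :
  symmetry_reflection (rt j @` closure V') f -> f = rt j \o s \o irt j.
Proof.
move=> [x [y [xy fE fU]]]; have if_ : improper f by rewrite fE; exact: reflection_improper.
have fI : involutive f by rewrite fE; exact: reflection_involutive.
pose g := irt j \o f \o rt j.
have ig : improper g by exact: improper_rotr (improper_rotl _ _ if_).
have gI : involutive g by move=> z; rewrite /g /= irtK fI rtK.
have gp : g p = q.
  apply: swap => //; apply/seteqP; split => z.
    move=> [w cw <-]; have : (f @` (rt j @` closure V')) (f (rt j w)).
      by exists (rt j w) => //; exists w.
    by rewrite fU => -[v cv vE]; rewrite /g /= -vE rtK.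
  move=> cz; have : (rt j @` closure V') (rt j z) by exists z.
  by rewrite -fU => -[_ [v cv <-] vE]; exists v; rewrite // /g /= vE rtK.
have gs : g = s.
  by apply: (improper_eq ig is_ pq); rewrite ?gp ?sp// -gp gI gp sq.
by apply/funext => z; rewrite /= -gs /g /= !irtK.
Qed.

Lemma flipped_tilingE (A : set 'I_N) (f : 'I_N -> R * R -> R * R) :
  (forall j, A j -> symmetry_reflection (rotation (angle R n k j) p @` closure V') (f j)) ->
  flipped_tiling p (closure V) A f = Tset A.
Proof.
move=> hf; have E (j m : 'I_N) i : A j -> (i < k)%N -> nat_of_ord m = ((j + i) %% N)%N ->
    f j @` T0_tile n k p (closure V) m = ftile j i.
  move=> Aj ik mE; rewrite (block_reflection (hf j Aj)).
  have -> : T0_tile n k p (closure V) m = plain (j + i) by rewrite -plain_mod -mE.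
  apply/seteqP; split => x.
    move=> [_ [y cy <-] <-]; apply/ftileE.
    by rewrite /= rtK ss -rtD rtK rtK.
  move=> /ftileE cx; exists (rt j (s (irt j x))); last by rewrite /= rtK ss irtK.
  apply/plainE; move: cx; congr (closure V _).
  by rewrite /irt /rt !rotationD natrD; congr rotation; ring.
apply/seteqP; split => X; (case=> H; [by left|right]).
  by move: H => [j [m [Aj [i ik mE] ->]]]; exists j, i => //; rewrite (E j m i).
move: H => [j [i ik [Aj ->]]]; have mN : ((j + i) %% N < N)%N by rewrite ltn_mod.
by exists j, (Ordinal mN); split => //; [exists i|rewrite (E j (Ordinal mN) i)].
Qed.

Lemma reflection_block (j : nat) :
  symmetry_reflection (rt j @` closure V') (rt j \o s \o irt j).
Proof.
have ig : improper (rt j \o s \o irt j) by exact: improper_rotr (improper_rotl _ _ is_).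
pose m := ((p.1 + q.1) / 2, (p.2 + q.2) / 2).
have sm : s m = m.
  by apply: (improper_equidist is_ pq) => //; rewrite /d2 /dot /m /=; field.
have [|y xy E] := @improper_reflection _ _ (rt j m) ig.
  by rewrite /= rtK sm.
exists (rt j m), y; split => //; rewrite -sV; apply/seteqP; split => x.
  move=> [_ [_ [z cz <-] <-] <-]; rewrite /= rtK ss; exists z => //; rewrite -sV.
  by exists (s z); rewrite ?ss// -sV; exists z.
move=> [_ [z cz <-] <-]; exists (rt j z); last by rewrite /= rtK.
by exists z => //; exists (s z); rewrite ?ss// -sV; exists z.
Qed.

Lemma is_flipped_tilingE T : is_flipped_tiling n k p (closure V') (closure V) T <->
  exists2 A : set 'I_N, disjoint_blocks A & T = Tset A.
Proof.
split=> [[A [f [dA fA ->]]]|[A dA ->]].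
  by exists A; rewrite // (flipped_tilingE fA).
exists A, (fun j => rt j \o s \o irt j); split => //.
  by move=> j _; exact: reflection_block.
by rewrite flipped_tilingE// => j _; exact: reflection_block.
Qed.

Let disk : set (R * R) := [set z | d2 z p <= d2 (e 1) p].

Lemma tile_in_disk (b : R) W M : tile e p b W -> M%:R * b = pi *+ 2 ->
  closure W `<=` disk.
Proof.
move=> HW Mb x /(closure_piece0 p b)/closure_d2 cx; rewrite /disk /= leNgt; apply/negP => hx.
have [r r0 hr] := open_d2P (@open_outer _ p (d2 (e 1) p)) hx.
have [y py yx] := cx r r0.
by have := piece_inner HW Mb (N_gt0 Mb) py; rewrite ltNge ltW// hr.
Qed.

(** Flipping preserves the region of a block, so the union does not depend on [A] and equivalences
    must preserve the disk. *)
Lemma union_Tset A : \bigcup_(X in Tset A) X = disk.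
Proof.
apply/seteqP; split => x.
  move=> [X + Xx]; case=> [[m _ XE]|[j [i ik [_ XE]]]].
    move: Xx; rewrite XE => /plainE /(tile_in_disk HT Na).
    by rewrite /disk /= d2_rotationp.
  move: Xx; rewrite XE => /ftileE cx.
  have : closure V' (s (irt j x)).
    by apply/(closure_subdivision HT Na HT' Na'); exists i => //; apply/closure_piece.
  move=> h; have : closure V' (irt j x) by rewrite -sV; exists (s (irt j x)); rewrite ?ss.
  by move=> /(tile_in_disk HT' Na'); rewrite /disk /= d2_rotationp.
move=> /(disk_covered HT Na)[i iN /closure_piece ci].
have [[j [Aj [l lk jE]]]|nb] := pselect (exists j, A j /\ in_block j (Ordinal iN)).
  have cj : closure V' (irt j x).
    apply/(closure_subdivision HT Na HT' Na'); exists l => //; apply/closure_piece.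
    have : plain i x by apply/plainE.
    have -> : i = ((j + l) %% N)%N by exact: jE.
    rewrite plain_mod => /plainE; congr (closure V _).
    by rewrite /irt rotationD natrD; congr rotation; ring.
  have : closure V' (s (irt j x)) by rewrite -sV; exists (irt j x).
  move=> /(closure_subdivision HT Na HT' Na')[i' ik' /closure_piece ci'].
  exists (ftile j i'); last exact/ftileE.
  by right; exists j, i'.
exists (plain i); last exact/plainE.
left; exists (Ordinal iN) => // j Aj hj; apply: nb; by exists j.
Qed.

Lemma plain_center m : plain m p.
Proof.
apply/plainE; rewrite irtp.
have fp : frame e p a p by apply: Or31; exists 0; [lra|exact: tile_start HT].
by case/(frameE HT): fp.
Qed.

Lemma flip_center j : flip j p.
Proof.
apply/(@flipE _ p q _ V s pq is_ sp sq); rewrite irtp sp.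
have fp : frame e p a q by apply: Or31; exists u0.
by case/(frameE HT): fp.
Qed.

(** A tile of a flipped block contains [p] when its preimage contains [q], and by [q_tile] only the
    first thin tile does. *)
Lemma Tset_center A X : Tset A X -> X p ->
  (exists2 m : 'I_N, (forall j, A j -> ~ in_block j m) & X = plain m) \/
  (exists2 j : 'I_N, A j & X = flip j).
Proof.
case=> [H|[j [[|i] ik [Aj XE]]]]; first by left.
  by move=> _; right; exists j; rewrite // XE ftile0.
rewrite XE => /ftileE; rewrite irtp sp => h; exfalso.
have h' : closure (piece_of p a V i.+1) q by apply/closure_piece.
exact: (q_tile HT Na HT' Na' N4 k0 hu0 qE pq _ ik h').
Qed.

Lemma Tset_has_center A : exists2 X, Tset A X & X p.
Proof.
have [[j Aj]|nA] := pselect (exists j, A j).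
  exists (flip j); last exact: flip_center.
  by right; exists j, 0%N; rewrite // ftile0.
exists (plain (Ordinal N0)); last exact: plain_center.
by left; exists (Ordinal N0) => // j Aj; case: nA; exists j.
Qed.

Let rt_eq i j : rt i = rt j -> (i = j %[mod N])%N :=
  @rt_eq_mod _ e p q a V V' N (2 * n) k u0 HT Na HT' Na' N4 k0 hu0 qE pq i j.

Let no_plain_flip b i j : (1 < k)%N -> rotation b p @` plain i = flip j -> False :=
  @rot_plain_flip _ e p q a V V' N (2 * n) k u0 s HT Na HT' Na' N4 k0 hu0 qE pq
    is_ sV sp sq b i j.

Lemma ftile_mod j i : ftile (j %% N) i = ftile j i.
Proof. by rewrite /ftile (rt_mod p Na). Qed.

Lemma flip_mod j : flip (j %% N) = flip j.
Proof. by rewrite -!ftile0 ftile_mod. Qed.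

Lemma rt_plain c m : rt c @` plain m = plain (m + c).
Proof.
rewrite /plain image_comp; congr (image _ _).
by apply/funext => z; rewrite /= rtD addnC.
Qed.

Lemma rt_ftile c j i : rt c @` ftile j i = ftile (j + c) i.
Proof.
rewrite /ftile image_comp; congr (image _ _).
by apply/funext => z; rewrite /= rtD addnC.
Qed.

Lemma rt_flip c j : rt c @` flip j = flip (j + c).
Proof. by rewrite -!ftile0 rt_ftile. Qed.

Definition shifted c (A B : set 'I_N) :=
  forall i j : 'I_N, (j = i + c %[mod N])%N -> (A i <-> B j).

Lemma shiftedV c A B : shifted c A B -> shifted (N - c %% N) B A.
Proof.
move=> h i j jE; have cN : (c %% N < N)%N by rewrite ltn_mod.
symmetry; apply: h; rewrite -modnDmr -[in RHS]modnDml jE modnDml.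
by rewrite -addnA subnK ?modnDr// ltnW.
Qed.

Let rtV c z : rt c (rt (N - c %% N) z) = z.
Proof.
have cN : (c %% N < N)%N by rewrite ltn_mod.
by rewrite -(rt_mod p Na c) rtD addnC subnK ?(rtN p Na)// ltnW.
Qed.

Lemma shift_tile c A B X : shifted c A B -> Tset A X -> Tset B (rt c @` X).
Proof.
move=> AB [[m nb ->]|[j [i ik [Aj ->]]]]; last first.
  have jN : ((j + c) %% N < N)%N by rewrite ltn_mod.
  right; exists (Ordinal jN), i => //; split; last by rewrite rt_ftile ftile_mod.
  by apply/(AB j) => //=; rewrite modn_mod.
have mN : ((m + c) %% N < N)%N by rewrite ltn_mod.
left; exists (Ordinal mN); last by rewrite rt_plain plain_mod.
move=> j Bj [l lk mE]; have jN : ((j + (N - c %% N)) %% N < N)%N by rewrite ltn_mod.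
have cN : (c %% N < N)%N by rewrite ltn_mod.
apply: (nb (Ordinal jN)).
  by apply: (proj1 (@shiftedV _ _ _ AB j (Ordinal jN) _) Bj); rewrite /= modn_mod.
exists l => //=; rewrite modnDml addnAC -modnDml -mE /= modnDml -addnA.
by rewrite -modnDmr -(modnDml c) subnKC 1?ltnW// modnn addn0 modn_small.
Qed.

Lemma shift_Tset c A B : shifted c A B -> image_tiling (rt c) (Tset A) = Tset B.
Proof.
move=> AB; apply/seteqP; split => X.
  by move=> [Y TY <-]; exact: shift_tile TY.
move=> TX; exists (rt (N - c %% N) @` X); first exact: shift_tile (shiftedV AB) TX.
rewrite image_comp -[RHS]image_id; congr (image _ _).
by apply/funext => z /=; rewrite rtV.
Qed.

Lemma flip_Tset (A : set 'I_N) (j : 'I_N) : (1 < k)%N -> Tset A (flip j) <-> A j.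
Proof.
move=> k1; split=> [TA|Aj]; last by right; exists j, 0%N; rewrite // ftile0.
have r0 X : rotation 0 p @` X = X.
  by rewrite -[RHS]image_id; congr (image _ _); apply/funext => z; rewrite rotation0.
case: (Tset_center TA (flip_center j)) => [[m _ jm]|[i Ai ji]].
  by case: (@no_plain_flip 0 m j k1); rewrite r0.
have E : rt j = rt i.
  have := @rot_flip _ e p q a V N (2 * n) k u0 s HT Na Na' N4 k0 hu0 qE pq is_ sp sq 0 j i.
  by rewrite r0 addr0; apply.
have := rt_eq E; rewrite !modn_small// => /val_inj ij; by rewrite ij.
Qed.

(** A single tile at [p] and its image identify the rotation: both are unflipped or both are
    flipped, so it agrees with some [rt c]. The translated set is then recovered through
    [flip_Tset]. *)
Lemma rotation_Tset A B b : (1 < k)%N -> image_tiling (rotation b p) (Tset A) = Tset B ->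
  exists c, shifted c A B.
Proof.
move=> k1 E; have [X TX Xp] := Tset_has_center A.
have TfX : Tset B (rotation b p @` X) by rewrite -E; exists X.
have fXp : (rotation b p @` X) p by exists p; rewrite ?rotation_center.
have K (i j : nat) : rotation (i%:R * a + b) p = rt j -> rotation b p = rt (j + (N - i %% N)).
  move=> h; apply/funext => z; rewrite -[z in LHS](rtV i) rotationD addrC h.
  by rewrite rtD.
have [c cE] : exists c, rotation b p = rt c.
  have V1 Y Z : rotation b p @` Y = Z -> rotation (- b) p @` Z = Y.
    move=> <-; rewrite image_comp -[RHS]image_id; congr (image _ _).
    by apply/funext => z /=; rewrite rotationK.
  case: (Tset_center TX Xp) => [[m _ XE]|[i _ XE]];
    case: (Tset_center TfX fXp) => [[m' _]|[i' _]]; rewrite XE => YE.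
  - exists (m' + (N - m %% N))%N; apply: K.
    exact: (@rot_plain _ e p a V N (2 * n) k u0 HT Na Na' N4 k0 hu0 b m m').
  - by case: (no_plain_flip k1 YE).
  - by case: (no_plain_flip k1 (V1 _ _ YE)).
  - exists (i' + (N - i %% N))%N; apply: K.
    exact: (@rot_flip _ e p q a V N (2 * n) k u0 s HT Na Na' N4 k0 hu0 qE pq is_ sp sq).
exists c => i j jE; have FE : rt c @` flip i = flip j.
  by rewrite rt_flip -flip_mod -jE modn_small.
rewrite -!flip_Tset//; split=> h.
  by rewrite -E cE; exists (flip i).
move: h; rewrite -E cE => -[Y TY]; rewrite -FE => YE.
suff -> : flip i = Y by [].
have inj : injective (rt c) := @rotation_inj _ _ _.
apply/seteqP; split => x Hx.
  have : (rt c @` Y) (rt c x) by rewrite YE; exists x.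
  by move=> [y Yy /inj <-].
have : (rt c @` flip i) (rt c x) by rewrite -YE; exists x.
by move=> [y Yy /inj <-].
Qed.
Lemma flip_plain j : k = 1%N -> flip j = plain j.
Proof.
move=> k1; have VV : closure V' = closure V.
  apply/seteqP; split => z.
    move=> /(closure_subdivision HT Na HT' Na')[i]; rewrite {1}k1 ltnS leqn0 => /eqP->.
    exact: (proj2 (closure_piece0 _ _ V z)).
  move=> cz; apply/(closure_subdivision HT Na HT' Na'); exists 0%N => //.
  exact: (proj1 (closure_piece0 _ _ V z)).
by rewrite /flip /plain -VV sV.
Qed.

Lemma improper_Tset A B f : improper f -> f p = p ->
  image_tiling f (Tset A) = Tset B -> False.
Proof.
move=> if_ fp E; have [X TX Xp] := Tset_has_center A.
have fI : involutive f := improper_involutive if_ fp.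
have TfX : Tset B (f @` X) by rewrite -E; exists X.
have fXp : (f @` X) p by exists p.
have V1 Y Z : f @` Y = Z -> f @` Z = Y.
  move=> <-; rewrite image_comp -[RHS]image_id; congr (image _ _).
  by apply/funext => z /=; rewrite fI.
have PP i j : f @` plain i = plain j -> False.
  exact: (@refl_plain _ e p q a V V' N (2 * n) k u0 HT Na HT' Na' N4 k0 hu0 qE pq swap).
have [k1|k1] := ltnP 1 k; last first.
  have k1' : k = 1%N by apply/eqP; rewrite eqn_leq k1 k0.
  by case: (Tset_center TX Xp) => [[m _ XE]|[i _ XE]];
    case: (Tset_center TfX fXp) => [[m' _]|[i' _]]; rewrite XE ?(flip_plain _ k1') => /PP.
case: (Tset_center TX Xp) => [[m _ XE]|[i _ XE]];
  case: (Tset_center TfX fXp) => [[m' _]|[i' _]]; rewrite XE => YE.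
- exact: PP YE.
- exact: (@refl_plain_flip _ e p q a V V' N (2 * n) k u0 s HT Na HT' Na' N4 k0 hu0 qE pq
    is_ sV sp sq f m i' k1 if_ fp YE).
- exact: (@refl_plain_flip _ e p q a V V' N (2 * n) k u0 s HT Na HT' Na' N4 k0 hu0 qE pq
    is_ sV sp sq f m' i k1 if_ fp (V1 _ _ YE)).
- exact: (@refl_flip _ e p q a V V' N (2 * n) k u0 s HT Na HT' Na' N4 k0 hu0 qE pq
    is_ sV sp sq f i i' k1 if_ fp YE).
Qed.

Lemma image_tiling_disk (A B : set 'I_N) f :
  image_tiling f (Tset A) = Tset B -> f @` disk = disk.
Proof.
move=> E; rewrite -[in LHS](union_Tset A) -(union_Tset B) -E.
apply/seteqP; split => x.
  by move=> [y [X TX Xy] <-]; exists (f @` X); exists X || exists y.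
by move=> [_ [X TX <-] [y Xy <-]]; exists y => //; exists X.
Qed.

Lemma affine_Tset A B f D : affine_det f D -> D <> 0 ->
  image_tiling f (Tset A) = Tset B -> 0 < D /\ exists b, f = rotation b p.
Proof.
move=> [a1 [b1 [c1 [d1 [e1 [g1 [DE fE]]]]]]] D0 E.
have fD := image_tiling_disk E; rewrite DE in D0 *.
have fp := affine_disk_center (r2_gt0 HT) fE fD.
case: (affine_disk_isometry (r2_gt0 HT) D0 fE fD) => -[] // _ if_.
by case: (improper_Tset if_ fp E).
Qed.

Local Notation m0 := (reflection p q).

(** One fixed mirror represents them all, since two reflections in lines through [p] differ by an
    orientation preserving map. *)
Definition mirrored (c : bool) T := if c then image_tiling m0 T else T.

Let m0K : involutive m0 := reflection_involutive pq.

Lemma mirroredE (c : bool) : exists f, [/\ affine_det f ((-1) ^+ c), involutive f &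
  forall T', mirrored c T' = image_tiling f T'].
Proof.
case: c; first by exists m0; split => //; rewrite expr1; exact/affine_improper/reflection_improper.
exists id; split => //; first exact: affine_id.
by move=> T' /=; rewrite /image_tiling; apply/seteqP; split => X;
  [exists X; rewrite ?image_id|move=> [Y TY <-]; rewrite image_id].
Qed.

(** Undoing the mirrors leaves an affine map between unmirrored tilings with determinant
    [(-1) ^+ c' * D * (-1) ^+ c]; it must be positive, which forces [c = c']. *)
Lemma same_mirrored c c' A B : same_tiling (mirrored c (Tset A)) (mirrored c' (Tset B)) ->
  c = c' /\ ((1 < k)%N -> exists i, shifted i A B).
Proof.
move=> [f /affine_opP[D D0 fD]].
have [g [gD gI ->]] := mirroredE c; have [h [hD hI ->]] := mirroredE c'.
move=> E; have {}E : image_tiling (h \o f \o g) (Tset A) = Tset B.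
  by rewrite (image_tiling_comp (h \o f)) (image_tiling_comp h) E image_tilingK.
have FD : affine_det (h \o f \o g) ((-1) ^+ c' * D * (-1) ^+ c).
  exact: affine_comp (affine_comp hD fD) gD.
have [|D1 [b bE]] := affine_Tset FD _ E.
  by move/eqP; rewrite !mulf_eq0 !signr_eq0 /= orbF => /eqP; have := D0; lra.
split; last by move=> k1; apply: (@rotation_Tset A B b k1); rewrite -E bE.
by move: c c' D1 {E gD hD FD} => [] [] //=; rewrite ?expr0 ?expr1; have := D0; lra.
Qed.

Lemma mirrored_same c f A B : affine_op f -> image_tiling f (Tset A) = Tset B ->
  same_tiling (mirrored c (Tset A)) (mirrored c (Tset B)).
Proof.
move=> /affine_opP[D D0 fD] E; have [g [gD gI gE]] := mirroredE c.
exists (g \o f \o g); last first.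
  by rewrite !gE (image_tiling_comp (g \o f)) (image_tiling_comp g) (image_tilingK _ gI) E.
apply/affine_opP; exists D => //; have := affine_comp (affine_comp gD fD) gD.
by rewrite mulrAC -expr2 sqrr_sign mul1r.
Qed.

Lemma C_familyE T : C_family n k p (closure V') (closure V) T ->
  exists c (A : set 'I_N), disjoint_blocks A /\ same_tiling (mirrored c (Tset A)) T.
Proof.
case=> [/is_flipped_tilingE[A dA ->]|[_ [b [/is_flipped_tilingE[A dA ->] bp ->]]]].
  by exists false, A; split => //; exact: same_tiling_refl.
exists true, A; split => //; exists (reflection p b \o m0); last first.
  by rewrite /= (image_tiling_comp (reflection p b)) (image_tilingK _ m0K).
apply/affine_opP; exists 1 => //.
have -> : 1 = -1 * -1 :> R by ring.
by apply: affine_comp; apply/affine_improper/reflection_improper => // /esym.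
Qed.

Lemma mirrored_C_family c (A : set 'I_N) : disjoint_blocks A ->
  C_family n k p (closure V') (closure V) (mirrored c (Tset A)).
Proof.
move=> dA; case: c => /=; last by left; apply/is_flipped_tilingE; exists A.
right; exists (Tset A), q; split => //; last by move/esym.
by apply/is_flipped_tilingE; exists A.
Qed.

Lemma disjoint_blocks_spaced (B : {set 'I_N}) :
  disjoint_blocks [set` B] <-> spaced k B.
Proof.
have wrap (x d : nat) : (x < N)%N -> (d < N)%N -> ((x + d) %% N + (N - x))%N = d %[mod N].
  by move=> xN dN; rewrite modnDml addnAC subnKC 1?ltnW// modnDl.
split=> [dB|/forall_inP sB].
  apply/forall_inP => x xB; apply/forall_inP => y yB; apply/implyP => xy.
  rewrite leqNgt; apply/negP => lt; move: xy; rewrite (dB x y y) ?eqxx//.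
    exists ((y + (N - x)) %% N)%N => //.
    by rewrite modnDmr addnCA subnKC 1?ltnW// modnDr modn_small.
  by exists 0%N; rewrite ?addn0 ?modn_small.
have key (x y : 'I_N) (i j : nat) : x \in B -> y \in B -> (i < k)%N -> (j <= i)%N ->
    (x + i = y + j %[mod N])%N -> x = y.
  move=> xB yB ik ji E; apply/eqP; apply/negPn/negP => xy.
  have := forall_inP (sB x xB) y yB; rewrite xy /= leqNgt => /negP; apply.
  have kN : (k <= N)%N by rewrite leq_pmull// muln_gt0; have := n3; lia.
  have dN : (i - j < N)%N by lia.
  have yE : nat_of_ord y = ((x + (i - j)) %% N)%N.
    rewrite -[LHS](@modn_small _ N)//; apply/eqP; rewrite -(eqn_modDr j) -addnA subnK//.
    by rewrite E.
  by rewrite yE wrap// modn_small//; lia.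
move=> x y m xB yB [i ik mi] [j jk mj].
have E : (x + i = y + j %[mod N])%N by rewrite -mi -mj.
have [ji|ij] := leqP j i; first exact: key E.
by symmetry; apply: (key y x j i) => //; exact: ltnW.
Qed.

Lemma Tset_single_block (A B : set 'I_N) : k = 1%N -> Tset A = Tset B.
Proof.
suff H A' B' X : k = 1%N -> Tset A' X -> Tset B' X.
  by move=> k1; apply/seteqP; split => X; exact: H.
move=> k1; have mem m : Tset B' (plain m).
  rewrite -plain_mod; have mN : (m %% N < N)%N by rewrite ltn_mod.
  have [Bm|nBm] := pselect (B' (Ordinal mN)).
    by right; exists (Ordinal mN), 0%N => //; split => //; rewrite ftile0 flip_plain.
  left; exists (Ordinal mN) => // j Bj [i ik /= mE]; apply: nBm.
  suff -> : Ordinal mN = j by [].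
  apply/val_inj => /=; rewrite mE; move: ik; rewrite {1}k1 ltnS leqn0 => /eqP->.
  by rewrite addn0 modn_small.
case=> [[m _ ->]|[j [i ik [_ ->]]]]; first exact: mem.
have -> : i = 0%N by move: ik; rewrite {1}k1 ltnS leqn0 => /eqP.
by rewrite ftile0 flip_plain.
Qed.

Lemma count_tilings_single : k = 1%N ->
  number_of_different_tilings (C_family n k p (closure V') (closure V)) 2.
Proof.
move=> k1; have <- : #|id @: [set: bool]%SET| = 2%N by rewrite imset_id cardsT card_bool.
have d0 : @disjoint_blocks n k set0 by move=> ? ? ? [].
apply: (@tiling_classes_count _ _ _ _ _ (fun c => mirrored c (Tset set0))).
- by move=> c _; exact: mirrored_C_family.
- move=> T /C_familyE[c [A [_ cT]]]; exists c; first by rewrite inE.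
  by rewrite (Tset_single_block _ A k1).
- move=> c c' _ _; split=> [/same_mirrored[]//|->]; exact: same_tiling_refl.
Qed.

Lemma count_tilings : (1 < k)%N -> exists m : nat,
  number_of_different_tilings (C_family n k p (closure V') (closure V)) m /\
  m%:R = 2 * \sum_(0 <= i < (2 * n).+1)
    (if i == 0%N then 1
     else \sum_(d <- divisors i | (d %| (2 * n - i) * k)%N)
       (totient d)%:R / i%:R *
       'C((2 * n - i) * k %/ d + i %/ d - 1, i %/ d - 1)%:R) :> rat.
Proof.
move=> k1; have n0 : (0 < n)%N by have := n3; lia.
have [g [gE <-]] := card_spaced_classes k0 n0 (erefl N).
pose D := finset.setX [set: bool]%SET [set B : {set 'I_N} | spaced k B]%SET.
pose G (x : bool * {set 'I_N}) := (x.1, g x.2).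
exists #|G @: D|; split; last first.
  have -> : G @: D = finset.setX [set: bool]%SET (g @: [set B | spaced k B]%SET).
    apply/setP => -[c C]; rewrite !inE /=; apply/imsetP/imsetP.
      by move=> [[c' B]]; rewrite !inE /= => sB [_ ->]; exists B; rewrite ?inE.
    by move=> [B]; rewrite inE => sB ->; exists (c, B); rewrite ?inE.
  by rewrite cardsX cardsT card_bool natrM.
apply: (@tiling_classes_count _ _ _ _ D (fun x => mirrored x.1 (Tset [set` x.2])) G).
- move=> [c B]; rewrite !inE /= => sB.
  by apply: mirrored_C_family; apply/disjoint_blocks_spaced.
- move=> T /C_familyE[c [A [dA cT]]]; pose B := [set j : 'I_N | `[< A j >]]%SET.
  have AB : A = [set` B] by apply/seteqP; split => j /=; rewrite inE => /asboolP.
  exists (c, B) => /=; last by rewrite -AB.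
  by rewrite !inE /=; apply/disjoint_blocks_spaced; rewrite -AB.
move=> [c B] [c' B'] _ _; rewrite /G /=; split.
  move=> /same_mirrored[-> /(_ k1)[i iE]]; congr (_, _); apply/gE; exists i => x y xy.
  by apply/idP/idP => h; apply/(iE x y xy).
move=> [-> /gE[i iE]].
apply: (@mirrored_same c' (rt i) [set` B] [set` B'] (affine_rotation _ _)).
by apply: shift_Tset => x y xy; rewrite /= (iE x y xy).
Qed.

End Tilings.

(** * The number of tilings in the family of a symmetric wedge *)

Theorem proposition5p1 (R : realType) (n k : nat) (t : R) (p q : R * R)
    (eta nu : R -> R * R) (U Uk : set (R * R))
    (n_ge3 : (3 <= n)%N) (n_odd : odd n) (k_ge1 : (1 <= k)%N)
    (t_range : 0 <= t < 1)
    (scale_pq : sup (groove_lengths n p q) = 1)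
    (U_wedge : symmetric_n_wedge n eta p nu q U)
    (U_groove : has_groove_length eta q t)
    (Uk_tile : radial_tile eta p (pi / (n * k)%:R) Uk) :
  (k = 1%N -> number_of_different_tilings (C_family n k p U Uk) 2) /\
  ((2 <= k)%N ->
     exists m : nat,
       number_of_different_tilings (C_family n k p U Uk) m /\
       m%:R = 2 * \sum_(0 <= i < (2 * n).+1)
         (if i == 0%N then 1
          else \sum_(d <- divisors i | (d %| (2 * n - i) * k)%N)
            (totient d)%:R / i%:R *
            'C((2 * n - i) * k %/ d + i %/ d - 1, i %/ d - 1)%:R) :> rat).
Proof.
have [[Uw pq Up Uq] [_ [c [d [cd -> sU]]]]] := U_wedge.
have only_pq x : radially_generated U x -> x = p \/ x = q.
  have [p' [q' [pq' gen]]] := Uw.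
  have /gen hp : radially_generated U p by exists eta, (pi / n%:R).
  have /gen hq : radially_generated U q by exists nu, (pi / n%:R).
  by move=> /gen; case: hp pq => -> pq0; case: hq pq0 => -> // _ []; auto.
have nk0 : (n * k)%:R != 0 :> R by rewrite pnatr_eq0 muln_eq0; lia.
have k0 : k%:R != 0 :> R by rewrite pnatr_eq0; lia.
have n0 : n%:R != 0 :> R by rewrite pnatr_eq0; lia.
have aE : pi / n%:R = k%:R * (pi / (n * k)%:R) :> R by rewrite natrM; field; rewrite k0.
have [V HT UkE] := radial_tile_tile Uk_tile.
have [V' HT' UE] := radial_tile_tile Up; rewrite aE in HT'.
have [[u0 /= + qE] _] := U_groove; rewrite in_itv/= => hu0.
have qE' : clamped eta u0 = q by rewrite clamped_id.
have Na' : (2 * n)%:R * (k%:R * (pi / (n * k)%:R)) = pi *+ 2 :> R.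
  by rewrite -aE natrM; field.
have N4 : (3 < 2 * n)%N by lia.
(* By [image_radial_tile], [f] sends generating points of the wedge to generating points, so it
   permutes [p] and [q]; [symmetry_not_fix] forbids fixing both. *)
have swap f : improper f -> involutive f -> f @` closure V' = closure V' -> f p = q.
  move=> if_ fI fV.
  have gen e x : radial_tile e x (pi / n%:R) U -> f x = p \/ f x = q.
    move=> /(image_radial_tile if_ fI); rewrite UE fV -UE => h.
    by apply: only_pq; do 2!eexists; exact: h.
  have [fp|//] := gen _ _ Up.
  have [fq|fq] := gen _ _ Uq; first by case: pq; rewrite -(fI q) fq fp.
  by case: (symmetry_not_fix HT' Na' N4 hu0 qE' pq if_ fV fp fq).
set s := reflection c d in sU.
have is_ : improper s := reflection_improper cd.
have ss : involutive s := reflection_involutive cd.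
have sV : s @` closure V' = closure V' by rewrite -UE.
have sp : s p = q by exact: swap.
have sq : s q = p by rewrite -sp ss.
rewrite UkE UE; split=> [k1|k1].
  exact: (count_tilings_single n_ge3 k_ge1 HT HT' hu0 qE' pq is_ sV sp sq swap).
exact: (count_tilings n_ge3 k_ge1 HT HT' hu0 qE' pq is_ sV sp sq swap k1).
Qed.
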